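(* There exists a positive integer $\kappa_4$ such that the following holds. If $(G,\sigma)$ is a connected signed graph with smallest eigenvalue at least $-3$ and minimum valency at least $\kappa_4$, then the lattice $\Lambda(G,\sigma)$ associated with $(G,\sigma)$ is (isomorphic to) a sublattice of a direct sum of a standard lattice $\mathbb{Z}^n$ and copies of the root lattice $E_8$, i.e. of $\mathbb{Z}^n\oplus E_8^{\oplus k}$ for some non-negative integers $n,k$. Furthermore, there exist infinitely many connected signed graphs with smallest eigenvalue at least $-3$ containing $(G,\sigma)$ as a proper induced subgraph, and thus $(G,\sigma)$ is extendable.
   Context: All graphs are finite, undirected, simple and non-empty. A signed graph $(G,\sigma)$ is a graph $G=(V(G),E(G))$ together with a function $\sigma:E(G)\to\{+,-\}$. It is connected if $G$ is connected, and the valency of a vertex $x$ is its number of neighbours in $G$ (regardless of signs). The induced subgraph of $(G,\sigma)$ on $U\subseteq V(G)$ is the signed graph with vertex set $U$, all edges of $G$ inside $U$, and the restricted signs. The adjacency matrix $A(G,\sigma)$ is the symmetric matrix indexed by $V(G)$ whose $(x,y)$-entry is $1$ if $\{x,y\}\in E(G)$ with $\sigma(\{x,y\})=+$, is $-1$ if $\{x,y\}\in E(G)$ with $\sigma(\{x,y\})=-$, and is $0$ otherwise. The eigenvalues of $(G,\sigma)$ are those of $A(G,\sigma)$. Associated lattice: let $\lambda$ be the smallest eigenvalue of $(G,\sigma)$. The matrix $A(G,\sigma)-\lfloor\lambda\rfloor\mathbf{I}$ is positive semidefinite, so it equals $N^TN$ for some real matrix $N$. The integral lattice generated (over $\mathbb{Z}$)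 by the columns of $N$ is denoted $\Lambda(G,\sigma)$; up to isomorphism (isometry) it does not depend on the choice of $N$. ''Direct sum'' means orthogonal direct sum. Extendability: a connected signed graph $(G,\sigma)$ with smallest eigenvalue $\lambda$ is non-extendable if there is no connected signed graph $(G',\sigma')$ such that (i) $(G,\sigma)$ is a proper induced subgraph of $(G',\sigma')$ and (ii) the smallest eigenvalue of $(G',\sigma')$ is at least $\lfloor\lambda\rfloor$. It is extendable if it is not non-extendable. The root lattice $E_8$ is $D_8\cup(\mathbf{c}+D_8)\subset\mathbb{R}^8$, where $D_8=\{\mathbf{x}\in\mathbb{Z}^8\mid \sum_{i=1}^8 x_i \text{ is even}\}$ and $\mathbf{c}=\frac12(1,1,1,1,1,1,1,1)^T$. *)

(* Defs.v *)
From HB Require Import structures.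
From mathcomp Require Import all_boot all_order all_algebra.
From mathcomp Require Import all_classical all_reals all_analysis.
From mathcomp Require Import ring lra.
Set Implicit Arguments.
Unset Strict Implicit.
Unset Printing Implicit Defensive.
Import Order.TTheory GRing.Theory Num.Theory.
Import numFieldNormedType.Exports.
Local Open Scope classical_set_scope.
Local Open Scope ring_scope.

(* Only the values of [sg_pos] on edges matter: every notion below, including
   isomorphism, ignores the values of [sg_pos] on non-adjacent pairs. *)
Record signed_graph := SignedGraph {
  sg_vertex :> finType;
  sg_adj : rel sg_vertex;
  sg_pos : rel sg_vertex;
  sg_adj_irr : irreflexive sg_adj;
  sg_adj_sym : symmetric sg_adj;
  sg_pos_sym : symmetric sg_pos;
  sg_nonempty : (0 < #|sg_vertex|)%N }.

Definition sg_connected (G : signed_graph) : Prop :=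
  forall x y : G, connect (@sg_adj G) x y.

Definition valency (G : signed_graph) (x : G) : nat :=
  #|[set y : G | sg_adj x y]%SET|.

Definition sg_iso (G H : signed_graph) : Prop :=
  exists f : G -> H,
    [/\ bijective f,
        forall x y, sg_adj (f x) (f y) = sg_adj x y
      & forall x y, sg_adj x y -> sg_pos (f x) (f y) = sg_pos x y].

Section Induced.
Variables (G : signed_graph) (U : {set G}) (U0 : U != finset.set0).

Let indV : finType := {x : G | x \in U}.

Let induced_adj (x y : indV) := sg_adj (val x) (val y).
Let induced_pos (x y : indV) := sg_pos (val x) (val y).

Fact induced_adj_irr : irreflexive induced_adj.
Proof. by move=> x; exact: sg_adj_irr. Qed.

Fact induced_adj_sym : symmetric induced_adj.
Proof. by move=> x y; exact: sg_adj_sym. Qed.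

Fact induced_pos_sym : symmetric induced_pos.
Proof. by move=> x y; exact: sg_pos_sym. Qed.

Fact induced_nonempty : (0 < #|indV|)%N.
Proof. by rewrite card_sig card_gt0. Qed.

Definition sg_induced : signed_graph :=
  SignedGraph induced_adj_irr induced_adj_sym induced_pos_sym induced_nonempty.

End Induced.

Definition sg_proper_induced (G H : signed_graph) : Prop :=
  exists (U : {set H}) (U0 : U != finset.set0),
    U \proper [set: H]%SET /\ sg_iso G (sg_induced U0).

Definition adj_mx (R : pzRingType) (G : signed_graph) : 'M[R]_#|G| :=
  \matrix_(i, j)
    if sg_adj (enum_val i) (enum_val j) then
      if sg_pos (enum_val i) (enum_val j) then 1 else -1
    else 0.

(* This infimum is a minimum: see [smallest_eigenvalueP] below. *)
Definition smallest_eigenvalue (R : realType) (G : signed_graph) : R :=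
  inf [set a : R | eigenvalue (adj_mx R G) a].

Definition sg_non_extendable (R : realType) (G : signed_graph) : Prop :=
  ~ exists H : signed_graph,
      [/\ sg_connected H, sg_proper_induced G H
        & (Num.floor (smallest_eigenvalue R G))%:~R <= smallest_eigenvalue R H].

Definition sg_extendable (R : realType) (G : signed_graph) : Prop :=
  ~ sg_non_extendable R G.

(* A lattice in the Euclidean space R^n is represented by its set of vectors. *)

Definition dotp (R : pzRingType) (n : nat) (u v : 'cV[R]_n) : R :=
  \sum_i u i 0 * v i 0.

Definition column_lattice (R : pzRingType) (m n : nat) (N : 'M[R]_(m, n)) :
    set 'cV[R]_m :=
  range (fun z : 'cV[int]_n => N *m map_mx intr z).

(* [L] is one of the mutually isometric realizations of the lattice associated
   with [G]; realizations exist by [associated_lattice_exists] below. *)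
Definition associated_lattice (R : realType) (G : signed_graph) (m : nat)
    (L : set 'cV[R]_m) : Prop :=
  exists2 N : 'M[R]_(m, #|G|),
    adj_mx R G - (Num.floor (smallest_eigenvalue R G))%:~R%:M = N^T *m N
    & L = column_lattice N.

Definition sublattice (R : pzRingType) (n : nat) (L M : set 'cV[R]_n) : Prop :=
  [/\ L `<=` M, L 0 & forall u v, L u -> L v -> L (u - v)].

Definition lattice_iso (R : pzRingType) (m n : nat)
    (L : set 'cV[R]_m) (M : set 'cV[R]_n) : Prop :=
  exists f : 'cV[R]_m -> 'cV[R]_n,
    [/\ set_bij L M f,
        forall u v, L u -> L v -> f (u + v) = f u + f v
      & forall u v, L u -> L v -> dotp (f u) (f v) = dotp u v].

Definition Zlattice (R : pzRingType) (n : nat) : set 'cV[R]_n :=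
  range (fun z : 'cV[int]_n => map_mx intr z).

Arguments Zlattice R n : clear implicits.

Definition D8 (R : pzRingType) : set 'cV[R]_8 :=
  [set map_mx intr z | z in [set z : 'cV[int]_8 | (2 %| \sum_i z i 0)%Z]].

Arguments D8 R : clear implicits.

Definition E8 (R : unitRingType) : set 'cV[R]_8 :=
  D8 R `|` [set const_mx 2^-1 + x | x in D8 R].

Arguments E8 R : clear implicits.

Definition lattice_dsum (R : pzRingType) (m n : nat)
    (L : set 'cV[R]_m) (M : set 'cV[R]_n) : set 'cV[R]_(m + n) :=
  [set v | L (usubmx v) /\ M (dsubmx v)].

Definition lattice_copies (R : pzRingType) (m : nat) (L : set 'cV[R]_m)
    (k : nat) : set 'cV[R]_(\sum_(i < k) m) :=
  [set v | forall i, L (submxcol v i)].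

Arguments lattice_copies {R m} L k.

(* The remaining lemmas are not used in the definitions: they show that
   [smallest_eigenvalue] is attained and that [associated_lattice] is
   inhabited, so that neither degenerates. *)

Definition qform (R : pzRingType) n (B : 'M[R]_n) (v : 'rV[R]_n) : R :=
  (v *m B *m v^T) 0 0.

Lemma qformD (R : comPzRingType) n (B : 'M[R]_n) (v w : 'rV[R]_n) :
  B^T = B -> qform B (v + w) = qform B v + (v *m B *m w^T) 0 0 *+ 2 + qform B w.
Proof.
move=> sB; rewrite /qform linearD /= !mulmxDl !mulmxDr.
have E (a b : 'M[R]_1) : (a + b) 0 0 = a 0 0 + b 0 0 by rewrite mxE.
rewrite !E //.
have -> : (w *m B *m v^T) 0 0 = (v *m B *m w^T) 0 0.
  transitivity ((v *m B *m w^T)^T 0 0); last by rewrite mxE.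
  by rewrite !trmx_mul trmxK sB mulmxA.
by rewrite mulr2n !addrA.
Qed.

Lemma qformZ (R : comPzRingType) n (B : 'M[R]_n) a (v : 'rV[R]_n) :
  qform B (a *: v) = a ^+ 2 * qform B v.
Proof. by rewrite /qform linearZ /= -!scalemxAl -scalemxAr !mxE mulrA expr2. Qed.

Lemma qform_scalar (R : comPzRingType) n a (v : 'rV[R]_n) :
  qform a%:M v = a * qform 1%:M v.
Proof. by rewrite /qform mulmx1 mul_mx_scalar -scalemxAl mxE. Qed.

Lemma qformB (R : comPzRingType) n (A B : 'M[R]_n) (v : 'rV[R]_n) :
  qform (A - B) v = qform A v - qform B v.
Proof. by rewrite /qform mulmxBr mulmxBl !mxE. Qed.

Lemma qform1 (R : comPzRingType) n (v : 'rV[R]_n) :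
  qform 1%:M v = \sum_i v 0 i ^+ 2.
Proof. by rewrite /qform mulmx1 mxE; apply: eq_bigr => i _; rewrite mxE expr2. Qed.

Lemma qform1_gt0 (R : realFieldType) n (v : 'rV[R]_n) :
  v != 0 -> 0 < qform 1%:M v.
Proof.
move=> v0; rewrite lt_neqAle qform1 sumr_ge0 ?andbT; last by move=> *; exact: sqr_ge0.
apply: contra v0 => /eqP/esym/psumr_eq0P h; apply/eqP/rowP => i.
by apply/eqP; rewrite mxE -sqrf_eq0 h // => j _; exact: sqr_ge0.
Qed.

Lemma lin_quad0 (R : realFieldType) (b c : R) :
  (forall t, 0 <= t * b *+ 2 + t ^+ 2 * c) -> b = 0.
Proof.
move=> h; case: (eqVneq b 0) => // b0.
have d0 : 0 < `|c| + 1 by rewrite ltr_wpDl.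
have := h (- (b / (`|c| + 1))).
have := ler_norm c; set d := `|c| in d0 *  => cd.
have -> : - (b / (d + 1)) * b *+ 2 + (- (b / (d + 1))) ^+ 2 * c =
   (b / (d + 1)) ^+ 2 * (c - (d + 1) *+ 2) by field; rewrite gt_eqF.
rewrite pmulr_rge0; last by rewrite exprn_even_gt0 //= mulf_neq0 // invr_neq0 // gt_eqF.
by lra.
Qed.

Lemma psd_ker (R : realFieldType) n (B : 'M[R]_n) (v : 'rV[R]_n) :
  B^T = B -> (forall w, 0 <= qform B w) -> qform B v = 0 -> v *m B = 0.
Proof.
move=> sB B0 Bv; apply/rowP => j; rewrite [RHS]mxE.
set w := delta_mx 0 j : 'rV[R]_n.
have -> : (v *m B) 0 j = (v *m B *m w^T) 0 0.
  by rewrite /w trmx_delta -colE [RHS]mxE.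
apply: (@lin_quad0 _ _ (qform B w)) => t.
have := B0 (v + t *: w); rewrite qformD // Bv qformZ add0r.
by rewrite linearZ /= -scalemxAr mxE.
Qed.

Lemma qform_continuous (R : realType) n (B : 'M[R]_n) :
  continuous (qform B : 'rV[R]_n -> R).
Proof.
have -> : qform B = (fun v => \sum_j (\sum_i v 0 i * B i j) * v 0 j).
  apply/funext => v; rewrite /qform mxE; apply: eq_bigr => j _.
  by rewrite !mxE.
apply: continuous_big => [|j _ v]; first exact: add_continuous.
apply: continuousM; last exact: coord_continuous.
apply: (@continuous_big _ _ _ _ _ _ _ _ (fun i (v : 'rV[R]_n) => v 0 i * B i j)) => [|i _ w]; first exact: add_continuous.
by apply: continuousM; [exact: coord_continuous|exact: cst_continuous].
Qed.

Lemma rayleigh (R : realType) n (B : 'M[R]_n) : (0 < n)%N -> B^T = B ->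
  exists2 mu, eigenvalue B mu & forall v, 0 <= qform (B - mu%:M) v.
Proof.
move=> n0 sB.
pose S := [set v : 'rV[R]_n | qform 1%:M v = 1].
have S0 : S !=set0.
  exists (delta_mx 0 (Ordinal n0)); rewrite /S /= qform1 (bigD1 (Ordinal n0)) //=.
  rewrite mxE !eqxx expr1n big1 ?addr0 // => i /negbTE i0.
  by rewrite mxE i0 andbF expr0n.
have cS : compact S.
  apply: bounded_closed_compact.
    exists 1; split=> // M M1 v Sv.
    apply: le_trans (ltW M1); rewrite [leLHS]/Num.norm /= mx_normrE.
    apply/bigmax_leP; split=> // -[i j] _ /=; rewrite ord1.
    rewrite -(@ler_pXn2r _ 2) ?nnegrE // expr1n -Sv qform1 (bigD1 j) //=.
    by rewrite -normrX ger0_norm ?sqr_ge0 // lerDl sumr_ge0 // => *; exact: sqr_ge0.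
  have -> : S = qform 1%:M @^-1` [set x | x = 1] by [].
  by apply: preimage_closed => [v _|]; [exact: qform_continuous|exact: closed_eq].
have [|c + minc] := @EVT_min_rV R n (qform B) S S0 cS.
  by apply: continuous_subspaceT; exact: qform_continuous.
rewrite inE /S /= => Sc; set mu := qform B c in minc.
have psd v : 0 <= qform (B - mu%:M) v.
  have [->|/qform1_gt0 v0] := eqVneq v 0.
    by rewrite /qform !mul0mx mxE.
  have s0 := sqrtr_gt0 (qform 1%:M v); rewrite v0 in s0.
  have := minc ((Num.sqrt (qform 1%:M v))^-1 *: v).
  rewrite inE /S /= !qformZ exprVn sqr_sqrtr; last exact: ltW.
  rewrite mulVf ?gt_eqF // => /(_ erefl).
  by rewrite [_^-1 * _]mulrC ler_pdivlMr // qformB (qform_scalar mu) subr_ge0.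
exists mu => //; apply/eigenvalueP; exists c; last first.
  by apply/eqP => c0; move: Sc; rewrite c0 /qform !mul0mx mxE => /esym/eqP; rewrite oner_eq0.
apply/eqP; rewrite -mul_mx_scalar -subr_eq0 -mulmxBr; apply/eqP/psd_ker => //.
  by rewrite linearB /= sB tr_scalar_mx.
by rewrite qformB qform_scalar Sc mulr1 subrr.
Qed.

Lemma adj_mx_sym (R : pzRingType) (G : signed_graph) :
  (adj_mx R G)^T = adj_mx R G.
Proof.
by apply/matrixP => i j; rewrite !mxE sg_adj_sym sg_pos_sym.
Qed.

Lemma eigenvalue_ge (R : realFieldType) n (B : 'M[R]_n) (mu a : R) :
  (forall v, 0 <= qform (B - mu%:M) v) -> eigenvalue B a -> mu <= a.
Proof.
move=> psd /eigenvalueP[v va v0]; have := psd v.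
have -> : qform (B - mu%:M) v = (a - mu) * qform 1%:M v.
  rewrite qformB (qform_scalar mu) mulrBl /qform va mulmx1.
  by rewrite -scalemxAl mxE.
by rewrite pmulr_lge0 ?qform1_gt0 // subr_ge0.
Qed.

Lemma smallest_eigenvalueE (R : realType) (G : signed_graph) mu :
  eigenvalue (adj_mx R G) mu ->
  (forall v, 0 <= qform (adj_mx R G - mu%:M) v) ->
  smallest_eigenvalue R G = mu.
Proof.
move=> emu psd.
have lb : lbound [set a | eigenvalue (adj_mx R G) a] mu.
  by move=> a /=; exact: eigenvalue_ge.
apply/eqP; rewrite eq_le; apply/andP; split.
  by apply: ge_inf => //; exists mu.
by apply: lb_le_inf => //; exists mu.
Qed.

Lemma smallest_eigenvalue_psd (R : realType) (G : signed_graph) v :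
  0 <= qform (adj_mx R G - (smallest_eigenvalue R G)%:M) v.
Proof.
have [mu emu psd] := rayleigh (sg_nonempty G) (adj_mx_sym R G).
by rewrite (smallest_eigenvalueE emu psd).
Qed.

Lemma smallest_eigenvalueP (R : realType) (G : signed_graph) :
  eigenvalue (adj_mx R G) (smallest_eigenvalue R G) /\
  forall a, eigenvalue (adj_mx R G) a -> smallest_eigenvalue R G <= a.
Proof.
have [mu emu psd] := rayleigh (sg_nonempty G) (adj_mx_sym R G).
rewrite (smallest_eigenvalueE emu psd); split=> // a.
exact: eigenvalue_ge.
Qed.

Lemma psd_gram (R : rcfType) n (B : 'M[R]_n) : B^T = B ->
  (forall v, 0 <= qform B v) -> exists N : 'M[R]_n, B = N^T *m N.
Proof.
elim: n => [|n IH] in B *; first by move=> _ _; exists 0; apply/matrixP => -[].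
rewrite -[n.+1]/(1 + n)%N in B * => sB psd.
pose a := B 0 0; pose b := ursubmx B.
have BE : B = block_mx a%:M b b^T (drsubmx B).
  rewrite -[LHS]submxK; congr block_mx; first by rewrite [LHS]mx11_scalar !mxE; congr (B _ _)%:M; apply: val_inj.
  by rewrite /b trmx_ursub sB.
have sC : (drsubmx B)^T = drsubmx B by rewrite trmx_drsub sB.
set C := drsubmx B in BE sC.
have qE (x : R) (w : 'rV_n) : qform B (row_mx x%:M w) =
    x ^+ 2 * a + (x * (b *m w^T) 0 0) *+ 2 + qform C w.
  rewrite /qform BE mul_row_block tr_row_mx mul_row_col !mulmxDl.
  rewrite tr_scalar_mx !mul_scalar_mx !mul_mx_scalar -!scalemxAl.
  have -> : w *m b^T = (b *m w^T)^T by rewrite trmx_mul trmxK.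
  by rewrite !mxE eqxx /= mulr1n; ring.
have a0 : 0 <= a.
  have := psd (row_mx 1%:M 0); rewrite qE /qform !mul0mx trmx0 mulmx0.
  by rewrite [(0 : 'M[R]_(_, _)) 0 0]mxE expr1n mul1r mulr0 mul0rn !addr0.
case: (eqVneq a 0) => [az|an].
  have b0 : b = 0.
    apply/rowP => j; rewrite [RHS]mxE.
    have -> : b 0 j = (b *m (delta_mx 0 j : 'rV_n)^T) 0 0.
      by rewrite trmx_delta -colE [RHS]mxE.
    apply: (@lin_quad0 _ _ (qform C (delta_mx 0 j))) => t.
    have := psd (row_mx 1%:M (t *: delta_mx 0 j)).
    by rewrite qE az mulr0 add0r mul1r linearZ /= -scalemxAr mxE qformZ.
  have [||N' CE] := IH C => //.
    by move=> w; have := psd (row_mx 0%:M w); rewrite qE expr0n /= !mul0r mul0rn !add0r.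
  exists (block_mx 0 0 0 N').
  by rewrite {1}BE az b0 CE tr_block_mx mulmx_block !trmx0 !mul0mx !mulmx0 !add0r -scalemx1 scale0r.
have ap : 0 < a by rewrite lt_neqAle eq_sym an.
pose C' := C - a^-1 *: (b^T *m b).
have [||N' CE] := IH C'.
- by rewrite /C' linearB linearZ /= trmx_mul trmxK sC.
- move=> w; have := psd (row_mx (- (a^-1 * (b *m w^T) 0 0))%:M w).
  rewrite qE /C' qformB.
  have -> : qform (a^-1 *: (b^T *m b)) w = a^-1 * ((b *m w^T) 0 0) ^+ 2.
    rewrite /qform -scalemxAr -scalemxAl mxE; congr (_ * _).
    have -> : w *m (b^T *m b) *m w^T = (b *m w^T)^T *m (b *m w^T).
      by rewrite trmx_mul trmxK !mulmxA.
    by rewrite [LHS]mxE big_ord1 [_^T _ _]mxE expr2.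
  set t := (b *m w^T) 0 0; set q := qform C w.
  suff -> : (- (a^-1 * t)) ^+ 2 * a + (- (a^-1 * t) * t) *+ 2 + q = q - a^-1 * t ^+ 2 by [].
  by field; exact: an.
exists (block_mx (Num.sqrt a)%:M ((Num.sqrt a)^-1 *: b) 0 N').
have sa : Num.sqrt a != 0 by rewrite gt_eqF // sqrtr_gt0.
rewrite {1}BE tr_block_mx mulmx_block !trmx0 !mul0mx !mulmx0 !addr0.
have -> : ((Num.sqrt a)^-1 *: b)^T = (Num.sqrt a)^-1 *: b^T.
  by apply/matrixP => i k; rewrite !mxE.
rewrite tr_scalar_mx -CE -!scalemxAl -!scalemxAr.
rewrite !mul_scalar_mx !mul_mx_scalar !scalerA mulVf // !scale1r.
rewrite scale_scalar_mx -expr2 sqr_sqrtr // -invfM -expr2 sqr_sqrtr //.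
by rewrite /C' addrC subrK.
Qed.

Lemma associated_lattice_exists (R : realType) (G : signed_graph) :
  exists (m : nat) (L : set 'cV[R]_m), associated_lattice G L.
Proof.
set c : R := (Num.floor (smallest_eigenvalue R G))%:~R.
have [||N NE] := @psd_gram R _ (adj_mx R G - c%:M).
- by rewrite linearB /= adj_mx_sym tr_scalar_mx.
- move=> v; have := smallest_eigenvalue_psd v; rewrite !qformB (qform_scalar c) (qform_scalar (smallest_eigenvalue R G)).
  move/le_trans; apply; rewrite lerD2l lerN2 ler_wpM2r ?floor_le //.
  by rewrite qform1 sumr_ge0 // => *; exact: sqr_ge0.
by exists #|G|, (column_lattice N); exists N.
Qed.

(* Main.v *)
Require Import Defs.
From mathcomp Require Import all_boot all_order all_algebra.
From mathcomp Require Import all_classical all_reals all_analysis.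
From mathcomp Require Import fintype finset ring lra zify.
Import Order.TTheory GRing.Theory Num.Theory.
Set Implicit Arguments. Unset Strict Implicit. Unset Printing Implicit Defensive.
Local Open Scope ring_scope.

(** Let [- m] be the floor of the smallest eigenvalue of the signed graph, so that
[1 <= m <= 3] and [A], the adjacency matrix plus [m], is the Gram matrix of
vectors of norm [m]. The idea is to split this Gram matrix into a part of rank
one summands with integer entries, which is realized in some [Z^s], and a rest
[B] with diagonal at most 2, which is realized by [Z^d] and copies of [E8] as in
the classification of root lattices.

Limit vectors. By Ramsey's theorem, a vertex of large valency has a large clique
[Y] (up to switching) among its neighbours. The average over a part of [Y] tends
to a unit vector when the part grows, and as products are integers, the product
of a fixed vertex with the average is constant, in [{-1, 0, 1}], but for boundedly
many members of [Y]. So the limit vector has a well-defined integer product with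
all vertices, and two limit vectors are equal up to sign or orthogonal. The limit
vectors are not combinations of vertices, so [A] minus the projections to them is
not obviously positive semidefinite; but by [limit_vectors] it is nonnegative on
integer vectors of bounded size, the bound being as large as wanted if the
valencies are large. Each vertex has product plus or minus 1 with some limit
vector, so that the diagonal of the rest [B] is at most 2.

From short vectors to local positivity. Only finitely many matrices of a given
size [N] have such diagonal entries and are nonnegative on short vectors, so that
[B] is positive semidefinite on vectors supported by [N] elements
([locally_psd_of_norm1]).

Local positivity suffices ([representable_of_locally_psd]). In a connected
component of [B], take a maximal connected subset [S] represented by integer
vectors, and an element [t] next to it. If [S] occupies many coordinates, then the
projections of [t] to bounded subsets of [S] have entries close to integers, and
the roundings fit together to a vector that represents [t]
([rounded_vector]). If [S] occupies few coordinates, it is itself bounded, and [t]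
can be projected to its span. Either the representation extends to [t], possibly
after a reflection, or the entries of the projection show that [t] and combinations
of [S] form a basis of [E6] ([few_step]). In the latter case the basis is extended
to [E7] and [E8] as long as possible, and in the end the elements of the component
differ by null vectors from their projections, which lie in [E8] ([e8_component]).
In particular [B] turns out to be positive semidefinite everywhere.

The lattice of the graph depends on the Gram matrix only, up to isometry, which
gives the first claim. For the second, let [phi] be the products with one limit
vector. New vertices that are pairwise adjacent and joined to [x] with the sign
[phi x] extend the Gram matrix to a positive semidefinite one because
[A - phi phi^T] is positive semidefinite ([smallest_eigenvalue_extension]); their
number is arbitrary, and the case of a single new vertex shows extendability. *)

(** * Bilinear forms *)

Definition bform (R : comPzRingType) n (B : 'M[R]_n) (u v : 'rV[R]_n) : R :=
  (u *m B *m v^T) 0 0.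

Section BilinearForm.
Variables (R : comPzRingType) (n : nat) (B : 'M[R]_n).
Implicit Types u v w : 'rV[R]_n.

Lemma bformDl u v w : bform B (u + v) w = bform B u w + bform B v w.
Proof. by rewrite /bform !mulmxDl mxE. Qed.

Lemma bformDr u v w : bform B w (u + v) = bform B w u + bform B w v.
Proof. by rewrite /bform linearD mulmxDr mxE. Qed.

Lemma bformZl a u w : bform B (a *: u) w = a * bform B u w.
Proof. by rewrite /bform -!scalemxAl mxE. Qed.

Lemma bformZr a u w : bform B w (a *: u) = a * bform B w u.
Proof. by rewrite /bform linearZ /= -scalemxAr mxE. Qed.

Lemma bformNl u w : bform B (- u) w = - bform B u w.
Proof. by rewrite -scaleN1r bformZl mulN1r. Qed.

Lemma bformNr u w : bform B w (- u) = - bform B w u.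
Proof. by rewrite -scaleN1r bformZr mulN1r. Qed.

Lemma bform0l w : bform B 0 w = 0.
Proof. by rewrite /bform !mul0mx mxE. Qed.

Lemma bform0r w : bform B w 0 = 0.
Proof. by rewrite /bform trmx0 mulmx0 mxE. Qed.

Lemma bform_suml (I : Type) (r : seq I) (P : pred I) (F : I -> 'rV[R]_n) w :
  bform B (\sum_(i <- r | P i) F i) w = \sum_(i <- r | P i) bform B (F i) w.
Proof.
by apply: (big_morph (fun u => bform B u w)) => [u v|]; [exact: bformDl|exact: bform0l].
Qed.

Lemma bform_sumr (I : Type) (r : seq I) (P : pred I) (F : I -> 'rV[R]_n) w :
  bform B w (\sum_(i <- r | P i) F i) = \sum_(i <- r | P i) bform B w (F i).
Proof.
by apply: (big_morph (bform B w)) => [u v|]; [exact: bformDr|exact: bform0r].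
Qed.

Lemma bform_deltar u j : bform B u (delta_mx 0 j) = (u *m B) 0 j.
Proof. by rewrite /bform trmx_delta -colE mxE. Qed.

Lemma bform_delta i j : bform B (delta_mx 0 i) (delta_mx 0 j) = B i j.
Proof. by rewrite bform_deltar -rowE mxE. Qed.

Lemma bform_deltarE u j : bform B u (delta_mx 0 j) = \sum_i u 0 i * B i j.
Proof. by rewrite bform_deltar mxE. Qed.

Lemma bformE u v : bform B u v = \sum_j v 0 j * \sum_i u 0 i * B i j.
Proof.
rewrite {1}[v]row_sum_delta bform_sumr; apply: eq_bigr => j _.
by rewrite bformZr bform_deltarE.
Qed.

Hypothesis sB : B^T = B.

Lemma bformC u v : bform B u v = bform B v u.
Proof.
transitivity ((u *m B *m v^T)^T 0 0); first by rewrite [RHS]mxE.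
by rewrite !trmx_mul trmxK sB mulmxA.
Qed.

Lemma bform_lin2 a b u v : bform B (a *: u + b *: v) (a *: u + b *: v) =
  a ^+ 2 * bform B u u + a * b * bform B u v *+ 2 + b ^+ 2 * bform B v v.
Proof.
rewrite !bformDl !bformDr !bformZl !bformZr (bformC v u); ring.
Qed.

End BilinearForm.

Definition supp (R : pzRingType) n (w : 'rV[R]_n) : {set 'I_n} :=
  [set i | w 0 i != 0].

(** * Finite combinatorics *)

Lemma ramsey a b : exists r, forall (T : finType) (e : rel T) (Y : {set T}),
  symmetric e -> (r <= #|Y|)%N ->
  (exists Z : {set T}, [/\ Z \subset Y, #|Z| = a &
     {in Z &, forall x y, x != y -> e x y}]) \/
  (exists Z : {set T}, [/\ Z \subset Y, #|Z| = b &
     {in Z &, forall x y, x != y -> ~~ e x y}]).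
Proof.
elim: a b => [|a IHa] b.
  exists 0%N => T e Y se _; left; exists set0.
  by split; rewrite ?sub0set ?cards0 // => x y; rewrite inE.
elim: b => [|b [r2 IHb]].
  exists 0%N => T e Y se _; right; exists set0.
  by split; rewrite ?sub0set ?cards0 // => x y; rewrite inE.
have [r1 {}IHa] := IHa b.+1.
exists (r1 + r2).+1 => T e Y se cY.
have [x xY] : exists x, x \in Y by apply/card_gt0P; lia.
pose N1 := [set y in Y :\ x | e x y]; pose N2 := [set y in Y :\ x | ~~ e x y].
have N1Y : N1 \subset Y by apply/subsetP => y; rewrite !inE => /andP[/andP[]].
have N2Y : N2 \subset Y by apply/subsetP => y; rewrite !inE => /andP[/andP[]].
have cN : (#|N1| + #|N2| = #|Y|.-1)%N.
  have -> : N1 = (Y :\ x) :&: [set y | e x y] by apply/setP => y; rewrite !inE.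
  have -> : N2 = (Y :\ x) :\: [set y | e x y].
    by apply/setP => y; rewrite !inE [RHS]andbC.
  by rewrite cardsID (cardsD1 x Y) xY.
have [h1|h2] : (r1 <= #|N1|)%N \/ (r2 <= #|N2|)%N by lia.
- have [[Z [ZN cZ eZ]]|[Z [ZN cZ eZ]]] := IHa T e N1 se h1.
    left; exists (x |: Z); split.
    + by rewrite subUset sub1set xY (subset_trans ZN N1Y).
    + rewrite cardsU1 cZ; case: (boolP (x \in Z)) => // /(subsetP ZN).
      by rewrite !inE eqxx.
    + move=> y z; rewrite !inE => /orP[/eqP->|yZ] /orP[/eqP->|zZ].
      * by rewrite eqxx.
      * by move: (subsetP ZN _ zZ); rewrite !inE => /andP[].
      * by move: (subsetP ZN _ yZ); rewrite !inE se => /andP[].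
      * exact: eZ.
  by right; exists Z; split => //; exact: subset_trans ZN N1Y.
- have [[Z [ZN cZ eZ]]|[Z [ZN cZ eZ]]] := IHb T e N2 se h2.
    by left; exists Z; split => //; exact: subset_trans ZN N2Y.
  right; exists (x |: Z); split.
  + by rewrite subUset sub1set xY (subset_trans ZN N2Y).
  + rewrite cardsU1 cZ; case: (boolP (x \in Z)) => // /(subsetP ZN).
    by rewrite !inE eqxx.
  + move=> y z; rewrite !inE => /orP[/eqP->|yZ] /orP[/eqP->|zZ].
    * by rewrite eqxx.
    * by move: (subsetP ZN _ zZ); rewrite !inE => /andP[].
    * by move: (subsetP ZN _ yZ); rewrite !inE se => /andP[].
    * exact: eZ.
Qed.

Lemma subset_of_card (T : finType) (X : {set T}) k :
  (k <= #|X|)%N -> exists2 P : {set T}, P \subset X & #|P| = k.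
Proof.
move=> kX; exists [set x in take k (enum X)].
  by apply/subsetP => x; rewrite inE => /mem_take; rewrite mem_enum.
rewrite cardsE; have /card_uniqP -> : uniq (take k (enum X)) by rewrite take_uniq // enum_uniq.
by rewrite size_take -cardE; case: ltngtP kX.
Qed.

Lemma card_bigcup_le (I T : finType) (P : pred I) (F : I -> {set T}) :
  (#|\bigcup_(i | P i) F i| <= \sum_(i | P i) #|F i|)%N.
Proof.
elim/big_rec2: _ => [|i k X _ h]; first by rewrite cards0.
by apply: (leq_trans (leq_card_setU _ _)); rewrite leq_add2l.
Qed.

Lemma sign_mulK (a b c : int) : a ^+ 2 = 1 -> b * a * c = 1 -> b * c = a.
Proof. by move=> a2 h; rewrite -[RHS]mulr1 -h -[LHS]mul1r -a2; ring. Qed.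

(** * Limits of cliques *)

Section CliqueFunctionals.
Variables (n : nat) (A : 'M[int]_n) (m : int).
Hypothesis sA : A^T = A.
Hypothesis psdA : forall w, 0 <= bform A w w.
Hypothesis mA : 1 <= m <= 3.
Hypothesis diagA : forall i, A i i = m.
Hypothesis offA : forall i j, i != j -> `|A i j| <= 1.
Variable Y : 'I_n -> {set 'I_n}.
Hypothesis adjY : forall x y, y \in Y x -> A x y ^+ 2 = 1.
Hypothesis clqY : forall x, {in Y x &, forall y z, y != z ->
  A x y * A x z * A y z = 1}.

Lemma A_sym i j : A i j = A j i.
Proof. by rewrite -{1}sA mxE. Qed.

Definition clique_sum x (P : {set 'I_n}) : 'rV[int]_n :=
  \sum_(y in P) A x y *: delta_mx 0 y.

Lemma bform_clique_const u x (P : {set 'I_n}) a :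
  (forall y, y \in P -> A x y * bform A u (delta_mx 0 y) = a) ->
  bform A u (clique_sum x P) = a * #|P|%:R.
Proof.
move=> h; rewrite bform_sumr (eq_bigr (fun=> a)) ?sumr_const ?mulr_natr //.
by move=> y yP; rewrite bformZr h.
Qed.

Lemma bform_clique_pair x (P Q : {set 'I_n}) :
  P \subset Y x -> Q \subset Y x -> [disjoint P & Q] ->
  bform A (clique_sum x P) (clique_sum x Q) = #|P|%:R * #|Q|%:R.
Proof.
move=> PY QY dPQ; apply: bform_clique_const => z zQ; rewrite (bformC sA).
rewrite (@bform_clique_const _ _ _ (A x z)) ?mulrA ?adjY ?(subsetP QY) // => [|y yP].
  by rewrite -expr2 adjY ?mul1r // (subsetP QY).
rewrite bform_delta; have yz : y != z.
  by apply: contraTneq yP => ->; rewrite (disjointFl dPQ).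
rewrite (A_sym z y); apply: sign_mulK; first exact/adjY/(subsetP QY).
exact: clqY (subsetP PY _ yP) (subsetP QY _ zQ) yz.
Qed.

Lemma bform_clique_norm x (P : {set 'I_n}) : P \subset Y x ->
  bform A (clique_sum x P) (clique_sum x P) = (m - 1 + #|P|%:R) * #|P|%:R.
Proof.
move=> PY; apply: bform_clique_const => y yP; rewrite (bformC sA).
have -> : clique_sum x P = A x y *: delta_mx 0 y + clique_sum x (P :\ y).
  by rewrite /clique_sum (big_setD1 y).
rewrite bformDr bformZr bform_delta diagA.
rewrite (@bform_clique_const _ _ _ (A x y)) => [|z].
  by rewrite (cardsD1 y P) yP; have := adjY (subsetP PY _ yP); rewrite /=; nia.
rewrite in_setD1 => /andP[zy zP]; rewrite bform_delta.
rewrite (A_sym y z); apply: sign_mulK; first exact/adjY/(subsetP PY).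
exact: clqY (subsetP PY _ zP) (subsetP PY _ yP) zy.
Qed.

(** [f] and [g] stand for sums of 13 members of a clique. The averages [f / 13]
and [g / 13] are at squared distance [2 (m - 1) / 13], so that Cauchy-Schwarz
gives [(a - b) ^ 2 <= 2 m (m - 1) / 13 < 1]; this is where the size 13 and the
bound [m <= 3] come from. *)
Lemma functional_eq (f g v : 'rV[int]_n) (a b : int) :
  bform A f f = (m + 12) * 13 -> bform A g g = (m + 12) * 13 ->
  bform A f g = 169 -> bform A v v = m ->
  bform A v f = a * 13 -> bform A v g = b * 13 -> a = b.
Proof.
move=> ff gg fg vv vf vg.
have := psdA (m *: (f - g) + (- (13 * (a - b))) *: v).
rewrite (bform_lin2 sA) !bformDl !bformDr !bformNl !bformNr !opprK.
rewrite !(bformC sA _ v) (bformC sA g f) ff gg fg vv vf vg.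
move: mA => /andP[m1 m3] h.
have {}h : 0 <= m * (26 * m * (m - 1) - 169 * (a - b) ^+ 2) by nia.
have : 169 * (a - b) ^+ 2 <= 156 by nia.
by move=> h2; nia.
Qed.

Definition at_value x v (a : int) : {set 'I_n} :=
  [set y in Y x | A x y * A v y == a].

Lemma at_value_sub x v a : at_value x v a \subset Y x.
Proof. by apply/subsetP => y; rewrite inE => /andP[]. Qed.

Lemma at_value_sum x v a (P : {set 'I_n}) : P \subset at_value x v a ->
  bform A (delta_mx 0 v) (clique_sum x P) = a * #|P|%:R.
Proof.
move=> PT; apply: bform_clique_const => y /(subsetP PT).
by rewrite inE bform_delta => /andP[_ /eqP].
Qed.

(** Disjoint parts of a clique have close averages. *)
Lemma at_value_inj x v a b :
  (13 <= #|at_value x v a|)%N -> (13 <= #|at_value x v b|)%N -> a = b.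
Proof.
move=> /subset_of_card[P PT cP] /subset_of_card[Q QT cQ].
case: (eqVneq a b) => // ab.
have PY := subset_trans PT (at_value_sub x v a).
have QY := subset_trans QT (at_value_sub x v b).
have dPQ : [disjoint P & Q].
  apply/pred0P => y /=; apply/negP => /andP[/(subsetP PT) + /(subsetP QT)].
  by rewrite !inE => /andP[_ /eqP ya] /andP[_ /eqP yb]; rewrite -ya -yb eqxx in ab.
apply: (@functional_eq (clique_sum x P) (clique_sum x Q) (delta_mx 0 v)).
- by rewrite bform_clique_norm // cP /=; lia.
- by rewrite bform_clique_norm // cQ /=; lia.
- by rewrite bform_clique_pair // cP cQ.
- by rewrite bform_delta.
- by rewrite (at_value_sum PT) cP.
- by rewrite (at_value_sum QT) cQ.
Qed.

(** The inner product of [v] with the limit of the unit vectors obtained by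
averaging the clique [Y x] over larger and larger parts. In a large clique some
value in [{-1, 0, 1}] is taken 13 times, hence the default value 0. *)
Definition clique_fun x v : int :=
  if (13 <= #|at_value x v 1|)%N then 1
  else if (13 <= #|at_value x v (-1)|)%N then -1 else 0.

Lemma clique_fun_bound x v : `|clique_fun x v| <= 1.
Proof. by rewrite /clique_fun; do 2?case: ifP. Qed.

Definition atypical x v := [set y in Y x | A x y * A v y != clique_fun x v].

(** The product [A x y * A v y] lies between -3 and 3, and each of the six values
other than [clique_fun x v] is taken at most 12 times. *)
Lemma atypical_card x v : (91 < #|Y x|)%N -> (#|atypical x v| <= 72)%N.
Proof.
move=> cY; pose vals : seq int := [:: -3; -2; -1; 0; 1; 2; 3].
have inv y : y \in Y x -> A x y * A v y \in vals.
  move=> yY; have /eqP : A x y ^+ 2 = 1 by exact: adjY.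
  have : `|A v y| <= 1 \/ A v y = m.
    by case: (eqVneq v y) => [->|/offA]; [right; exact: diagA|left].
  move: mA => /andP[m1 m3]; rewrite sqrf_eq1 /vals !inE => h /orP[]/eqP -> //; lia.
have cover (Z : {set 'I_n}) : Z \subset Y x ->
   (#|Z| = \sum_(a <- vals) #|[set y in Z | (A x y * A v y == a)%R]|)%N.
  move=> ZY; rewrite -sum1_card.
  under [RHS]eq_bigr do rewrite -sum1_card.
  rewrite (exchange_big_dep (mem Z)) /=; last by move=> a y _; rewrite inE => /andP[].
  apply: eq_bigr => y yZ; rewrite (eq_bigl (fun a => a == A x y * A v y)); last first.
    by move=> a; rewrite inE yZ eq_sym.
  by rewrite -big_filter filter_pred1_uniq // ?big_seq1 // inv // (subsetP ZY).
have tY : (#|Y x| = \sum_(a <- vals) #|at_value x v a|)%N by exact: cover.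
have [a aV ca] : exists2 a, a \in vals & (13 < #|at_value x v a|)%N.
  apply: contrapT => h; suff : (#|Y x| <= 91)%N by lia.
  rewrite tY; apply: (@leq_trans (\sum_(a <- vals) 13)%N); last by rewrite !big_cons big_nil.
  rewrite big_seq [leqRHS]big_seq; apply: leq_sum => a aV.
  by rewrite leqNgt; apply/negP => ca; apply: h; exists a.
have a1 : `|a| <= 1.
  have /subset_of_card[P PT cP] : (2 <= #|at_value x v a|)%N by lia.
  have [y yP yv] : exists2 y, y \in P & v != y.
    have /card_gt0P[y] : (0 < #|P :\ v|)%N by rewrite lt0n; apply: contra_eqN cP => /eqP c0; rewrite (cardsD1 v) c0; case: (v \in P).
    by rewrite !inE eq_sym => /andP[]; exists y.
  move: (subsetP PT _ yP); rewrite inE => /andP[yY /eqP <-].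
  have /eqP := adjY yY; have := offA yv; rewrite sqrf_eq1 => h /orP[]/eqP -> //; lia.
have fa : clique_fun x v = a.
  rewrite /clique_fun; case: ifP => h1; first exact: (at_value_inj h1 (ltnW ca)).
  case: ifP => h2; first exact: (at_value_inj h2 (ltnW ca)).
  have : a = 0 \/ a = 1 \/ a = -1 by lia.
  by case=> [->|[]ea] //; rewrite ea ?(ltnW ca) // in h1 h2 ca; lia.
rewrite (cover (atypical x v)); last by apply/subsetP => y; rewrite inE => /andP[].
have -> : 72%N = (\sum_(b <- vals | b != a) 12)%N.
  by move: aV; rewrite /vals !inE; do 6?(case/orP; first by move=> /eqP ->; rewrite !big_cons big_nil); move=> /eqP ->; rewrite !big_cons big_nil.
rewrite (bigID (fun b => b == a)) /= big1 ?add0n => [|b /eqP ->]; last first.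
  by apply/eqP; rewrite cards_eq0; apply/eqP/setP => y; rewrite !inE fa; case: eqP; rewrite ?andbF.
apply: leq_sum => b ba; rewrite -ltnS ltnNge; apply/negP => cb.
suff ab : a = b by rewrite ab eqxx in ba.
apply: (at_value_inj (ltnW ca)); apply: (leq_trans cb).
by apply/subset_leq_card/subsetP => y; rewrite !inE => /andP[/andP[-> _] ->].
Qed.

(** Equality of the limit vectors of [Y x] and [Y x'] up to sign. *)
Definition same_fun x x' :=
  [forall v, clique_fun x v == clique_fun x' v] ||
  [forall v, clique_fun x v == - clique_fun x' v].

Lemma typicalE x v y : y \in Y x -> y \notin atypical x v ->
  A x y * A v y = clique_fun x v.
Proof. by move=> yY; rewrite inE yY negbK => /eqP. Qed.

(** Two limit vectors are unit vectors, and their inner product is an integer: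
if it is not zero, then they agree up to sign. Of 170 members of [Y x'] on
which the limit vector of [Y x] does not vanish, 85 agree after switching; 85
is large enough to leave 13 of them once the 72 exceptions of a given [v] have
been removed. *)
Lemma orthogonal_cliques x x' : (85 * 73 <= #|Y x|)%N -> (85 * 73 <= #|Y x'|)%N ->
  ~~ same_fun x x' -> (#|[set z in Y x' | clique_fun x z != 0]| < 170)%N.
Proof.
move=> cx cx'; apply: contraR; rewrite -leqNgt => c170.
pose Z (e : int) := [set z in Y x' | A x' z * clique_fun x z == e].
have [e e2 cZ] : exists2 e : int, e ^+ 2 = 1 & (85 <= #|Z e|)%N.
  have [c1|c1] := leqP 85 #|Z 1%R|; first by exists 1.
  exists (-1) => //; have : (170 <= #|Z 1%R :|: Z (-1)%R|)%N.
    apply: (leq_trans c170); apply/subset_leq_card/subsetP => z.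
    rewrite !inE => /andP[zY /eqP f0]; rewrite zY /=.
    have := clique_fun_bound x z; have /eqP := adjY zY; rewrite sqrf_eq1.
    by move=> /orP[]/eqP ->; lia.
  by move=> /leq_trans /(_ (leq_card_setU _ _)); move: c1; lia.
have [P PZ cP] := subset_of_card cZ.
have PY : P \subset Y x' by apply: (subset_trans PZ); apply/subsetP => z; rewrite inE => /andP[].
pose bad := \bigcup_(z in P) atypical x z.
have cbad : (#|bad| <= 85 * 72)%N.
  apply: (leq_trans (card_bigcup_le _ _)) => /=.
  apply: (@leq_trans (\sum_(z in P) 72)%N); last by rewrite sum_nat_const cP.
  by apply: leq_sum => z _; apply: atypical_card; apply: leq_trans cx.
have main v : clique_fun x v = e * clique_fun x' v.
  have [C CS cC] : exists2 C : {set 'I_n}, C \subset Y x :\: (bad :|: atypical x v) & #|C| = 13%N.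
    apply: subset_of_card.
    have h1 := leq_card_setU bad (atypical x v).
    have h2 : (#|atypical x v| <= 72)%N by apply: atypical_card; apply: leq_trans cx.
    have h3 := cardsID (bad :|: atypical x v) (Y x).
    have h4 : (#|Y x :&: (bad :|: atypical x v)| <= #|bad :|: atypical x v|)%N.
      exact/subset_leq_card/subsetIr.
    move: (leq_trans h4 h1) h3; set a := #|_ :&: _|; set b := #|_ :\: _|.
    by move=> h5 h6; rewrite -h6 in cx; lia.
  have [Q QS cQ] : exists2 Q : {set 'I_n}, Q \subset P :\: atypical x' v & #|Q| = 13%N.
    apply: subset_of_card.
    have h2 : (#|atypical x' v| <= 72)%N by apply: atypical_card; apply: leq_trans cx'.
    have h3 := cardsID (atypical x' v) P.
    have h4 : (#|P :&: atypical x' v| <= #|atypical x' v|)%N.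
      exact/subset_leq_card/subsetIr.
    move: h4 h3; set a := #|_ :&: _|; set b := #|_ :\: _|.
    by move=> h5 h6; rewrite cP in h6; lia.
  have QP : Q \subset P by apply: (subset_trans QS); exact: subsetDl.
  have QY := subset_trans QP PY.
  have CY : C \subset Y x by apply: (subset_trans CS); exact: subsetDl.
  apply: (@functional_eq (clique_sum x C) (e *: clique_sum x' Q) (delta_mx 0 v)).
  - by rewrite bform_clique_norm // cC; lia.
  - by rewrite bformZl bformZr mulrA -expr2 e2 mul1r bform_clique_norm // cQ; move: m; lia.
  - rewrite bformZr (@bform_clique_const _ _ _ (13 * e)) ?cQ; last first.
      move=> z zQ; rewrite (bformC sA) (@bform_clique_const _ _ _ (clique_fun x z)) ?cC.
        by move: (subsetP PZ _ (subsetP QP _ zQ)); rewrite inE => /andP[_ /eqP]; lia.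
      move=> y yC; rewrite bform_delta; apply: typicalE; first exact: (subsetP CY).
      move: (subsetP CS _ yC); rewrite !inE !negb_or -andbA => /and3P[+ _ _].
      apply: contra => yb; apply/bigcupP; exists z; first exact: (subsetP QP).
      by move: yb; rewrite inE.
    by transitivity (e ^+ 2 * 169); [ring|rewrite e2].
  - by rewrite bform_delta.
  - rewrite (@bform_clique_const _ _ _ (clique_fun x v)) ?cC // => y yC; rewrite bform_delta.
    apply: typicalE; first exact: (subsetP CY).
    by move: (subsetP CS _ yC); rewrite in_setD in_setU negb_or => /andP[/andP[]].
  - rewrite bformZr (@bform_clique_const _ _ _ (clique_fun x' v)) ?cQ; first by rewrite mulrA.
    move=> y yQ; rewrite bform_delta; apply: typicalE; first exact: (subsetP QY).
    by move: (subsetP QS _ yQ); rewrite in_setD => /andP[].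
have /eqP := e2; rewrite sqrf_eq1 /same_fun => /orP[]/eqP e1; apply/orP; [left|right];
  by apply/forallP => v; rewrite main e1 ?mul1r ?mulN1r.
Qed.

Definition fun_at x (u : 'rV[int]_n) : int := \sum_v u 0 v * clique_fun x v.

Lemma same_fun_sym x y : same_fun x y = same_fun y x.
Proof.
rewrite /same_fun; congr (_ || _); apply/forallP/forallP => h v.
- by rewrite eq_sym.
- by rewrite eq_sym.
- by rewrite (eqP (h v)) opprK.
- by rewrite (eqP (h v)) opprK.
Qed.

Lemma supp_clique_sum x (D : {set 'I_n}) : supp (clique_sum x D) \subset D.
Proof.
apply/subsetP => v; rewrite inE summxE; apply: contraR => vD.
rewrite big1 // => y yD; rewrite !mxE eqxx /=; case: eqP => [vy|]; last by rewrite mulr0.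
by rewrite vy yD in vD.
Qed.

Lemma fun_atB x u v : fun_at x (u - v) = fun_at x u - fun_at x v.
Proof.
by rewrite /fun_at -sumrB; apply: eq_bigr => i _; rewrite !mxE; ring.
Qed.

Lemma fun_atZ x a u : fun_at x (a *: u) = a * fun_at x u.
Proof.
by rewrite /fun_at mulr_sumr; apply: eq_bigr => i _; rewrite !mxE; ring.
Qed.

(** A part of the clique [Y x] that behaves on [u] exactly like the limit
vector of the clique, and is orthogonal to the limit vectors in [js]: it is
found by removing the exceptions of the vertices in the support of [u], and the
few members on which a limit vector in [js] does not vanish. *)
Lemma typical_part x (u : 'rV[int]_n) (js : seq 'I_n) d :
  (forall x, (85 * 73 <= #|Y x|)%N) ->
  (d + 72 * #|supp u| + 170 * size js <= #|Y x|)%N ->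
  all (fun j => ~~ same_fun x j) js ->
  exists D : {set 'I_n}, [/\ D \subset Y x, #|D| = d,
    bform A u (clique_sum x D) = fun_at x u * d%:R
  & forall j, j \in js -> fun_at j (clique_sum x D) = 0].
Proof.
move=> cY cYx hjs.
pose bad1 := \bigcup_(v in supp u) atypical x v.
pose bad2 := \bigcup_(j <- js) [set z in Y x | clique_fun j z != 0].
have c1 : (#|bad1| <= 72 * #|supp u|)%N.
  apply: (leq_trans (card_bigcup_le _ _)) => /=.
  apply: (@leq_trans (\sum_(v in supp u) 72)%N); last by rewrite sum_nat_const mulnC.
  by apply: leq_sum => v _; apply: atypical_card; apply: leq_trans (cY x).
have c2 : (#|bad2| <= 170 * size js)%N.
  rewrite /bad2; elim: js hjs {bad2 cYx} => [|j js IH]; first by rewrite big_nil cards0.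
  rewrite big_cons mulnS => /andP[xj /IH{}IH].
  apply: (leq_trans (leq_card_setU _ _)); apply: leq_add => //.
  by apply/ltnW/orthogonal_cliques; rewrite // same_fun_sym.
have [D DS cD] : exists2 D : {set 'I_n}, D \subset Y x :\: (bad1 :|: bad2) & #|D| = d.
  apply: subset_of_card.
  have h1 := leq_card_setU bad1 bad2.
  have h3 := cardsID (bad1 :|: bad2) (Y x).
  have h4 : (#|Y x :&: (bad1 :|: bad2)| <= #|bad1 :|: bad2|)%N.
    exact/subset_leq_card/subsetIr.
  move: (leq_trans h4 h1) h3; set a := #|_ :&: _|; set b := #|_ :\: _|.
  by move=> h5 h6; rewrite -h6 in cYx; lia.
have DY : D \subset Y x by apply: (subset_trans DS); exact: subsetDl.
exists D; split => //.
- rewrite -cD; apply: bform_clique_const => y yD; rewrite bform_deltarE mulr_sumr.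
  apply: eq_bigr => v _; have [->|uv] := eqVneq (u 0 v) 0; first by rewrite !mul0r mulr0.
  rewrite mulrCA (@typicalE x v) ?(subsetP DY) //.
  move: (subsetP DS _ yD); rewrite in_setD in_setU negb_or => /andP[/andP[+ _] _].
  by apply: contra => h; apply/bigcupP; exists v; rewrite // inE.
- move=> j jj; rewrite /fun_at big1 // => v _.
  case: (boolP (v \in D)) => [vD|vD]; last first.
    have : v \notin supp (clique_sum x D) by apply: contra vD; exact/subsetP/supp_clique_sum.
    by rewrite inE negbK => /eqP ->; rewrite mul0r.
  move: (subsetP DS _ vD); rewrite in_setD in_setU negb_or => /andP[/andP[_ +] vY].
  suff -> : (v \in bad2) = (clique_fun j v != 0) || (v \in bad2).
    by rewrite negb_or negbK => /andP[/eqP -> _]; rewrite mulr0.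
  case: (boolP (clique_fun j v == 0)) => //= jv; rewrite /bad2 (big_rem j) //=.
  by rewrite in_setU inE vY jv.
Qed.

(** The Gram-Schmidt process for the limit vectors, with sums of [d] clique
members in their place. Subtracting [c x] times such a sum from [u] lowers the
norm by [c x ^ 2 (d ^ 2 - (m - 1) d)] and keeps the products with the limit
vectors that are still to come. *)
Lemma limit_approx (c : 'I_n -> int) d (js : seq 'I_n) (u : 'rV[int]_n) :
  (forall x, (85 * 73 <= #|Y x|)%N) ->
  (forall x, (d + 72 * (#|supp u| + d * size js) + 170 * size js <= #|Y x|)%N) ->
  pairwise (fun x y => ~~ same_fun x y) js ->
  (forall j, j \in js -> fun_at j u = d%:R * c j) ->
  0 <= bform A u u - \sum_(j <- js) c j ^+ 2 * (d%:R ^+ 2 - (m - 1) * d%:R).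
Proof.
move=> cY; elim: js u => [|x js IH] u cYx.
  by move=> _ _; rewrite big_nil subr0; exact: psdA.
rewrite pairwise_cons => /andP[xjs pjs] hu.
have [|D [DY cD uD jD]] := @typical_part x u js d cY _ xjs.
  apply: leq_trans (cYx x); rewrite /=; nia.
have hux : fun_at x u = d%:R * c x by apply: hu; rewrite mem_head.
have -> : bform A u u - \sum_(j <- x :: js) c j ^+ 2 * (d%:R ^+ 2 - (m - 1) * d%:R) =
  bform A (u - c x *: clique_sum x D) (u - c x *: clique_sum x D) -
  \sum_(j <- js) c j ^+ 2 * (d%:R ^+ 2 - (m - 1) * d%:R).
  rewrite big_cons !bformDl !bformDr !bformNl !bformNr !bformZl !bformZr.
  rewrite (bformC sA _ u) uD hux bform_clique_norm // cD; ring.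
apply: IH => // [y|j jj]; last first.
  by rewrite fun_atB fun_atZ jD // mulr0 subr0 hu // in_cons jj orbT.
have hs : (#|supp (u - c x *: clique_sum x D)| <= #|supp u| + d)%N.
  rewrite -cD; apply: leq_trans (leq_card_setU _ _); apply/subset_leq_card/subsetP => v.
  rewrite in_setU 2!inE; apply: contraR; rewrite negb_or negbK => /andP[/eqP uv vD].
  have : v \notin supp (clique_sum x D) by apply: contra vD; exact/subsetP/supp_clique_sum.
  by rewrite inE negbK !mxE uv => /eqP ->; rewrite mulr0 subr0.
apply: leq_trans (cYx y); move: hs; rewrite /= mulnS; move: #|_| #|_| (d * _)%N => a b c'; lia.
Qed.

Definition norm1 (w : 'rV[int]_n) : int := \sum_i `|w 0 i|.

Lemma supp_norm1 w : (#|supp w|%:R <= norm1 w :> int).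
Proof.
rewrite -sum1_card natr_sum big_mkcond /=; apply: ler_sum => i _.
by rewrite inE; case: (eqVneq (w 0 i) 0) => [->|w0] /=; rewrite ?normr0 // -gtz0_ge1 normr_gt0.
Qed.

Lemma fun_at_norm1 x w : `|fun_at x w| <= norm1 w.
Proof.
apply: (le_trans (ler_norm_sum _ _ _)); apply: ler_sum => i _.
by rewrite normrM ler_piMr // clique_fun_bound.
Qed.

Lemma bform_norm1 w : bform A w w <= 3 * norm1 w ^+ 2.
Proof.
have A3 i j : `|A i j| <= 3.
  case: (eqVneq i j) => [->|/offA]; last by lia.
  by rewrite diagA; move: mA => /andP[]; lia.
rewrite bformE; apply: (@le_trans _ _ (\sum_j `|w 0 j| * \sum_i `|w 0 i| * 3)).
  apply: ler_sum => j _; apply: (le_trans (ler_norm _)); rewrite normrM ler_wpM2l //.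
  apply: (le_trans (ler_norm_sum _ _ _)); apply: ler_sum => i _.
  by rewrite normrM ler_wpM2l.
by rewrite -mulr_suml -mulr_suml -/(norm1 w) expr2 mulrA mulrC.
Qed.

(** For a bounded number of limit vectors, apply the Gram-Schmidt process to
[d w]: as [bform A w w] and the sum of squares are integers, the error of order
[1 / d] disappears when [d] is large. If more than [R0] limit vectors had a
nonzero product with [w], then [R0] of them would already violate the bound
[bform A w w <= 3 K ^ 2]. *)
Lemma limit_form_psd (F : {set 'I_n}) K w :
  let R0 := (3 * K ^ 2).+1 in let d := (2 * R0 * K ^ 2).+1 in
  (forall x, (85 * 73 + (d + 72 * (K + d * R0) + 170 * R0) <= #|Y x|)%N) ->
  {in F &, forall x y, x != y -> ~~ same_fun x y} ->
  norm1 w <= K%:R ->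
  0 <= bform A w w - \sum_(f in F) fun_at f w ^+ 2.
Proof.
move=> R0 d cY hF wK.
have sub (G : {set 'I_n}) : G \subset F -> (#|G| <= R0)%N ->
    0 <= bform A w w - \sum_(f in G) fun_at f w ^+ 2.
  move=> GF cG.
  have dP : 0 < (d%:R : int) by rewrite ltr0n.
  have := @limit_approx (fun f => fun_at f w) d (enum G) (d%:R *: w).
  have -> : #|supp (d%:R *: w)| = #|supp w|.
    by apply: eq_card => i; rewrite !inE !mxE mulf_eq0 gt_eqF.
  have sw : (#|supp w| <= K)%N by have := supp_norm1 w; lia.
  rewrite -!cardE big_enum /= -mulr_suml bformZl bformZr.
  set S := \sum_(i in G) _ => H.
  have {H} h : 0 <= d%:R * (d%:R * bform A w w) - S * (d%:R ^+ 2 - (m - 1) * d%:R).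
   apply: H.
  - by move=> x; apply: leq_trans (cY x); rewrite leq_addr.
  - move=> x; apply: leq_trans (leq_trans (leq_addl _ _) (cY x)).
    by apply: leq_add; rewrite ?leq_add2l ?leq_mul // leq_add // leq_mul.
  - have : uniq (enum G) by exact: enum_uniq.
    have : {subset enum G <= G} by move=> x; rewrite mem_enum.
    elim: (enum G) => //= x s IH sG /andP[xs us]; rewrite IH ?andbT //.
      apply/allP => y ys; apply: hF.
      + by apply: (subsetP GF); apply: sG; rewrite mem_head.
      + by apply: (subsetP GF); apply: sG; rewrite in_cons ys orbT.
      + by apply: contraNneq xs => ->.
    by move=> y ys; apply: sG; rewrite in_cons ys orbT.
  - by move=> j _; rewrite fun_atZ.
  have SK : S <= (R0 * K ^ 2)%N%:R.
    apply: (@le_trans _ _ (\sum_(f in G) (K%:R ^+ 2))).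
      apply: ler_sum => f _; rewrite -(real_normK (num_real _)) ler_sqr ?nnegrE //.
      exact: le_trans (fun_at_norm1 f w) wK.
    by rewrite sumr_const -[leLHS]mulr_natl natrM natrX ler_wpM2r ?exprn_ge0 // ler_nat.
  have : 0 <= (d%:R : int) * (d%:R * (bform A w w - S) + 2 * S) .
    apply: (le_trans h); move: mA => /andP[m1 m3].
    have S0 : 0 <= S by apply: sumr_ge0 => f _; exact: sqr_ge0.
    rewrite -subr_ge0.
    have -> : d%:R * (d%:R * (bform A w w - S) + 2 * S) - (d%:R * (d%:R * bform A w w) - S * (d%:R ^+ 2 - (m - 1) * d%:R)) = (3 - m) * (d%:R * S) by ring.
    by rewrite mulr_ge0 ?subr_ge0 // mulr_ge0 // ltW.
  rewrite pmulr_rge0 // => h2; rewrite leNgt; apply/negP => h3.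
  have {}h3 : bform A w w - S <= -1 by lia.
  have : d%:R * (bform A w w - S) <= - d%:R by rewrite -mulrN1 ler_wpM2l // ltW.
  have dE : d = (2 * (R0 * K ^ 2) + 1)%N by rewrite mulnA addn1.
  have : (d%:R : int) = 2 * (R0 * K ^ 2)%N%:R + 1 by rewrite dE natrD natrM.
  by move: SK h2; lia.
pose G := [set f in F | fun_at f w != 0].
have GF : G \subset F by apply/subsetP => f; rewrite inE => /andP[].
have -> : \sum_(f in F) fun_at f w ^+ 2 = \sum_(f in G) fun_at f w ^+ 2.
  rewrite (bigID (fun f => fun_at f w != 0)) /= [X in _ + X]big1 ?addr0.
    by apply: eq_bigl => f; rewrite inE.
  by move=> f /andP[_]; rewrite negbK => /eqP ->; rewrite expr0n.
have [cG|cG] := leqP #|G| R0; first exact: sub.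
have [G' G'G cG'] := subset_of_card (ltnW cG).
have := sub G' (subset_trans G'G GF); rewrite cG' leqnn => /(_ isT).
have : (R0%:R : int) <= \sum_(f in G') fun_at f w ^+ 2.
  rewrite -cG' -sum1_card natr_sum; apply: ler_sum => f /(subsetP G'G).
  by rewrite inE => /andP[_]; rewrite -normr_gt0 -(real_normK (num_real _)); nia.
have : norm1 w ^+ 2 <= K%:R ^+ 2.
  by rewrite ler_sqr ?nnegrE // sumr_ge0.
have := bform_norm1 w; have : (R0%:R : int) = 3 * K%:R ^+ 2 + 1 by rewrite /R0 -addn1 natrD natrM natrX.
by move: (norm1 w ^+ 2) (K%:R ^+ 2 : int) => a b; lia.
Qed.

End CliqueFunctionals.

Lemma bformB (R : comPzRingType) n (B C : 'M[R]_n) u v :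
  bform (B - C) u v = bform B u v - bform C u v.
Proof. by rewrite /bform mulmxBr mulmxBl !mxE. Qed.

Lemma bform_gram (R : comPzRingType) n s (U : 'M[R]_(n, s)) u v :
  bform (U *m U^T) u v = \sum_j (u *m U) 0 j * (v *m U) 0 j.
Proof.
rewrite /bform -!mulmxA -trmx_mul mulmxA mxE.
by apply: eq_bigr => j _; rewrite [_^T _ _]mxE.
Qed.

(** Subtracting from the Gram matrix [A] the projections to the limit vectors
leaves a form that is nonnegative on short integer vectors, and thereby its
diagonal drops from at most 3 to at most 2. By Ramsey's theorem each vertex [x]
of large valency has a large clique among its neighbours (after switching them
so that they are positively adjacent to [x]): ten switched neighbours that are
pairwise not positively adjacent would make the norm of [m] times their sum
minus [10 x] negative. *)
Lemma limit_vectors K : exists kappa, forall n (A : 'M[int]_n) (m : int),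
  A^T = A -> (forall w, 0 <= bform A w w) -> 1 <= m <= 3 ->
  (forall i, A i i = m) -> (forall i j, i != j -> `|A i j| <= 1) ->
  (forall x, (kappa <= #|[set y | (y != x) && (A x y != 0)]|)%N) ->
  exists s (Phi : 'M[int]_(n, s)),
    [/\ forall x j, `|Phi x j| <= 1, forall x, exists j, Phi x j != 0
      & forall w, norm1 w <= K%:R -> 0 <= bform (A - Phi *m Phi^T) w w].
Proof.
pose R0 := (3 * K ^ 2).+1; pose d := (2 * R0 * K ^ 2).+1.
pose p := (85 * 73 + (d + 72 * (K + d * R0) + 170 * R0))%N.
have [r hr] := ramsey p 10; exists r => n A m sA psd m13 dA oA val.
have A_sym := A_sym sA.
have A2 x y : y != x -> A x y != 0 -> A x y ^+ 2 = 1.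
  rewrite eq_sym => /oA h1 h2; have : A x y = 1 \/ A x y = -1 by lia.
  by case=> ->.
have /choice[Y hY] : forall x, exists Y : {set 'I_n}, [/\ #|Y| = p,
    forall y, y \in Y -> A x y ^+ 2 = 1 &
    {in Y &, forall y z, y != z -> A x y * A x z * A y z = 1}].
  move=> x; have := val x; set N := [set y | _] => valx.
  have AN y : y \in N -> A x y ^+ 2 = 1 by rewrite inE => /andP[]; exact: A2.
  have [||[Z [ZN cZ eZ]]|[P [PN cP eP]]] :=
    hr _ (fun y z => A x y * A x z * A y z == 1) N.
  - by move=> y z; rewrite (A_sym y z) (mulrC (A x y)).
  - exact: valx.
  - exists Z; split=> // [y /(subsetP ZN)/AN //|y z yZ zZ yz].
    exact/eqP/eZ.
  have := psd (m *: clique_sum A x P + (-10) *: delta_mx 0 x).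
  rewrite (bform_lin2 sA) (bformC sA (clique_sum _ _ _) (delta_mx 0 x)).
  rewrite (@bform_clique_const _ _ (delta_mx 0 x) x P 1) ?cP; last first.
    by move=> y /(subsetP PN)/AN; rewrite bform_delta expr2.
  rewrite bform_delta dA.
  suff : bform A (clique_sum A x P) (clique_sum A x P) <= m * 10.
    move: m13 => /andP[m1 m3]; set q := bform _ _ _ => hq h.
    have : 0 <= m * (m * (m * 10) - 100) by nia.
    by nia.
  rewrite bform_sumr (@le_trans _ _ (\sum_(y in P) m)) //; last first.
    by rewrite sumr_const cP mulr_natr.
  apply: ler_sum => y yP; rewrite bformZr bform_suml (big_setD1 y) //= bformZl bform_delta dA.
  rewrite mulrDr mulrA -expr2 AN ?(subsetP PN) // mul1r -lerBrDl subrr mulr_sumr.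
  apply: sumr_le0 => z; rewrite in_setD1 => /andP[zy zP].
  rewrite bformZl bform_delta mulrA; have := eP _ _ yP zP; rewrite eq_sym zy => /(_ isT).
  have := AN _ (subsetP PN _ yP); have := AN _ (subsetP PN _ zP).
  rewrite (A_sym y z); have := oA _ _ zy; move: (A x y) (A x z) (A z y) => a b c c1 /eqP.
  by rewrite sqrf_eq1 => /orP[]/eqP-> /eqP; rewrite sqrf_eq1 => /orP[]/eqP-> ; lia.
have cY x : #|Y x| = p by case: (hY x).
have aY x y : y \in Y x -> A x y ^+ 2 = 1 by case: (hY x) => _ + _; apply.
have qY x : {in Y x &, forall y z, y != z -> A x y * A x z * A y z = 1}.
  by case: (hY x).
(* [F] picks one vertex for each limit vector up to sign. *)
pose free (F : {set 'I_n}) := [forall x in F, forall y in F, (x != y) ==> ~~ same_fun A Y x y].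
have free0 : free set0 by apply/forall_inP => x; rewrite inE.
have [F /maxsetP[fF mF] _] := maxset_exists free0.
have hF : {in F &, forall x y, x != y -> ~~ same_fun A Y x y}.
  by move=> x y xF yF xy; move/forall_inP/(_ x xF)/forall_inP/(_ y yF)/implyP: fF; apply.
exists #|F|, (\matrix_(x, j) clique_fun A Y (enum_val j) x); split.
- by move=> x j; rewrite mxE; exact: clique_fun_bound.
- move=> x; have fxx : clique_fun A Y x x = 1.
    rewrite /clique_fun (_ : at_value A Y x x 1 = Y x) ?cY //.
    by apply/setP => y; rewrite inE; case: (boolP (y \in Y x)) => //= /aY; rewrite expr2 => /eqP.
  have [f fF' /orP sf] : exists2 f, f \in F & same_fun A Y f x.
    case: (boolP (x \in F)) => xF.
      by exists x => //; apply/orP; left; apply/forallP.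
    apply: contrapT => h.
    suff : free (x |: F) by move=> /mF /(_ (subsetUr _ _)) FE; rewrite -FE setU11 in xF.
    apply/forall_inP => y; rewrite in_setU1 => /orP[/eqP ->|yF];
      apply/forall_inP => z; rewrite in_setU1 => /orP[/eqP ->|zF]; apply/implyP => yz.
    + by rewrite eqxx in yz.
    + by apply/negP; rewrite same_fun_sym => sf; apply: h; exists z.
    + by apply/negP => sf; apply: h; exists y.
    + exact: hF.
  exists (enum_rank_in fF' f); rewrite mxE enum_rankK_in //.
  by case: sf => /forallP/(_ x)/eqP ->; rewrite fxx.
- move=> w wK; rewrite bformB bform_gram.
  have := limit_form_psd sA psd m13 dA oA aY qY _ hF wK.
  move=> /(_ (fun x => eq_leq (esym (cY x)))); congr (0 <= _ - _).
  rewrite big_enum_val; apply: eq_bigr => j _; rewrite mxE expr2.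
  by congr (_ * _); apply: eq_bigr => v _; rewrite mxE.
Qed.

(** * Locally positive semidefinite forms *)

Definition locally_psd n (B : 'M[int]_n) N :=
  forall w : 'rV[rat]_n, (#|supp w| <= N)%N -> 0 <= bform (map_mx intr B) w w.

Lemma bform_map (R : comPzRingType) n (B : 'M[int]_n) (u v : 'rV[int]_n) :
  bform (map_mx intr B) (map_mx intr u) (map_mx intr v) = (bform B u v)%:~R :> R.
Proof. by rewrite /bform map_trmx -!map_mxM mxE. Qed.

Lemma bform_mul (R : comPzRingType) n s (B : 'M[R]_n) (G : 'M[R]_(s, n)) u v :
  bform B (u *m G) (v *m G) = bform (G *m B *m G^T) u v.
Proof. by rewrite /bform trmx_mul !mulmxA. Qed.

Lemma rat_common_denom n (w : 'rV[rat]_n) :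
  exists (d : int) (z : 'rV[int]_n), 0 < d /\ d%:~R *: w = map_mx intr z.
Proof.
pose d := \prod_i denq (w 0 i).
exists d, (\row_i (numq (w 0 i) * \prod_(j | j != i) denq (w 0 j))); split.
  by apply: prodr_gt0 => i _; exact: denq_gt0.
apply/rowP => i; rewrite !mxE /d (bigD1 i) //= !rmorphM /=.
rewrite -{2}(divq_num_den (w 0 i)) mulrAC; congr (_ * _).
by rewrite mulrCA mulfV ?mulr1 // intr_eq0 denq_eq0.
Qed.

Lemma norm1_eq1 n (i : 'I_n) (a : int) : norm1 (a *: delta_mx 0 i : 'rV[int]_n) = `|a|.
Proof.
rewrite /norm1 (bigD1 i) //= big1 ?addr0 ?mxE ?eqxx ?mulr1 // => j ji.
by rewrite !mxE (negbTE ji) mulr0 normr0.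
Qed.

Lemma norm1D n (u v : 'rV[int]_n) : norm1 (u + v) <= norm1 u + norm1 v.
Proof. by rewrite -big_split /=; apply: ler_sum => i _; rewrite mxE ler_normD. Qed.

(** The entries of [B] are at most 2 in absolute value, so that only finitely
many matrices of size [N] occur as restrictions of such forms, and a failure of
positivity on [N] coordinates is witnessed by an integer vector of bounded
size. *)
Lemma locally_psd_of_norm1 N : exists K, forall n (B : 'M[int]_n),
  B^T = B -> (forall i, B i i <= 2) ->
  (forall w, norm1 w <= K%:R -> 0 <= bform B w w) -> locally_psd B N.
Proof.
(* The entries of [B] lie between -2 and 2, and are coded by ['I_5]. *)
pose dec (M : 'M['I_5]_N) : 'M[int]_N := \matrix_(i, j) ((M i j)%:Z - 2).
have /choice[k hk] : forall M, exists k : nat, (exists v, bform (dec M) v v < 0) ->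
    exists2 v, norm1 v <= k%:R & bform (dec M) v v < 0.
  move=> M; have [[v hv]|] := pselect (exists v, bform (dec M) v v < 0); last by exists 0%N.
  by exists `|norm1 v|%N => _; exists v; rewrite // natr_absz intz ler_norm.
exists (2 + \max_M k M)%N => n B sB dB hB.
have B_sym i j : B i j = B j i by rewrite -{1}sB mxE.
have d0 i : 0 <= B i i.
  rewrite -bform_delta hB // -[delta_mx _ _]scale1r norm1_eq1; lia.
have Bb i j : -2 <= B i j <= 2.
  have dlt (a : int) : `|a| = 1 -> 0 <= B i i + a * B i j *+ 2 + a ^+ 2 * B j j.
    move=> a1; have := hB (1 *: delta_mx 0 i + a *: delta_mx 0 j).
    rewrite (bform_lin2 sB) !bform_delta expr1n !mul1r; apply.
    by apply: (le_trans (norm1D _ _)); rewrite !norm1_eq1 a1; lia.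
  have := dlt 1 (erefl _); have := dlt (-1) (erefl _); have := dB i; have := dB j; have := d0 i; lia.
move=> w0 cw0; rewrite leNgt; apply/negP => w0neg.
have [d [w [dP wE]]] := rat_common_denom w0.
have wneg : bform B w w < 0.
  rewrite -(ltr_int rat) -bform_map -wE bformZl bformZr mulrA pmulr_rlt0 //.
  by rewrite mulr_gt0 ?ltr0z.
have {cw0} cw : (#|supp w| <= N)%N.
  apply: leq_trans cw0; apply/subset_leq_card/subsetP => i; rewrite !inE.
  apply: contra => /eqP wi; have /rowP/(_ i) := wE; rewrite !mxE wi mulr0 => /esym/eqP.
  by rewrite intr_eq0.
have [x0 x0w] : exists x, x \in supp w.
  apply: contrapT => h; suff w00 : w = 0 by rewrite w00 bform0l ltxx in wneg.
  apply/rowP => i; rewrite mxE; apply/eqP; apply: contrapT => wi; apply: h; exists i.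
  by rewrite inE; apply/negP.
pose g (i : 'I_N) := nth x0 (enum (supp w)) i.
pose G : 'M[int]_(N, n) := \matrix_(i, j) (g i == j)%:R.
have GE (v : 'rV[int]_N) : v *m G = \sum_i v 0 i *: delta_mx 0 (g i).
  apply/rowP => j; rewrite mxE summxE; apply: eq_bigr => i _.
  by rewrite !mxE eqxx eq_sym.
pose v : 'rV[int]_N := \row_i (if (i < #|supp w|)%N then w 0 (g i) else 0).
have vG : v *m G = w.
  rewrite GE [RHS]row_sum_delta (bigID (mem (supp w))) /= [X in _ + X]big1 ?addr0; last first.
    by move=> i; rewrite inE negbK => /eqP ->; rewrite scale0r.
  rewrite -[RHS]big_enum /= [RHS](big_nth x0) -cardE [RHS]big_mkord.
  rewrite (big_ord_widen _ (fun i => w 0 (nth x0 (enum (supp w)) i) *: delta_mx 0 (nth x0 (enum (supp w)) i)) cw).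
  rewrite [RHS]big_mkcond; apply: eq_bigr => i _.
  by rewrite mxE; case: ifP; rewrite ?scale0r.
pose M : 'M['I_5]_N := \matrix_(i, j) inord (absz (B (g i) (g j) + 2)).
have ME : G *m B *m G^T = dec M.
  apply/matrixP => i j; rewrite [RHS]mxE [M i j]mxE inordK; last by have := Bb (g i) (g j); lia.
  have -> : ((absz (B (g i) (g j) + 2))%:Z - 2) = B (g i) (g j) by have := Bb (g i) (g j); lia.
  have dG l : (delta_mx 0 l : 'rV_N) *m G = delta_mx 0 (g l).
    by rewrite -rowE; apply/rowP => l'; rewrite !mxE eqxx eq_sym.
  by rewrite -bform_delta -bform_mul !dG bform_delta.
have [|v' v'k v'neg] := hk M.
  by exists v; rewrite -ME -bform_mul vG.
move: v'neg; rewrite -ME -bform_mul ltNge hB //.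
apply: (@le_trans _ _ (norm1 v')).
  rewrite GE [leRHS]/norm1; elim/big_rec2: _ => [|i u a _ h].
    by rewrite /norm1 big1 // => i _; rewrite mxE normr0.
  by apply: (le_trans (norm1D _ _)); rewrite norm1_eq1 lerD2l.
apply: (le_trans v'k); rewrite ler_nat; apply: leq_trans (leq_addl _ _).
exact: (leq_bigmax M).
Qed.

(** * Inner products *)

Definition dot (R : pzRingType) d (x y : 'rV[R]_d) : R := \sum_j x 0 j * y 0 j.

Lemma dotC (R : comPzRingType) d (x y : 'rV[R]_d) : dot x y = dot y x.
Proof. by apply: eq_bigr => j _; rewrite mulrC. Qed.

Lemma dotDl (R : pzRingType) d (x y z : 'rV[R]_d) : dot (x + y) z = dot x z + dot y z.
Proof. by rewrite -big_split; apply: eq_bigr => j _; rewrite mxE mulrDl. Qed.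

Lemma dotZl (R : pzRingType) d a (x z : 'rV[R]_d) : dot (a *: x) z = a * dot x z.
Proof. by rewrite mulr_sumr; apply: eq_bigr => j _; rewrite mxE mulrA. Qed.

Lemma dotNl (R : pzRingType) d (x z : 'rV[R]_d) : dot (- x) z = - dot x z.
Proof. by rewrite -scaleN1r dotZl mulN1r. Qed.

Lemma dotDr (R : comPzRingType) d (x y z : 'rV[R]_d) : dot z (x + y) = dot z x + dot z y.
Proof. by rewrite dotC dotDl !(dotC z). Qed.

Lemma dotZr (R : comPzRingType) d a (x z : 'rV[R]_d) : dot z (a *: x) = a * dot z x.
Proof. by rewrite dotC dotZl (dotC z). Qed.

Lemma dotNr (R : comPzRingType) d (x z : 'rV[R]_d) : dot z (- x) = - dot z x.
Proof. by rewrite dotC dotNl (dotC z). Qed.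

Lemma dot_sumr (R : comPzRingType) d (I : finType) (x : 'rV[R]_d) (F : I -> 'rV[R]_d) :
  dot x (\sum_i F i) = \sum_i dot x (F i).
Proof.
apply: (big_morph (dot x)) => [u w|]; first exact: dotDr.
by rewrite -(scale0r 0) dotZr mul0r.
Qed.

Lemma dot_delta (R : comPzRingType) d (x : 'rV[R]_d) p : dot x (delta_mx 0 p) = x 0 p.
Proof.
rewrite /dot (bigD1 p) //= big1 ?addr0 ?mxE ?eqxx ?mulr1 // => j jp.
by rewrite mxE (negbTE jp) andbF mulr0.
Qed.

Lemma dot_mulmx (R : comPzRingType) d s (x : 'rV[R]_d) (c : 'rV[R]_s) (U : 'M[R]_(s, d)) :
  dot x (c *m U) = \sum_i c 0 i * dot x (row i U).
Proof.
transitivity (\sum_j \sum_i c 0 i * (x 0 j * U i j)).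
  apply: eq_bigr => j _; rewrite mxE mulr_sumr; apply: eq_bigr => i _; ring.
rewrite exchange_big; apply: eq_bigr => i _; rewrite mulr_sumr.
by apply: eq_bigr => j _; rewrite mxE.
Qed.

Lemma dot_map (R : comPzRingType) d (x y : 'rV[int]_d) :
  dot (map_mx intr x) (map_mx intr y) = (dot x y)%:~R :> R.
Proof. by rewrite /dot rmorph_sum /=; apply: eq_bigr => j _; rewrite !mxE rmorphM. Qed.

Lemma dot_row_mx (R : pzRingType) d e (x x' : 'rV[R]_d) (y y' : 'rV[R]_e) :
  dot (row_mx x y) (row_mx x' y') = dot x x' + dot y y'.
Proof.
rewrite /dot big_split_ord /=.
by congr (_ + _); apply: eq_bigr => j _; rewrite ?row_mxEl ?row_mxEr.
Qed.

Lemma dot_sqr_ge0 (R : realDomainType) d (x : 'rV[R]_d) : 0 <= dot x x.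
Proof. by apply: sumr_ge0 => j _; rewrite -expr2 sqr_ge0. Qed.

(** * The lattice E8 *)

(** A basis of [E8] in doubled coordinates, chosen so that the first six (seven)
vectors generate the sublattice of the vectors whose coordinates of index 5, 6
and 7 (5 and 6) agree, which is [E6] ([E7]). *)
Definition e8_basis : seq (seq int) :=
  [:: [:: 0; 0; 0; 2; -2; 0; 0; 0]; [:: 2; -2; 0; 0; 0; 0; 0; 0];
      [:: 0; 2; -2; 0; 0; 0; 0; 0]; [:: 0; 0; 2; -2; 0; 0; 0; 0];
      [:: 0; 0; 0; 2; 2; 0; 0; 0]; [:: -1; -1; -1; -1; -1; -1; -1; -1];
      [:: 2; 0; 0; 0; 0; 0; 0; 2]; [:: 2; 0; 0; 0; 0; 0; 2; 0]].

Definition e8_row i : 'rV[int]_8 := \row_j nth 0 (nth [::] e8_basis i) j.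

Definition e8_gram i j : int := nth 0 (nth [::]
  [:: [:: 2; 0; 0; -1; 0; 0; 0; 0]; [:: 0; 2; -1; 0; 0; 0; 1; 1];
      [:: 0; -1; 2; -1; 0; 0; 0; 0]; [:: -1; 0; -1; 2; -1; 0; 0; 0];
      [:: 0; 0; 0; -1; 2; -1; 0; 0]; [:: 0; 0; 0; 0; -1; 2; -1; -1];
      [:: 0; 1; 0; 0; 0; -1; 2; 1]; [:: 0; 1; 0; 0; 0; -1; 1; 2]] i) j.

Lemma forall_lt8 (P : nat -> Prop) : P 0%N -> P 1%N -> P 2%N -> P 3%N -> P 4%N ->
  P 5%N -> P 6%N -> P 7%N -> forall k, (k < 8)%N -> P k.
Proof. by move=> ? ? ? ? ? ? ? ?; do 8?[case=> //]. Qed.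

Lemma e8_row_dot i j : (i < 8)%N -> (j < 8)%N ->
  dot (e8_row i) (e8_row j) = 4 * e8_gram i j.
Proof.
rewrite /dot => i8 j8; rewrite !big_ord_recl big_ord0 !mxE.
by move: i i8; apply: forall_lt8; move: j j8; apply: forall_lt8.
Qed.

(** The integral combinations [W 0], ..., [W k.-1] span a copy of [E6], [E7] or
[E8] according to [k]. *)
Definition e8_config n (B : 'M[int]_n) k (X : {set 'I_n}) (W : nat -> 'rV[int]_n) :=
  (forall i, (i < k)%N -> supp (W i) \subset X) /\
  (forall i j, (i < k)%N -> (j < k)%N -> bform B (W i) (W j) = e8_gram i j).

Notation ratv := (map_mx (intr : int -> rat)).

(** Membership in [E8], in doubled coordinates so as to stay over the
integers. *)
Definition e8_vector (m : 'rV[int]_8) :=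
  (forall j, (2 %| m 0%R j - m 0%R ord0)%Z) /\ (4 %| \sum_j m 0%R j)%Z.

Definition coord (R : Type) (x : 'rV[R]_8) j := x 0 (inord j).

Lemma sum_coord (R : pzRingType) (F : 'I_8 -> R) : \sum_j F j =
  F (inord 0) + (F (inord 1) + (F (inord 2) + (F (inord 3) + (F (inord 4) +
  (F (inord 5) + (F (inord 6) + F (inord 7))))))).
Proof.
rewrite !big_ord_recl big_ord0 addr0.
have E (i j : 'I_8) : nat_of_ord i = j -> F i = F j by move=> /val_inj ->.
by do 7?[congr (_ + _)]; apply: E; rewrite /= inordK.
Qed.

Lemma dot_coord (R : pzRingType) (x y : 'rV[R]_8) : dot x y =
  coord x 0 * coord y 0 + (coord x 1 * coord y 1 + (coord x 2 * coord y 2 +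
  (coord x 3 * coord y 3 + (coord x 4 * coord y 4 + (coord x 5 * coord y 5 +
  (coord x 6 * coord y 6 + coord x 7 * coord y 7)))))).
Proof. exact: sum_coord. Qed.

Lemma coord_row (R : Type) (F : nat -> R) j : (j < 8)%N -> coord (\row_(i < 8) F i) j = F j.
Proof. by move=> j8; rewrite /coord mxE inordK. Qed.

Lemma coord_map (R R' : Type) (f : R -> R') (x : 'rV[R]_8) j : coord (map_mx f x) j = f (coord x j).
Proof. by rewrite /coord mxE. Qed.

Lemma row8P (R : Type) (x z : 'rV[R]_8) :
  (forall j, (j < 8)%N -> coord x j = coord z j) -> x = z.
Proof. by move=> h; apply/rowP => j; have := h j (ltn_ord j); rewrite /coord inord_val. Qed.

(** A parametrization in which divisibility is replaced by equations, the form
needed by linear arithmetic. *)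
Lemma e8_vectorP (m : 'rV[int]_8) : e8_vector m <->
  exists (e : int) (h : nat -> int) (s : int), [/\ h 0%N = 0,
   forall j, (j < 8)%N -> coord m j = e + 2 * h j &
   h 1%N + h 2%N + h 3%N + h 4%N + h 5%N + h 6%N + h 7%N = 2 * s].
Proof.
have i0 : inord 0 = ord0 :> 'I_8 by apply: val_inj; rewrite /= inordK.
split.
  move=> [m2 m4]; exists (coord m 0), (fun j => divz (coord m j - coord m 0) 2).
  have mE j : coord m j = coord m 0 + 2 * divz (coord m j - coord m 0) 2.
    have : (2 %| coord m j - coord m 0)%Z by rewrite /coord i0; exact: m2.
    by move=> /divzK h; rewrite [2 * _]mulrC h addrC subrK.
  exists (divz (divz (coord m 1 - coord m 0) 2 + divz (coord m 2 - coord m 0) 2 + divz (coord m 3 - coord m 0) 2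
    + divz (coord m 4 - coord m 0) 2 + divz (coord m 5 - coord m 0) 2 + divz (coord m 6 - coord m 0) 2
    + divz (coord m 7 - coord m 0) 2) 2); split=> //; first by rewrite subrr div0z.
  move: m4; rewrite sum_coord -!/(coord m _).
  have := mE 1%N; have := mE 2%N; have := mE 3%N; have := mE 4%N; have := mE 5%N.
  have := mE 6%N; have := mE 7%N.
  move: (divz _ 2) (divz _ 2) (divz _ 2) (divz _ 2) (divz _ 2) (divz _ 2) (divz _ 2).
  by move=> a7 a6 a5 a4 a3 a2 a1 -> -> -> -> -> -> ->; move: (coord m 0) => m0; lia.
move=> [e [h [s [h0 mE hs]]]]; split.
  move=> j; have := mE j (ltn_ord j); have := mE 0%N isT.
  by rewrite /coord i0 inord_val h0 => -> ->; lia.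
rewrite sum_coord -!/(coord m _) !mE // h0; move: hs.
by move: (h 1%N) (h 2%N) (h 3%N) (h 4%N) (h 5%N) (h 6%N) (h 7%N) => *; lia.
Qed.

Lemma e8_vector_comb (m : 'rV[int]_8) a (m' : 'rV[int]_8) :
  e8_vector m -> e8_vector m' -> e8_vector (a *: m + m').
Proof.
move=> [m2 m4] [n2 n4]; split.
  move=> j; rewrite !mxE opprD addrACA -mulrBr.
  by apply: rpredD; [exact: dvdz_mull|exact: n2].
under eq_bigr do rewrite !mxE.
by rewrite big_split -mulr_sumr /=; apply: rpredD; [exact: dvdz_mull|exact: n4].
Qed.

Lemma e8_row_vector i : (i < 8)%N -> e8_vector (e8_row i).
Proof.
move=> i8; split.
  by move=> j; rewrite !mxE; move: i i8; apply: forall_lt8;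
     move: j => [j j8] /=; move: j j8; apply: forall_lt8.
under eq_bigr do rewrite mxE.
rewrite !big_ord_recl big_ord0; by move: i i8; apply: forall_lt8.
Qed.

Lemma e8_vector_even m : e8_vector m -> exists k, dot m m = 8 * k.
Proof.
move=> /e8_vectorP[e [h [s [h0 mE hs]]]]; rewrite dot_coord !mE // h0 mulr0 addr0.
have even (x : int) : exists c, x * x = x + 2 * c.
  have [c [->|->]] : exists c, x = 2 * c \/ x = 2 * c + 1 by exists (divz x 2); lia.
    by exists (2 * c * c - c); ring.
  by exists (2 * c * c + c); ring.
have [c1 e1] := even (h 1%N); have [c2 e2] := even (h 2%N); have [c3 e3] := even (h 3%N).
have [c4 e4] := even (h 4%N); have [c5 e5] := even (h 5%N); have [c6 e6] := even (h 6%N).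
have [c7 e7] := even (h 7%N).
have sq j : (e + 2 * h j) * (e + 2 * h j) = e * e + 4 * (e * h j) + 4 * (h j * h j) by ring.
rewrite !sq e1 e2 e3 e4 e5 e6 e7.
exists (e * e + e * s + s + c1 + c2 + c3 + c4 + c5 + c6 + c7).
have -> : h 1%N = 2 * s - (h 2%N + h 3%N + h 4%N + h 5%N + h 6%N + h 7%N) by rewrite -hs; ring.
have e1' : forall x : int, 0 = x - x by move=> x; rewrite subrr.
ring.
Qed.

(** The equations of the space spanned by the first [k] basis vectors, [k] being
6, 7 or 8. *)
Definition e8_level (R : Type) k (x : 'rV[R]_8) :=
  ((k <= 7)%N -> coord x 5 = coord x 6) /\ ((k <= 6)%N -> coord x 5 = coord x 7).

Lemma e8_row_level k i : (6 <= k)%N -> (i < k)%N -> (k <= 8)%N -> e8_level k (e8_row i).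
Proof.
move=> k6 ik k8; split=> kk; rewrite /e8_row !coord_row //.
  have : (i < 7)%N by exact: leq_trans kk.
  by move: i {ik}; do 7?[case=> //].
have : (i < 6)%N by exact: leq_trans kk.
by move: i {ik}; do 6?[case=> //].
Qed.

(** [E6] and [E7] are primitive in [E8]. *)
Lemma e8_spanP k (m : 'rV[int]_8) : (6 <= k <= 8)%N -> e8_vector m -> e8_level k m ->
  exists c : nat -> int, m = \sum_(i < k) c i *: e8_row i.
Proof.
move=> k68 /e8_vectorP[e [h [s [h0 mE hs]]]] [l7 l6].
pose n7 := h 6%N - h 5%N; pose n6 := h 7%N - h 5%N; pose n5 := - (e + 2 * h 5%N).
pose a0 := h 0%N - h 5%N - n6 - n7; pose b := a0 + (h 1%N - h 5%N).
pose c := b + (h 2%N - h 5%N).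
pose n4 := s - 4 * h 5%N - n6 - n7.
pose cs := [:: n4 - (h 4%N - h 5%N); a0; b; c; n4; n5; n6; n7].
have m8 : m = \sum_(i < 8) cs`_i *: e8_row i.
  apply: row8P => j j8; rewrite mE // /coord summxE.
  under eq_bigr do rewrite !mxE inordK //.
  rewrite !big_ord_recl big_ord0 /cs /= /bump /=.
  have hs' : h 1%N = 2 * s - (h 2%N + h 3%N + h 4%N + h 5%N + h 6%N + h 7%N) by rewrite -hs; ring.
  move: j j8; apply: forall_lt8; rewrite /= /n4 /c /b /a0 /n5 /n6 /n7 h0 ?hs'; ring.
exists (fun i => cs`_i); move: k68 l7 l6 => /andP[]; case: k => [//|k].
do 5?[case: k => [//|k]]; case: k => [_ _ l7 l6|k].
  have z7 : n7 = 0 by move: (l7 isT); rewrite !mE // /n7; lia.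
  have z6 : n6 = 0 by move: (l6 isT); rewrite !mE // /n6; lia.
  by rewrite {1}m8 2!big_ord_recr /= z6 z7 !scale0r !addr0.
case: k => [_ _ l7 _|k].
  have z7 : n7 = 0 by move: (l7 isT); rewrite !mE // /n7; lia.
  by rewrite {1}m8 big_ord_recr /= z7 !scale0r !addr0.
by case: k => [_ _ _ _|//].
Qed.

(** The component of [e8_row k] orthogonal to the space of level [k]. *)
Definition e8_gap k : 'rV[rat]_8 := \row_j nth 0 (nth [::]
  [:: [:: 0; 0; 0; 0; 0; - (2 / 3); - (2 / 3); 4 / 3]; [:: 0; 0; 0; 0; 0; -1; 1; 0]] (k - 6)) j.

Lemma e8_vector_mk (e s : int) (h : nat -> int) : h 0%N = 0 ->
  h 1%N + h 2%N + h 3%N + h 4%N + h 5%N + h 6%N + h 7%N = 2 * s ->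
  e8_vector (\row_(j < 8) (e + 2 * h j)).
Proof.
move=> h0 hs; apply/e8_vectorP; exists e, h, s; split=> // j j8.
exact: (coord_row (fun j => e + 2 * h j)).
Qed.

Lemma e8_row_products (Y : 'rV[rat]_8) : let y j := coord Y j in
  ((dot Y (ratv (e8_row 0)) = 2 * (y 3%N - y 4%N)) *
   (dot Y (ratv (e8_row 1)) = 2 * (y 0%N - y 1%N)) *
   (dot Y (ratv (e8_row 2)) = 2 * (y 1%N - y 2%N)) *
   (dot Y (ratv (e8_row 3)) = 2 * (y 2%N - y 3%N)) *
   (dot Y (ratv (e8_row 4)) = 2 * (y 3%N + y 4%N)) *
   (dot Y (ratv (e8_row 5)) = - (y 0%N + y 1%N + y 2%N + y 3%N + y 4%N + y 5%N + y 6%N + y 7%N)) *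
   (dot Y (ratv (e8_row 6)) = 2 * (y 0%N + y 7%N)) *
   (dot Y (ratv (e8_row 7)) = 2 * (y 0%N + y 6%N))).
Proof.
by move=> y; do 7?split; rewrite dot_coord !coord_map /e8_row !coord_row //= /y; ring.
Qed.

(** As [E8] is unimodular and its sublattice of level [k] is primitive, a vector
of level [k] with integral products is the projection of a vector of [E8]. The
quotient of the dual of [E6] ([E7]) by [E6] ([E7]) has order 3 (2) and is
generated by the projection of [e8_row k], so that the lift can be chosen to
differ from the vector by 0 or plus or minus the gap. *)
Lemma e8_lift k (Y : 'rV[rat]_8) (b : nat -> int) :
  (6 <= k <= 8)%N -> e8_level k Y ->
  (forall i, (i < k)%N -> dot Y (ratv (e8_row i)) = 4 * (b i)%:~R) ->
  (exists2 m, e8_vector m & Y = ratv m) \/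
  (k < 8)%N /\ exists (s : int) (m : 'rV[int]_8),
    [/\ s ^+ 2 = 1, e8_vector m & ratv m = Y + s%:~R *: e8_gap k].
Proof.
move=> k68 [l7 l6] hb; have k6 : (6 <= k)%N by case/andP: k68.
have lt6 i : (i < 6)%N -> (i < k)%N by move/leq_trans; apply.
have := hb 0%N (lt6 0%N isT); have := hb 1%N (lt6 1%N isT); have := hb 2%N (lt6 2%N isT).
have := hb 3%N (lt6 3%N isT); have := hb 4%N (lt6 4%N isT); have := hb 5%N (lt6 5%N isT).
rewrite !e8_row_products => E5 E4 E3 E2 E1 E0.
pose e : int := b 4%N + b 0%N + 2 * b 1%N + 2 * b 2%N + 2 * b 3%N.
pose h4 : int := - b 1%N - b 2%N - b 3%N - b 0%N.
pose hh (h5 h6 h7 : int) := nth 0 [:: 0; - b 1%N; - b 1%N - b 2%N; - b 1%N - b 2%N - b 3%N; h4; h5; h6; h7].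
have mk h5 h6 h7 (g : 'rV[rat]_8) : (forall j, (j < 5)%N -> coord g j = 0) ->
    coord Y 5 + coord g 5 = e%:~R + 2 * h5%:~R -> coord Y 6 + coord g 6 = e%:~R + 2 * h6%:~R ->
    coord Y 7 + coord g 7 = e%:~R + 2 * h7%:~R -> coord g 5 + coord g 6 + coord g 7 = 0 ->
    let m := \row_(j < 8) (e + 2 * hh h5 h6 h7 j) in e8_vector m /\ ratv m = Y + g.
  move=> g0 H5 H6 H7 gs m; have mY : ratv m = Y + g.
    apply: row8P => j j8; rewrite coord_map (coord_row (fun j => e + 2 * hh h5 h6 h7 j) j8).
    have -> : coord (Y + g) j = coord Y j + coord g j by rewrite /coord mxE.
    rewrite rmorphD rmorphM /=.
    move: j j8; apply: forall_lt8; rewrite /hh /= ?H5 ?H6 ?H7 ?g0 // /h4 /e ?rmorph0;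
      rewrite ?(rmorphD, rmorphB, rmorphN, rmorphM) /=; lra.
  split=> //; apply: (@e8_vector_mk _ (- b 5%N - 2 * e)) => //; rewrite /hh /=.
  apply/eqP; rewrite -(eqr_int rat); apply/eqP; rewrite /h4.
  rewrite !(rmorphD, rmorphB, rmorphN, rmorphM) /=.
  have e5 : (h5%:~R : rat) = (coord Y 5 + coord g 5 - e%:~R) / 2 by rewrite H5; field.
  have e6 : (h6%:~R : rat) = (coord Y 6 + coord g 6 - e%:~R) / 2 by rewrite H6; field.
  have e7 : (h7%:~R : rat) = (coord Y 7 + coord g 7 - e%:~R) / 2 by rewrite H7; field.
  rewrite e5 e6 e7 /e !(rmorphD, rmorphB, rmorphN, rmorphM) /=; lra.
have g00 : forall j, (j < 5)%N -> coord (0 : 'rV[rat]_8) j = 0 by move=> j _; rewrite /coord mxE.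
have mk0 h5 h6 h7 : coord Y 5 = e%:~R + 2 * h5%:~R -> coord Y 6 = e%:~R + 2 * h6%:~R ->
    coord Y 7 = e%:~R + 2 * h7%:~R -> exists2 m, e8_vector m & Y = ratv m.
  move=> H5 H6 H7; have := mk h5 h6 h7 0 g00; rewrite /coord !mxE -!/(coord _ _) !addr0.
  by case/(_ H5 H6 H7 erefl) => m1 m2; eexists; [exact: m1|rewrite m2].
move: k68 l7 l6 hb {lt6 k6} => /andP[]; case: k => [//|k].
do 5?[case: k => [//|k]]; case: k => [_ _ l7 l6 _|k].
  have {}l7 := l7 isT; have {}l6 := l6 isT.
  pose u : int := - (2 * b 5%N + 4 * b 4%N + b 1%N + 2 * b 2%N + 3 * b 3%N).
  have uE : coord Y 5 = e%:~R + 2 * h4%:~R + 2 / 3 * u%:~R.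
    rewrite /e /h4 /u !(rmorphD, rmorphB, rmorphN, rmorphM) /=; lra.
  have gE j : (j < 8)%N -> coord (e8_gap 6) j = nth 0 [:: 0; 0; 0; 0; 0; - (2 / 3); - (2 / 3); 4 / 3] j.
    exact: (coord_row (nth 0 [:: 0; 0; 0; 0; 0; - (2 / 3); - (2 / 3); 4 / 3])).
  have gZ (s : int) j : (j < 8)%N -> coord (s%:~R *: e8_gap 6) j =
      s%:~R * nth 0 [:: 0; 0; 0; 0; 0; - (2 / 3); - (2 / 3); 4 / 3] j.
    by move=> j8; rewrite -gE // /coord mxE.
  have g0 (s : int) j : (j < 5)%N -> coord (s%:~R *: e8_gap 6) j = 0.
    move=> j5; rewrite gZ ?(leq_trans j5) //; move: j j5.
    by do 5?[case=> [|//]]; rewrite /= mulr0.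
  have [q [uq|[uq|uq]]] : exists q, u = 3 * q \/ u = 3 * q + 1 \/ u = 3 * q + 2.
    by exists (divz u 3); lia.
  - left; apply: (mk0 (h4 + q) (h4 + q) (h4 + q)); rewrite -?l6 -?l7 uE uq !(rmorphD, rmorphM) /=; lra.
  - right; split=> //; exists 1; have [||||m1 m2] := mk (h4 + q) (h4 + q) (h4 + q + 1) (1%:~R *: e8_gap 6) (g0 1); try by rewrite !gZ //= -?l6 -?l7 ?uE ?uq !(rmorphD, rmorphM) /=; lra.
    by eexists; split; [|exact: m1|rewrite m2].
  - right; split=> //; exists (-1); have [||||m1 m2] := mk (h4 + q + 1) (h4 + q + 1) (h4 + q) ((-1)%:~R *: e8_gap 6) (g0 (-1)); try by rewrite !gZ //= -?l6 -?l7 ?uE ?uq !(rmorphD, rmorphM, rmorphN) /=; lra.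
    by eexists; split; [|exact: m1|rewrite m2].
case: k => [_ _ l7 _ hb|k].
  have {}l7 := l7 isT; have := hb 6%N isT; rewrite e8_row_products => E6.
  pose u : int := - (2 * b 5%N + 3 * b 4%N + b 2%N + 2 * b 3%N + b 6%N).
  have uE : coord Y 5 = e%:~R + 2 * h4%:~R + u%:~R.
    rewrite /e /h4 /u !(rmorphD, rmorphB, rmorphN, rmorphM) /=; lra.
  have y7 : coord Y 7 = e%:~R + 2 * (b 6%N - e)%:~R.
    rewrite /e !(rmorphD, rmorphB, rmorphN, rmorphM) /=; lra.
  have gZ j : (j < 8)%N -> coord (1%:~R *: e8_gap 7) j = nth 0 [:: 0; 0; 0; 0; 0; -1; 1; 0] j.
    move=> j8; rewrite scale1r.
    exact: (coord_row (nth 0 [:: 0; 0; 0; 0; 0; -1; 1; 0])).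
  have g0 j : (j < 5)%N -> coord (1%:~R *: e8_gap 7) j = 0.
    by move=> j5; rewrite gZ ?(leq_trans j5) //; move: j j5; do 5?[case=> [|//]].
  have [q [uq|uq]] : exists q, u = 2 * q \/ u = 2 * q + 1 by exists (divz u 2); lia.
  - left; apply: (mk0 (h4 + q) (h4 + q) (b 6%N - e)) => //; rewrite -?l7 uE uq !(rmorphD, rmorphM) /=; lra.
  - right; split=> //; exists 1; have [||||m1 m2] := mk (h4 + q) (h4 + q + 1) (b 6%N - e) (1%:~R *: e8_gap 7) g0; try by rewrite !gZ //= -?l7 ?y7 ?uE ?uq !(rmorphD, rmorphM) /=; lra.
    by eexists; split; [|exact: m1|rewrite m2].
case: k => [_ _ _ _ hb|//].
have := hb 6%N isT; have := hb 7%N isT; rewrite !e8_row_products => E7 E6; left.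
apply: (mk0 (2 * (- b 5%N - 2 * e) - (- b 1%N + (- b 1%N - b 2%N) + (- b 1%N - b 2%N - b 3%N) +
  h4 + (b 7%N - e) + (b 6%N - e))) (b 7%N - e) (b 6%N - e)); rewrite /h4 /e !(rmorphD, rmorphB, rmorphN, rmorphM) /=; lra.
Qed.

Lemma e8_level_comb (R : pzRingType) k (a : R) (x z : 'rV[R]_8) :
  e8_level k x -> e8_level k z -> e8_level k (a *: x + z).
Proof.
have E j : coord (a *: x + z) j = a * coord x j + coord z j by rewrite /coord !mxE.
by move=> [x7 x6] [z7 z6]; split=> h; rewrite !E ?(x7 h) ?(z7 h) ?(x6 h) ?(z6 h).
Qed.

Lemma e8_level_mulmx (R : pzRingType) k l (z : 'rV[R]_l) (H : 'M[R]_(l, 8)) :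
  (forall i, e8_level k (row i H)) -> e8_level k (z *m H).
Proof.
have E j : coord (z *m H) j = \sum_i z 0 i * coord (row i H) j.
  by rewrite /coord mxE; apply: eq_bigr => i _; rewrite mxE.
move=> hH; split=> h; rewrite !E; apply: eq_bigr => i _; have [h7 h6] := hH i.
  by rewrite (h7 h).
by rewrite (h6 h).
Qed.

Lemma e8_level_map (R : pzRingType) k (f : {rmorphism int -> R}) (x : 'rV[int]_8) :
  e8_level k x -> e8_level k (map_mx f x).
Proof. by move=> [x7 x6]; split=> h; rewrite !coord_map ?(x7 h) ?(x6 h). Qed.

Lemma e8_level_int k (x : 'rV[int]_8) : e8_level k (ratv x) -> e8_level k x.
Proof.
by move=> [x7 x6]; split=> h; [move: (x7 h)|move: (x6 h)]; rewrite !coord_map => /intr_inj.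
Qed.

Lemma e8_gap_facts k : (6 <= k < 8)%N ->
  [/\ forall x, e8_level k x -> dot (e8_gap k) x = 0,
      e8_level k (ratv (e8_row k) - e8_gap k) &
      0 < dot (e8_gap k) (e8_gap k) < 4].
Proof.
have E (x z : 'rV[rat]_8) j : coord (x - z) j = coord x j - coord z j by rewrite /coord !mxE.
have C (F : nat -> rat) j : (j < 8)%N -> coord (\row_(i < 8) F i) j = F j by exact: coord_row.
move=> /andP[]; case: k => [//|k]; do 5?[case: k => [//|k]].
case: k => [_ _|k].
  have G j : (j < 8)%N -> coord (e8_gap 6) j = nth 0 [:: 0; 0; 0; 0; 0; - (2 / 3); - (2 / 3); 4 / 3] j.
    exact: C.
  have dG x : dot (e8_gap 6) x = - (2 / 3) * coord x 5 - 2 / 3 * coord x 6 + 4 / 3 * coord x 7.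
    by rewrite dot_coord !G //=; ring.
  split=> [x [x7 x6]||].
  - rewrite dG -(x7 isT) -(x6 isT); ring.
  - split=> h; rewrite !E !coord_map /e8_row !coord_row // !G //=; lra.
  - have G5 : coord (e8_gap 6) 5 = - (2 / 3) by exact: (G 5%N).
    have G6 : coord (e8_gap 6) 6 = - (2 / 3) by exact: (G 6%N).
    have G7 : coord (e8_gap 6) 7 = 4 / 3 by exact: (G 7%N).
    rewrite dG; move: (coord _ _) (coord _ _) (coord _ _) G5 G6 G7 => a b c -> -> ->; lra.
case: k => [_ _|//].
have G j : (j < 8)%N -> coord (e8_gap 7) j = nth 0 [:: 0; 0; 0; 0; 0; -1; 1; 0] j.
  exact: C.
have dG x : dot (e8_gap 7) x = coord x 6 - coord x 5 by rewrite dot_coord !G //=; ring.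
split=> [x [x7 x6]||].
- by rewrite dG (x7 isT) subrr.
- split=> h //; rewrite !E !coord_map /e8_row !coord_row // !G //=; lra.
- have G5 : coord (e8_gap 7) 5 = - 1 by exact: (G 5%N).
  have G6 : coord (e8_gap 7) 6 = 1 by exact: (G 6%N).
  rewrite dG; move: (coord _ _) (coord _ _) G6 G5 => a b -> ->; lra.
Qed.

Lemma e8_gramC i j : (i < 8)%N -> (j < 8)%N -> e8_gram i j = e8_gram j i.
Proof.
move=> i8 j8; have := e8_row_dot i8 j8; rewrite dotC e8_row_dot // => h; lia.
Qed.

Lemma e8_gram_diag i : (i < 8)%N -> e8_gram i i = 2.
Proof. by move: i; apply: forall_lt8. Qed.

(** * Projections and integral representations *)

Section LocalForm.
Variables (n : nat) (B : 'M[int]_n) (N : nat).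
Hypothesis sB : B^T = B.
Hypothesis dB : forall i, B i i <= 2.
Hypothesis lpB : locally_psd B N.

Lemma B_sym i j : B i j = B j i.
Proof. by rewrite -{1}sB mxE. Qed.

Lemma supp_map (w : 'rV[int]_n) : supp (ratv w) = supp w.
Proof. by apply/setP => i; rewrite !inE mxE intr_eq0. Qed.

Lemma local_ge0 (w : 'rV[int]_n) : (#|supp w| <= N)%N -> 0 <= bform B w w.
Proof. by move=> cw; rewrite -(ler_int rat) -bform_map lpB // supp_map. Qed.

Lemma suppD_sub (R : pzRingType) m (X : {set 'I_m}) (u v : 'rV[R]_m) :
  supp u \subset X -> supp v \subset X -> supp (u + v) \subset X.
Proof.
move=> uX vX; apply/subsetP => i; rewrite inE mxE; apply: contraR => iX.
have : i \notin supp u by apply: contra iX; exact/subsetP.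
have : i \notin supp v by apply: contra iX; exact/subsetP.
by rewrite !inE !negbK => /eqP -> /eqP ->; rewrite addr0.
Qed.

Lemma suppZ_sub (R : pzRingType) m (X : {set 'I_m}) a (u : 'rV[R]_m) :
  supp u \subset X -> supp (a *: u) \subset X.
Proof.
move=> uX; apply/subsetP => i; rewrite inE mxE; apply: contraR => iX.
have : i \notin supp u by apply: contra iX; exact/subsetP.
by rewrite inE negbK => /eqP ->; rewrite mulr0.
Qed.

Lemma supp_delta (R : nzRingType) m (x : 'I_m) : supp (delta_mx 0 x : 'rV[R]_m) = [set x].
Proof. by apply/setP => i; rewrite !inE mxE eqxx /=; case: (i == x); rewrite ?oner_eq0 ?eqxx. Qed.

Lemma supp_mulmx_sub (R : pzRingType) k m (X : {set 'I_m}) (z : 'rV[R]_k) (W : 'M[R]_(k, m)) :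
  (forall i, supp (row i W) \subset X) -> supp (z *m W) \subset X.
Proof.
move=> WX; apply/subsetP => j; rewrite inE; apply: contraR => jX.
rewrite mxE big1 // => i _.
have : j \notin supp (row i W) by apply: contra jX; exact/subsetP.
by rewrite inE negbK mxE => /eqP ->; rewrite mulr0.
Qed.

(** By Cauchy-Schwarz on the support of [w] and one more coordinate. *)
Lemma local_null (w : 'rV[int]_n) : (#|supp w| < N)%N -> bform B w w = 0 ->
  forall x, bform B w (delta_mx 0 x) = 0.
Proof.
move=> cw w0 x; set b := bform _ _ _.
have := @local_ge0 ((- 2 * b) *: w + 1 *: delta_mx 0 x).
rewrite (bform_lin2 sB) w0 bform_delta -/b => h.
have {}h : 0 <= (- 2 * b) ^+ 2 * 0 + - 2 * b * 1 * b *+ 2 + 1 ^+ 2 * B x x.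
  apply: h; apply: leq_trans cw; apply: (@leq_trans #|x |: supp w|).
    apply/subset_leq_card/suppD_sub; apply: suppZ_sub; first exact: subsetUr.
    by rewrite supp_delta sub1set setU11.
  by rewrite cardsU1 -[X in (_ <= X)%N]add1n leq_add2r leq_b1.
have := dB x; nia.
Qed.

Lemma diag_ge0 i : (0 < N)%N -> 0 <= B i i.
Proof. by move=> N0; rewrite -bform_delta local_ge0 // supp_delta cards1. Qed.

(** The orthogonal projection of [t] to the span of the rows of [W] involves only
the support of these vectors, and so exists although [B] is positive on small
supports only. The span is identified with the span of the rows of [H] in a
Euclidean space. *)
Lemma local_projection k d (W : 'M[int]_(k, n)) (H : 'M[rat]_(k, d))
    (t : 'rV[int]_n) (X : {set 'I_n}) :
  (#|X| <= N)%N -> (forall i, supp (row i W) \subset X) -> supp t \subset X ->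
  (forall i j, (bform B (row i W) (row j W))%:~R = dot (row i H) (row j H)) ->
  exists z : 'rV[rat]_k,
    (forall i, dot (z *m H) (row i H) = (bform B (row i W) t)%:~R) /\
    dot (z *m H) (z *m H) <= (bform B t t)%:~R.
Proof.
move=> cX WX tX WH; pose M := H *m H^T; pose Br : 'M[rat]_n := ratv B.
have sBr : Br^T = Br by rewrite map_trmx sB.
pose h := ratv t *m Br *m (ratv W)^T.
have ME : ratv W *m Br *m (ratv W)^T = M.
  apply/matrixP => i j; rewrite map_trmx -!map_mxM mxE.
  have -> : (W *m B *m W^T) i j = bform B (row i W) (row j W).
    by rewrite !rowE bform_mul bform_delta.
  by rewrite /= WH !mxE; apply: eq_bigr => l _; rewrite !mxE.
have hE i : h 0 i = (bform B (row i W) t)%:~R.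
  rewrite (bformC sB) /h map_trmx -!map_mxM mxE; congr (_ %:~R).
  by rewrite /bform rowE trmx_mul mulmxA trmx_delta -colE [RHS]mxE.
have psd a (z : 'rV[rat]_k) : 0 <= a ^+ 2 * bform M z z + a * 1 * (h *m z^T) 0 0 *+ 2 + (bform B t t)%:~R.
  have := lpB (w := a *: (z *m ratv W) + 1 *: ratv t); rewrite (bform_lin2 sBr).
  rewrite bform_mul ME bform_map expr1n mul1r (bformC sBr).
  have -> : bform Br (ratv t) (z *m ratv W) = (h *m z^T) 0 0.
    by rewrite /bform trmx_mul !mulmxA.
  apply.
  apply: leq_trans cX; apply/subset_leq_card/suppD_sub; apply: suppZ_sub; last by rewrite supp_map.
  by apply: supp_mulmx_sub => i; rewrite -map_row supp_map.
have : (h <= M)%MS.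
  rewrite submxE; apply/eqP/rowP => j; rewrite [RHS]mxE.
  set c : 'rV[rat]_k := (col j (cokermx M))^T.
  have Mc : M *m c^T = 0 by rewrite trmxK colE mulmxA mulmx_coker mul0mx.
  have -> : (h *m cokermx M) 0 j = (h *m c^T) 0 0.
    transitivity (col j (h *m cokermx M) 0 0); first by rewrite [RHS]mxE.
    by rewrite trmxK !colE (mulmxA h (cokermx M)).
  apply: (@lin_quad0 _ _ ((bform B t t)%:~R)) => a.
  case: (eqVneq a 0) => [->|a0].
    rewrite mul0r mul0rn expr0n mul0r addr0 //.
  have := psd a^-1 c; rewrite {1}/bform -mulmxA Mc mulmx0 mxE mulr0 add0r mulr1.
  rewrite -(pmulr_rge0 (x := a ^+ 2)) ?exprn_even_gt0 //.
  by rewrite mulrDr -mulrnAr mulrA expr2 mulfK // mulrnAr.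
case/submxP => z hz; exists z.
have zM i : dot (z *m H) (row i H) = h 0 i.
  by rewrite hz /M mulmxA [RHS]mxE; apply: eq_bigr => j _; rewrite !mxE.
split=> [i|]; first by rewrite zM hE.
have := psd (-1) z; rewrite sqrrN expr1n mul1r mulr1 mulN1r.
have -> : bform M z z = (h *m z^T) 0 0 by rewrite /bform -hz.
have -> : dot (z *m H) (z *m H) = (h *m z^T) 0 0.
  rewrite dot_mulmx mxE; apply: eq_bigr => i _.
  by rewrite zM [z^T _ _]mxE mulrC.
by lra.
Qed.

Definition integral_rep d (U : 'M[int]_(n, d)) (S : {set 'I_n}) :=
  {in S &, forall s s', B s s' = dot (row s U) (row s' U)}.

Lemma integral_rep_projection d (U : 'M[int]_(n, d)) (S X : {set 'I_n}) t :
  integral_rep U S -> X \subset S -> (#|X| < N)%N ->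
  exists y : 'rV[rat]_d,
    (forall s, s \in X -> dot y (ratv (row s U)) = (B s t)%:~R) /\
    dot y y <= (B t t)%:~R.
Proof.
move=> zU XS cX.
pose W : 'M[int]_n := \matrix_(i, j) (if i \in X then (i == j)%:R else 0).
pose H : 'M[int]_(n, d) := \matrix_(i, j) (if i \in X then U i j else 0).
have rW i : row i W = if i \in X then delta_mx 0 i else 0.
  by apply/rowP => j; rewrite !mxE; case: ifP; rewrite ?mxE // eqxx eq_sym.
have rH i : row i H = if i \in X then row i U else 0.
  by apply/rowP => j; rewrite !mxE; case: ifP; rewrite ?mxE.
have dot0l x : dot (0 : 'rV[int]_d) x = 0 by rewrite -(scale0r 0) dotZl mul0r.
have dot0r x : dot x (0 : 'rV[int]_d) = 0 by rewrite dotC dot0l.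
have [||||z [z1 z2]] := @local_projection _ _ W (ratv H) (delta_mx 0 t) (t |: X).
- by rewrite cardsU1; apply: leq_trans cX; rewrite -[X in (_ <= X)%N]add1n leq_add2r leq_b1.
- move=> i; rewrite rW; case: ifP => iX; first by rewrite supp_delta sub1set in_setU1 iX orbT.
  by apply/subsetP => j; rewrite inE mxE eqxx.
- by rewrite supp_delta sub1set setU11.
- move=> i j; rewrite -!map_row dot_map; congr (_ %:~R); rewrite !rW !rH.
  case: ifP => iX; last by rewrite bform0l dot0l.
  case: ifP => jX; last by rewrite bform0r dot0r.
  by rewrite bform_delta zU // (subsetP XS).
exists (z *m ratv H); split=> [s sX|]; last by rewrite bform_delta in z2.
by have := z1 s; rewrite -map_row rH rW sX bform_delta.
Qed.

(** Connectedness of [S] for the relation [B s s' <> 0], phrased by cuts: a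
growing subset always finds an edge that leaves it. *)
Definition linked (S : {set 'I_n}) := forall S1 : {set 'I_n},
  S1 \subset S -> S1 != set0 -> S1 != S ->
  exists s s', [/\ s \in S1, s' \in S :\: S1 & B s s' != 0].

Definition zsupp d (U : 'M[int]_(n, d)) (S : {set 'I_n}) :=
  [set p | [exists s in S, U s p != 0]].

Lemma zsuppP d (U : 'M[int]_(n, d)) (S : {set 'I_n}) p :
  reflect (exists2 s, s \in S & U s p != 0) (p \in zsupp U S).
Proof. by rewrite inE; exact: exists_inP. Qed.

Lemma integral_rep_norm d (U : 'M[int]_(n, d)) S s : integral_rep U S -> s \in S ->
  \sum_j U s j ^+ 2 <= 2.
Proof.
move=> zU sS; apply: le_trans (dB s); rewrite zU //.
by apply: ler_sum => j _; rewrite !mxE expr2.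
Qed.

Lemma norm2_two d (x : 'rV[int]_d) p q : p != q -> \sum_j x 0 j ^+ 2 <= 2 ->
  x 0 p != 0 -> x 0 q != 0 ->
  [/\ x 0 p ^+ 2 = 1, x 0 q ^+ 2 = 1 & x = x 0 p *: delta_mx 0 p + x 0 q *: delta_mx 0 q].
Proof.
move=> pq; rewrite (bigD1 p) //= (bigD1 q) /= ?(eq_sym q p) //.
set r := \sum_(i | _) _ => h xp xq.
have r0 : 0 <= r by apply: sumr_ge0 => i _; exact: sqr_ge0.
have p1 : 1 <= x 0 p ^+ 2 by rewrite -gtz0_ge1 exprn_even_gt0.
have q1 : 1 <= x 0 q ^+ 2 by rewrite -gtz0_ge1 exprn_even_gt0.
have re : r = 0 by lia.
split; try by lia.
apply/rowP => j; rewrite !mxE eqxx /=.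
have [->|jp] := eqVneq j p; first by rewrite (negbTE pq) mulr1 mulr0 addr0.
have [->|jq] := eqVneq j q; first by rewrite mulr1 mulr0 add0r.
rewrite !mulr0 addr0; have /psumr_eq0P h0 := re.
by apply/eqP; rewrite -sqrf_eq0 h0 ?jp ?jq // => i _; exact: sqr_ge0.
Qed.

Lemma delta_mulmx d (U : 'M[int]_(n, d)) s : delta_mx 0 s *m U = row s U.
Proof. by rewrite rowE. Qed.

(** In a connected set, all coordinates are linked to [p]: some [s] in [S] has a
nonzero entry both at a coordinate reached so far and at a new one, and, having
norm at most 2, it is the sum of these two entries. The set [X] of the vectors
that are used grows by one for each coordinate. *)
Lemma reach d (U : 'M[int]_(n, d)) (S : {set 'I_n}) p k :
  integral_rep U S -> linked S -> p \in zsupp U S ->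
  exists (X : {set 'I_n}) (J : {set 'I_d}),
    [/\ [/\ X \subset S, J \subset zsupp U S & p \in J], (#|X| <= k)%N,
        (k < #|J|)%N \/ J = zsupp U S &
        forall q, q \in J -> exists (tau : int) (c : 'rV[int]_n),
          [/\ tau ^+ 2 = 1, supp c \subset X
            & c *m U = delta_mx 0 p - tau *: delta_mx 0 q]].
Proof.
move=> zU lS pI; elim: k => [|k [X [J [[XS JI pJ] cX cJ hJ]]]].
  exists set0, [set p]; split; rewrite ?cards0 ?cards1 //; last 1 first.
  - move=> q; rewrite inE => /eqP ->; exists 1, 0; split; rewrite ?expr1n //.
      by apply/subsetP => i; rewrite inE mxE eqxx.
    by rewrite mul0mx scale1r subrr.
  - by rewrite sub0set sub1set set11.
  - by left.
have [JE|JnI] := eqVneq J (zsupp U S).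
  by exists X, J; split=> //; [exact: leqW|right].
have {cJ} cJ : (k < #|J|)%N by case: cJ => // JE; rewrite JE eqxx in JnI.
have [s [p1 [q [sS p1J qJ [Up Uq]]]]] : exists s p1 q,
    [/\ s \in S, p1 \in J, q \notin J & U s p1 != 0 /\ U s q != 0].
  apply: contrapT => ncross.
  pose S1 := [set s in S | [exists p1 in J, U s p1 != 0]].
  have cr s p1 q : s \in S -> p1 \in J -> U s p1 != 0 -> q \notin J -> U s q = 0.
    move=> sS p1J Up qJ; apply/eqP; apply: contrapT => /negP Uq; apply: ncross.
    by exists s, p1, q.
  have [|||s [s' [sS1]]] := lS S1.
  - by apply/subsetP => s; rewrite inE => /andP[].
  - apply/set0Pn; have /zsuppP[s sS Us] := pI.
    by exists s; rewrite inE sS; apply/exists_inP; exists p.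
  - apply: contra JnI => /eqP S1E; rewrite eqEsubset JI /=.
    apply/subsetP => q /zsuppP[s sS Us]; apply: contraT => qJ.
    move: sS; rewrite -S1E inE => /andP[sS /exists_inP[p1 p1J Up]].
    by rewrite (cr s p1 q) ?eqxx in Us.
  rewrite in_setD => /andP[s'S1 s'S].
  move: sS1; rewrite inE => /andP[sS /exists_inP[p1 p1J Up]].
  rewrite zU // /dot big1 ?eqxx // => j _; rewrite !mxE.
  have [jJ|jJ] := boolP (j \in J); last by rewrite (cr s p1) ?mul0r.
  suff -> : U s' j = 0 by rewrite mulr0.
  apply/eqP; apply: contraNT s'S1 => Uj; rewrite inE s'S.
  by apply/exists_inP; exists j.
exists (s |: X), (q |: J); split.
- by rewrite !subUset !sub1set sS XS JI in_setU1 pJ orbT; split=> //;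
    rewrite andbT; apply/zsuppP; exists s.
- by rewrite cardsU1 -[X in (_ <= X)%N]add1n leq_add // leq_b1.
- by left; rewrite cardsU1 qJ.
move=> q'; rewrite in_setU1 => /orP[/eqP ->|q'J]; last first.
  have [tau [c [t2 cX' cU]]] := hJ q' q'J; exists tau, c; split=> //.
  exact: subset_trans cX' (subsetUr _ _).
have [tau [c [t2 cX' cU]]] := hJ p1 p1J.
have p1q : p1 != q by apply: contraNneq qJ => <-.
have [] := @norm2_two _ (row s U) p1 q p1q; rewrite ?mxE //.
  by under eq_bigr do rewrite mxE; exact: integral_rep_norm zU sS.
move=> U1 U2 UE; exists (- tau * U s p1 * U s q), (c + (tau * U s p1) *: delta_mx 0 s); split.
- by rewrite !exprMn sqrrN t2 U1 U2.
- apply: suppD_sub; first exact: subset_trans cX' (subsetUr _ _).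
  by apply: suppZ_sub; rewrite supp_delta sub1set setU11.
rewrite mulmxDl cU -scalemxAl delta_mulmx UE scalerDr !scalerA -mulrA -expr2 U1 mulr1.
by rewrite addrA subrK !mulNr scaleNr opprK.
Qed.

(** If the norm of [t] exceeds that of its projection by 1, then a new coordinate
accounts for the difference. *)
Lemma integral_rep_add d (U : 'M[int]_(n, d)) (S : {set 'I_n}) t (x : 'rV[int]_d) :
  integral_rep U S -> t \notin S -> (forall s, s \in S -> dot x (row s U) = B s t) ->
  dot x x <= B t t <= dot x x + 1 ->
  exists d' (U' : 'M[int]_(n, d')), integral_rep U' (t |: S).
Proof.
move=> zU tS hx hn; pose e := B t t - dot x x.
pose V : 'M[int]_(n, d) := \matrix_(i, j) (if i == t then x 0 j else U i j).
pose E : 'M[int]_(n, 1) := \matrix_(i, j) (if i == t then e else 0).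
exists (d + 1)%N, (row_mx V E).
have e2 : e * e = e.
  have /orP[/eqP ->|/eqP ->] : (e == 0) || (e == 1) by rewrite /e; lia.
  - by rewrite mulr0.
  - by rewrite mulr1.
have D s s' : dot (row s (row_mx V E)) (row s' (row_mx V E)) =
    dot (row s V) (row s' V) + E s 0 * E s' 0.
  by rewrite !row_row_mx dot_row_mx {2}/dot big_ord1 ![row _ E _ _]mxE.
have VS s : s \in S -> row s V = row s U.
  move=> sS; apply/rowP => j; rewrite !mxE ifN //.
  by apply: contraNneq tS => <-.
have Vt : row t V = x by apply/rowP => j; rewrite !mxE eqxx.
have ES s : s \in S -> E s 0 = 0.
  by move=> sS; rewrite mxE ifN //; apply: contraNneq tS => <-.
have Et : E t 0 = e by rewrite mxE eqxx.
move=> s s'; rewrite !in_setU1 => /orP[/eqP ->|sS] /orP[/eqP ->|s'S]; rewrite D.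
- by rewrite Vt Et e2 /e addrC subrK.
- by rewrite Vt (VS _ s'S) (ES _ s'S) mulr0 addr0 hx // B_sym.
- by rewrite Vt (VS _ sS) (ES _ sS) mul0r addr0 dotC hx.
- by rewrite !VS // (ES _ sS) mul0r addr0 zU.
Qed.

Lemma linked_add (S : {set 'I_n}) t s0 : linked S -> s0 \in S -> B s0 t != 0 -> linked (t |: S).
Proof.
move=> lS s0S bt S1 S1S S10 S1n.
have [S1t|S1t] := eqVneq (S1 :&: S) set0.
  have S1E : S1 = [set t].
    apply/eqP; rewrite eqEsubset sub1set; apply/andP; split.
      apply/subsetP => s sS1; have := subsetP S1S _ sS1; rewrite in_setU1 inE.
      by case/orP => // sS; move: (in_set0 s); rewrite -S1t inE sS1 sS.
    have /set0Pn[s sS1] := S10; have := subsetP S1S _ sS1; rewrite in_setU1.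
    by case/orP => [/eqP <- //|sS]; move: (in_set0 s); rewrite -S1t inE sS1 sS.
  case: (boolP (s0 \in S1)) => s0S1.
    by move: (in_set0 s0); rewrite -S1t inE s0S1 s0S.
  by exists t, s0; rewrite S1E set11 B_sym bt in_setD in_setU1 s0S orbT -S1E s0S1.
have [S1E|S1E] := eqVneq (S1 :&: S) S.
  have SS1 : S \subset S1 by rewrite -S1E subsetIl.
  exists s0, t; split; rewrite ?(subsetP SS1) // in_setD setU11 andbT.
  apply: contra S1n => tS1; rewrite eqEsubset S1S /=.
  by rewrite subUset sub1set tS1 SS1.
have [s [s' [sS1 + bs]]] := lS _ (subsetIr S1 S) S1t S1E.
rewrite in_setD in_setI negb_and => /andP[/orP[s'S1|/negbTE ->] // s'S].
exists s, s'; split=> //; last by rewrite in_setD s'S1 in_setU1 s'S orbT.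
by move: sS1; rewrite inE => /andP[].
Qed.

Lemma linked1 x : linked [set x].
Proof.
move=> S1 S1x S10; rewrite eqEsubset S1x sub1set /= => xS1.
have /set0Pn[s sS1] := S10; have := subsetP S1x _ sS1; rewrite inE => /eqP sx.
by rewrite -sx sS1 in xS1.
Qed.

(** Modulo the span of [X], the unit vectors of the coordinates in [J] agree up to
sign. *)
Definition linked_coords d (U : 'M[int]_(n, d)) (X : {set 'I_n}) p (J : {set 'I_d}) :=
  forall q, q \in J -> exists (tau : int) (c : 'rV[int]_n),
    [/\ tau ^+ 2 = 1, supp c \subset X & c *m U = delta_mx 0 p - tau *: delta_mx 0 q].

Lemma dot_ratv_delta d (z : 'rV[rat]_d) p : dot z (ratv (delta_mx 0 p)) = z 0 p.
Proof. by rewrite map_delta_mx dot_delta. Qed.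

Lemma dot_ratv_mulmx d (z : 'rV[rat]_d) (U : 'M[int]_(n, d)) (c : 'rV[int]_n) (X : {set 'I_n}) (h : 'I_n -> int) :
  supp c \subset X -> (forall s, s \in X -> dot z (ratv (row s U)) = (h s)%:~R) ->
  dot z (ratv (c *m U)) = (\sum_s c 0 s * h s)%:~R.
Proof.
move=> cX hz; rewrite map_mxM dot_mulmx rmorph_sum; apply: eq_bigr => s _.
rewrite mxE -map_row rmorphM /=; have [->|cs] := eqVneq (c 0 s) 0; first by rewrite !mul0r.
by rewrite hz // (subsetP cX) // inE.
Qed.

(** One of the coordinates [q] of [J] has an entry of square at most [C / #|J|],
and the entry at [p] differs from it, up to sign, by an integer. *)
Lemma linked_coords_close d (U : 'M[int]_(n, d)) X p J (z : 'rV[rat]_d) (h : 'I_n -> int) C :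
  linked_coords U X p J -> p \in J ->
  (forall s, s \in X -> dot z (ratv (row s U)) = (h s)%:~R) -> dot z z <= C ->
  exists a : int, (z 0 p - a%:~R) ^+ 2 * #|J|%:R <= C /\
    ((forall s, h s = 0) -> a = 0).
Proof.
move=> hJ pJ hz zC.
have [q qJ qC] : exists2 q, q \in J & z 0 q ^+ 2 * #|J|%:R <= C.
  apply: contrapT => hq; suff : C * #|J|%:R < C * #|J|%:R by rewrite ltxx.
  have J0 : 0 < (#|J|%:R : rat) by rewrite ltr0n; apply/card_gt0P; exists p.
  apply: (@lt_le_trans _ _ (\sum_(q in J) z 0 q ^+ 2 * #|J|%:R)).
    rewrite mulr_natr -sumr_const; apply: ltr_sum => [|q qJ].
      by apply/hasP; exists p; rewrite ?mem_index_enum.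
    by rewrite ltNge; apply/negP => qC; apply: hq; exists q.
  rewrite -mulr_suml ler_wpM2r ?ler0n //; apply: le_trans zC.
  rewrite /dot [leRHS](bigID (mem J)) /= -[leLHS]addr0 lerD //.
  by apply: sumr_ge0 => i _; rewrite -expr2 sqr_ge0.
have [tau [c [t2 cX cU]]] := hJ q qJ.
exists (\sum_s c 0 s * h s); split; last first.
  by move=> h0; apply: big1 => s _; rewrite h0 mulr0.
rewrite -(dot_ratv_mulmx cX hz) cU map_mxB map_mxZ dotDr dotNr dotZr !dot_ratv_delta.
rewrite opprD opprK addNKr exprMn (_ : _ ^+ 2 = 1) ?mul1r //.
by rewrite -rmorphXn /= t2.
Qed.

Lemma dot_close (R : realDomainType) d (x : 'rV[R]_d) (C : R) (P : {set 'I_d}) :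
  dot x x <= C -> \sum_(p in P) x 0 p ^+ 2 <= C.
Proof.
apply: le_trans; rewrite /dot [leRHS](bigID (mem P)) /= -[leLHS]addr0 lerD //.
by apply: sumr_ge0 => i _; rewrite -expr2 sqr_ge0.
Qed.

Lemma sqr_bound (R : realFieldType) (e C r b M : R) :
  e ^+ 2 * M <= C -> C <= r ^+ 2 * b -> b <= M -> 0 <= r -> 0 < b -> `|e| <= r.
Proof.
move=> h1 h2 h3 r0 b0; rewrite -(ger0_norm r0) -ler_sqr ?nnegrE // !real_normK ?num_real //.
rewrite -(ler_pM2r b0); apply: le_trans h2; apply: le_trans h1.
by rewrite ler_wpM2l ?sqr_ge0.
Qed.

Lemma rounded_sqr (R : realFieldType) (a : int) (b : R) :
  a != 0 -> `|b - a%:~R| <= 3 / 20 -> (a ^+ 2)%:~R * 17 ^+ 2 <= b ^+ 2 * 20 ^+ 2.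
Proof.
move=> a0 hab; have a1 : 1 <= (`|a|%:~R : R) by rewrite -[1]/(1%:~R) ler_int -gtz0_ge1 normr_gt0.
rewrite -(real_normK (num_real a)) -(real_normK (num_real b)) rmorphXn /=.
have : `|a|%:~R - 3 / 20 <= `|b|.
  rewrite intr_norm; have := ler_distD b (a%:~R) 0; rewrite !subr0 (distrC _ b).
  lra.
move: (`|a|%:~R : R) a1 => c c1 cb; rewrite -!exprMn ler_sqr ?nnegrE ?mulr_ge0 //; lra.
Qed.

(** 1/20 for the distance of a projection to an integer, plus 1/10 for the
distance of two projections. The constant is locked to keep conversion from
computing with fractions. *)
Definition rounding_error : rat := locked (3 / 20).

Lemma rounding_error_ge0 : 0 <= rounding_error.
Proof. by rewrite /rounding_error -lock; lra. Qed.

(** * Sets that occupy many coordinates *)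

Section ManyCoordinates.
Variables (d K : nat) (U : 'M[int]_(n, d)) (S : {set 'I_n}) (t : 'I_n).
Hypothesis Kr : 900 <= (K%:R : rat).
Hypothesis KN : (3 * K + 1 < N)%N.
Hypothesis zU : integral_rep U S.
Hypothesis lS : linked S.
Hypothesis cI : (K < #|zsupp U S|)%N.

(** Each coordinate [p] is linked to at least [K] coordinates by a patch of at
most [K] vectors, so that the projection of [t] to any bounded set that contains
the patch has an entry at [p] within 1/20 of an integer. Two such projections
differ by a vector orthogonal to the patch, hence by at most 1/10 at [p]: the
integer does not depend on the projection. *)
Lemma rounding : exists x : 'rV[int]_d,
  (forall p, p \notin zsupp U S -> x 0 p = 0) /\
  forall (P : {set 'I_d}) (Y : {set 'I_n}),
  P \subset zsupp U S -> (#|P| <= 3)%N -> Y \subset S -> (#|Y| <= 1)%N ->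
  exists y : 'rV[rat]_d, [/\ dot y y <= (B t t)%:~R,
    forall s, s \in Y -> dot y (ratv (row s U)) = (B s t)%:~R &
    forall p, p \in P -> `|y 0 p - (x 0 p)%:~R| <= rounding_error].
Proof.
pose patch p (XJ : {set 'I_n} * {set 'I_d}) := [/\ XJ.1 \subset S, p \in XJ.2,
  (#|XJ.1| <= K)%N, (K <= #|XJ.2|)%N & linked_coords U XJ.1 p XJ.2].
have close (X : {set 'I_n}) (J : {set 'I_d}) p (z : 'rV[rat]_d) h C r :
    patch p (X, J) -> (forall s, s \in X -> dot z (ratv (row s U)) = (h s)%:~R) ->
    dot z z <= C -> C <= r ^+ 2 * 900 -> 0 <= r ->
    exists a : int, `|z 0 p - a%:~R| <= r /\ ((forall s, h s = 0) -> a = 0).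
  move=> [_ pJ _ cJ hJ] hz zC Cr r0.
  have [a [ha1 ha2]] := linked_coords_close hJ pJ hz zC; exists a; split; last exact: ha2.
  apply: (sqr_bound ha1 Cr _ r0 _); last by rewrite ltr0n.
  apply: (le_trans Kr); rewrite ler_nat; exact: cJ.
clear Kr.
have /choice[pt ptP] : forall p, exists XJ, p \in zsupp U S -> patch p XJ.
  move=> p; have [pI|_] := boolP (p \in zsupp U S); last by exists (set0, set0).
  have [X [J [[XS JI pJ] cX cJ hJ]]] := reach K zU lS pI.
  exists (X, J) => _; split=> //=; case: cJ => [/ltnW //|->]; exact: ltnW.
have proj (X : {set 'I_n}) : X \subset S -> (#|X| <= 3 * K + 1)%N ->
    exists y : 'rV[rat]_d, (forall s, s \in X -> dot y (ratv (row s U)) = (B s t)%:~R) /\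
    dot y y <= (B t t)%:~R.
  by move=> XS cX; exact: (integral_rep_projection t zU XS (leq_ltn_trans cX KN)).
have t2 : (B t t)%:~R <= 2 :> rat by rewrite -[2]/(2%:~R) ler_int.
have /choice[ya yaP] : forall p, exists ya : 'rV[rat]_d * int, p \in zsupp U S ->
    [/\ dot ya.1 ya.1 <= 2, forall s, s \in (pt p).1 -> dot ya.1 (ratv (row s U)) = (B s t)%:~R
      & `|ya.1 0 p - ya.2%:~R| <= 1 / 20].
  move=> p; have [pI|_] := boolP (p \in zsupp U S); last by exists (0, 0).
  have := ptP p pI; case: (pt p) => X J pP; have [XS pJ cX cJ hJ] := pP.
  have [|y [y1 y2]] := proj X XS; first by apply: (leq_trans cX); lia.
  have [||a [a1 _]] := close X J p y _ 2 (1 / 20) pP y1 (le_trans y2 t2); [lra|lra|].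
  by exists (y, a) => _; split=> //=; exact: le_trans y2 t2.
exists (\row_p (if p \in zsupp U S then (ya p).2 else 0)); split.
  by move=> p /negbTE pI; rewrite mxE pI.
move=> P Y PI cP YS cY; pose X := Y :|: \bigcup_(p in P) (pt p).1.
have [|| y [y1 y2]] := proj X.
- rewrite subUset YS; apply/bigcupsP => p pP.
  by have [] := ptP p (subsetP PI _ pP).
- apply: (leq_trans (leq_card_setU _ _)); rewrite addnC leq_add //.
  apply: (leq_trans (card_bigcup_le _ _)) => /=.
  apply: (@leq_trans (\sum_(p in P) K)%N); last by rewrite sum_nat_const leq_mul2r cP orbT.
  by apply: leq_sum => p pP; have [] := ptP p (subsetP PI _ pP).
exists y; split=> [|s sY|p pP]; [exact: y2|by apply: y1; rewrite in_setU sY|].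
have pI := subsetP PI _ pP; rewrite mxE pI; have [z1 z2 z3] := yaP p pI.
set z := (ya p).1 in z1 z2 z3 *; set a := (ya p).2 in z3 *.
have pPt := ptP p pI; case E : (pt p) => [X' J] in z2 pPt.
have [||||b [b1 b2]] := close X' J p (y - z) (fun=> 0) 8 (1 / 10) pPt; [| |lra|lra|].
- move=> s sX'; rewrite dotDl dotNl z2 ?sX' // y1 ?subrr ?mulr0z //.
  by rewrite in_setU; apply/orP; right; apply/bigcupP; exists p; rewrite // E.
- have := dot_sqr_ge0 (y + z); rewrite !dotDl !dotDr !dotNl !dotNr opprK (dotC z y).
  have := le_trans y2 t2; lra.
move: b1; rewrite (b2 (fun=> erefl)) subr0 !mxE => b1.
have -> : y 0 p - a%:~R = (y 0 p - z 0 p) + (z 0 p - a%:~R) by ring.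
apply: (le_trans (ler_normD _ _)); rewrite /rounding_error -lock; lra.
Qed.

(** The product with [s] involves at most two coordinates, so the rounding of a
single projection to [s] computes it up to an error less than 1. Three nonzero
entries are impossible since [3 * 17 ^ 2 > 2 * 20 ^ 2], and the same inequality
of squares bounds the norm. *)
Lemma rounded_vector : exists x : 'rV[int]_d,
  (forall s, s \in S -> dot x (row s U) = B s t) /\ dot x x <= B t t.
Proof.
have [x [x0 hx]] := rounding; clear Kr; exists x; split=> [s sS|].
  pose P := [set p | U s p != 0].
  have n2 : \sum_(p in P) 1 <= 2 :> int.
    apply: le_trans (integral_rep_norm zU sS); rewrite big_mkcond; apply: ler_sum => j _.
    by rewrite inE; case: ifP => // h; rewrite -?gtz0_ge1 ?exprn_even_gt0 // sqr_ge0.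
  have cP : (#|P| <= 2)%N by move: n2; rewrite sumr_const -[2]/(2%:R) ler_nat.
  have [||||y [y1 y2 y3]] := hx P [set s].
  - by apply/subsetP => p; rewrite inE => Up; apply/zsuppP; exists s.
  - exact: leq_trans cP _.
  - by rewrite sub1set.
  - by rewrite cards1.
  have U1 p : `|U s p| <= 1.
    have := integral_rep_norm zU sS; rewrite (bigD1 p) //= => h.
    have : 0 <= \sum_(i < d | i != p) U s i ^+ 2 by apply: sumr_ge0 => i _; exact: sqr_ge0.
    move: (\sum_(i < d | i != p) _) h => r; nia.
  have : `|((dot x (row s U) - B s t)%:~R : rat)| <= 2 * rounding_error.
    rewrite rmorphB /= -y2 ?set11 // -dot_map -dotNl -dotDl /dot (bigID (mem P)) /=.
    rewrite [X in _ + X]big1 ?addr0; last first.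
      by move=> j; rewrite inE negbK !mxE => /eqP ->; rewrite mulr0.
    apply: (le_trans (ler_norm_sum _ _ _)).
    apply: (@le_trans _ _ (\sum_(p in P) rounding_error)).
      apply: ler_sum => p pP; rewrite normrM -[leRHS]mulr1 ler_pM //.
        by rewrite !mxE distrC y3.
      by rewrite !mxE -intr_norm -[1]/(1%:~R) ler_int.
    by rewrite sumr_const -[leLHS]mulr_natl ler_wpM2r ?rounding_error_ge0 // -[2]/(2%:R) ler_nat.
  rewrite -intr_norm /rounding_error -lock => h.
  have : (`|dot x (row s U) - B s t|%:~R : rat) < 1%:~R by lra.
  rewrite ltr_int; lia.
pose Q := [set p | x 0 p != 0].
have QI : Q \subset zsupp U S.
  by apply/subsetP => p; rewrite inE; apply: contraR => /x0 ->.
have key (P : {set 'I_d}) : P \subset Q -> (#|P| <= 3)%N ->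
    (\sum_(p in P) x 0 p ^+ 2) * 17 ^+ 2 <= B t t * 20 ^+ 2.
  move=> PQ cP; have [||||y [y1 _ y3]] := hx P set0.
  - exact: subset_trans PQ QI.
  - exact: cP.
  - by rewrite sub0set.
  - by rewrite cards0.
  have {}y1 := dot_close P y1.
  rewrite -(ler_int rat) [leLHS]intrM [leRHS]intrM rmorph_sum /=.
  have e17 (k : int) : (k ^+ 2)%:~R = k%:~R ^+ 2 :> rat by rewrite rmorphXn.
  rewrite !(e17 17) !(e17 20).
  suff h : \sum_(p in P) ((x 0 p ^+ 2)%:~R : rat) * 17 ^+ 2 <= \sum_(p in P) y 0 p ^+ 2 * 20 ^+ 2.
    rewrite mulr_suml; apply: (le_trans h); rewrite -mulr_suml ler_wpM2r //.
  apply: ler_sum => p pP; have := y3 p pP.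
  have : x 0 p != 0 by move: (subsetP PQ _ pP); rewrite inE.
  move: (y 0 p) (x 0 p) => b a a0 hab; apply: rounded_sqr a0 _.
  by move: hab; rewrite /rounding_error -lock.
have N0 : 0 <= B t t by apply: diag_ge0; lia.
have [cQ|cQ] := leqP #|Q| 3; last first.
  have [P PQ cP] := subset_of_card (ltnW cQ).
  have := key P PQ (eq_leq cP).
  have : 3 <= \sum_(p in P) x 0 p ^+ 2.
    rewrite -[3]/(3%:R) -cP -sumr_const; apply: ler_sum => p pP.
    have : x 0 p != 0 by move: (subsetP PQ _ pP); rewrite inE.
    by rewrite -gtz0_ge1 exprn_even_gt0.
  by have := dB t; rewrite !expr2; set r := \sum_(p in P) _; lia.
have := key Q (subxx _) cQ.
have -> : \sum_(p in Q) x 0 p ^+ 2 = dot x x.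
  rewrite /dot [RHS](bigID (mem Q)) /= [X in _ = _ + X]big1 ?addr0.
    by apply: eq_bigr => p _; rewrite expr2.
    by move=> p; rewrite inE negbK => /eqP ->; rewrite mulr0.
by have := dB t; rewrite !expr2; move: (dot x x) => r; lia.
Qed.

End ManyCoordinates.

(** As [t] is not orthogonal to [S], its projection has norm at least 1, and at
most 1 is missing to the norm of [t]. *)
Lemma integral_rep_add_nonzero d (U : 'M[int]_(n, d)) (S : {set 'I_n}) t s0 (x : 'rV[int]_d) :
  integral_rep U S -> t \notin S -> s0 \in S -> B s0 t != 0 ->
  (forall s, s \in S -> dot x (row s U) = B s t) -> dot x x <= B t t ->
  exists d' (U' : 'M[int]_(n, d')), integral_rep U' (t |: S).
Proof.
move=> zU tS s0S bt hx xx; apply: (integral_rep_add zU tS hx); rewrite xx /=.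
have x1 : 1 <= dot x x; last by have := dB t; lia.
rewrite -gtz0_ge1 lt_neqAle dot_sqr_ge0 andbT eq_sym.
apply: contra bt => /eqP xx0; rewrite -hx // /dot big1 // => j _.
suff -> : x 0 j = 0 by rewrite mul0r.
apply/eqP; rewrite -sqrf_eq0 expr2; move/psumr_eq0P: xx0 => -> // i _.
by rewrite -expr2 sqr_ge0.
Qed.

(** * Sets that occupy few coordinates *)

Section FewCoordinates.
Variables (d : nat) (U : 'M[int]_(n, d)) (S : {set 'I_n}) (t s0 : 'I_n).
Hypothesis cS : (#|S| < N)%N.
Hypothesis zU : integral_rep U S.
Hypothesis lS : linked S.
Hypothesis tS : t \notin S.
Hypothesis s0S : s0 \in S.
Hypothesis bt : B s0 t != 0.

Variable y : 'rV[rat]_d.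
Hypothesis yS : forall s, s \in S -> dot y (ratv (row s U)) = (B s t)%:~R.
Hypothesis yy : dot y y <= (B t t)%:~R.

Definition in_span (r : 'rV[int]_d) := exists2 c : 'rV[int]_n, supp c \subset S & c *m U = r.

Lemma in_spanD r r' : in_span r -> in_span r' -> in_span (r + r').
Proof.
move=> [c cS' <-] [c' cS'' <-]; exists (c + c'); first exact: suppD_sub.
by rewrite mulmxDl.
Qed.

Lemma in_spanZ a r : in_span r -> in_span (a *: r).
Proof.
move=> [c cS' <-]; exists (a *: c); first exact: suppZ_sub.
by rewrite scalemxAl.
Qed.

Lemma in_spanB r r' : in_span r -> in_span r' -> in_span (r - r').
Proof. by move=> hr hr'; rewrite -scaleN1r; apply/in_spanD/in_spanZ. Qed.

Lemma in_span_row s : s \in S -> in_span (row s U).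
Proof.
move=> sS; exists (delta_mx 0 s); last exact: delta_mulmx.
by rewrite supp_delta sub1set.
Qed.

Lemma in_span_int r : in_span r -> exists a : int, dot y (ratv r) = a%:~R.
Proof. by move=> [c cS' <-]; eexists; exact: dot_ratv_mulmx cS' yS. Qed.

Lemma bform_span c c' : supp c \subset S -> supp c' \subset S ->
  bform B c c' = dot (c *m U) (c' *m U).
Proof.
have suppP (e : 'rV[int]_n) i : supp e \subset S -> e 0 i != 0 -> i \in S.
  by move=> eS ei; apply: (subsetP eS); rewrite inE.
move=> cS' cS''; rewrite bformE dot_mulmx; apply: eq_bigr => j _.
have [->|cj] := eqVneq (c' 0 j) 0; first by rewrite !mul0r.
congr (_ * _); rewrite dotC dot_mulmx; apply: eq_bigr => i _.
have [->|ci] := eqVneq (c 0 i) 0; first by rewrite !mul0r.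
by rewrite (zU (suppP _ _ cS' ci) (suppP _ _ cS'' cj)) (dotC (row j U)).
Qed.

(** A copy of the basis of [E6] in which the vector of index [i0] is [- t] and the
others are combinations of [S]. *)
Lemma e6_config_build i0 (r : nat -> 'rV[int]_d) : (i0 < 6)%N -> B t t = 2 ->
  (forall i, (i < 6)%N -> i != i0 -> in_span (r i)) ->
  (forall i j, (i < 6)%N -> (j < 6)%N -> i != i0 -> j != i0 ->
     dot (r i) (r j) = e8_gram i j) ->
  (forall i, (i < 6)%N -> i != i0 -> dot y (ratv (r i)) = - (e8_gram i0 i)%:~R) ->
  exists W, e8_config B 6 (t |: S) W.
Proof.
move=> i06 t2 hr hd hy.
have /choice[w hw] : forall i, exists c : 'rV[int]_n, (i < 6)%N -> i != i0 ->
    supp c \subset S /\ c *m U = r i.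
  move=> i; have [i6|i6] := boolP (i < 6)%N; last by exists 0.
  have [ii|ii] := boolP (i != i0); last by exists 0.
  by have [c c1 c2] := hr i i6 ii; exists c.
have gsym i : (i < 6)%N -> e8_gram i0 i = e8_gram i i0.
  by move: i0 i06 {hr hd hy hw} i; do 6?[case=> //]; move=> _; do 6?[case=> //].
have g2 : e8_gram i0 i0 = 2 by move: i0 i06 {hr hd hy hw gsym}; do 6?[case=> //].
have wt i : (i < 6)%N -> i != i0 -> bform B (w i) (delta_mx 0 t) = - e8_gram i0 i.
  move=> i6 ii; have [wS wU] := hw i i6 ii; apply/eqP; rewrite -(eqr_int rat) rmorphN /= -hy // -wU.
  by rewrite (dot_ratv_mulmx wS yS) bform_deltarE.
exists (fun i => if i == i0 then - delta_mx 0 t else w i); split.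
  move=> i i6; case: eqP => [_|/eqP ii].
    by rewrite -scaleN1r; apply: suppZ_sub; rewrite supp_delta sub1set setU11.
  by apply: subset_trans (subsetUr _ _); case: (hw i i6 ii).
move=> i j i6 j6; case: eqP => [->|/eqP ii]; case: eqP => [->|/eqP jj].
- by rewrite bformNl bformNr opprK bform_delta t2 g2.
- by rewrite bformNl (bformC sB) wt // opprK.
- by rewrite bformNr wt // opprK gsym.
- by have [c1 c2] := hw i i6 ii; have [c3 c4] := hw j j6 jj; rewrite bform_span // c2 c4 hd.
Qed.

Lemma orthonormal_deltas (f : nat -> 'I_d) (e : nat -> int) k :
  {in gtn k &, injective f} -> (forall i, (i < k)%N -> e i ^+ 2 = 1) ->
  forall i j, (i < k)%N -> (j < k)%N ->
  dot (e i *: delta_mx 0 (f i)) (e j *: delta_mx 0 (f j)) = (i == j)%:R.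
Proof.
move=> fi he i j ik jk; rewrite dotZl dotZr dot_delta mxE eqxx /=.
case: (eqVneq i j) => [->|ij]; first by rewrite eqxx mulr1 -expr2 he.
case: eqP => [fij|]; last by rewrite !mulr0.
by rewrite (fi j i) ?eqxx // in ij.
Qed.

Lemma in_span_sum (I : finType) (P : pred I) (F : I -> 'rV[int]_d) :
  (forall i, P i -> in_span (F i)) -> in_span (\sum_(i | P i) F i).
Proof.
move=> hF; apply: (big_ind in_span) => [|u v|i Pi]; [|exact: in_spanD|exact: hF].
exists 0; last exact: mul0mx.
by apply/subsetP => i; rewrite inE mxE eqxx.
Qed.

Local Notation I := (zsupp U S).

Lemma dot_zsupp (x z : 'rV[rat]_d) s : s \in S -> (forall q, q \in I -> x 0 q = z 0 q) ->
  dot x (ratv (row s U)) = dot z (ratv (row s U)).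
Proof.
move=> sS xz; apply: eq_bigr => q _; rewrite !mxE.
have [->|Us] := eqVneq (U s q) 0; first by rewrite !mulr0.
by rewrite xz //; apply/zsuppP; exists s.
Qed.

Lemma integral_rep_add_integral (x : 'rV[int]_d) :
  (forall q, q \in I -> y 0 q = (x 0 q)%:~R) -> (forall q, q \notin I -> x 0 q = 0) ->
  exists d' (U' : 'M[int]_(n, d')), integral_rep U' (t |: S).
Proof.
move=> yx x0; apply: (integral_rep_add_nonzero zU tS s0S bt (x := x)) => [s sS|].
  apply/eqP; rewrite -(eqr_int rat) -yS // -dot_map; apply/eqP/dot_zsupp => // q qI.
  by rewrite mxE yx.
rewrite -(ler_int rat) -dot_map; apply: le_trans yy; apply: ler_sum => q _; rewrite mxE.
have [/yx ->//|/x0 ->] := boolP (q \in I).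
by rewrite mul0r -expr2 sqr_ge0.
Qed.

(** All coordinates of [S] are linked to one of them, so the entries of the
projection [y] differ, up to sign, by the integers [a q]. *)
Lemma span_links : exists (p : 'I_d) (tau a : 'I_d -> int), p \in I /\
  forall q, q \in I -> [/\ tau q ^+ 2 = 1, in_span (delta_mx 0 p - tau q *: delta_mx 0 q)
    & y 0 p - (tau q)%:~R * y 0 q = (a q)%:~R].
Proof.
have [p pI] : exists p, p \in I.
  apply: contrapT => nI; move/eqP: bt; apply; apply/eqP; rewrite -(eqr_int rat) -yS //.
  rewrite /dot big1 // => q _; rewrite !mxE.
  have [->|Us] := eqVneq (U s0 q) 0; first by rewrite mulr0.
  by case: nI; exists q; apply/zsuppP; exists s0.
have [X [J [[XS JI pJ] cX cJ hJ]]] := reach #|I| zU lS pI.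
have JE : J = I.
  by case: cJ => // cJ; have := subset_leq_card JI; rewrite leqNgt cJ.
have /choice[ta hta] : forall q, exists ta : int * int, q \in I ->
    [/\ ta.1 ^+ 2 = 1, in_span (delta_mx 0 p - ta.1 *: delta_mx 0 q)
    & y 0 p - ta.1%:~R * y 0 q = ta.2%:~R].
  move=> q; have [qI|qI] := boolP (q \in I); last by exists (0, 0).
  have [|tau [c [t2 cX' cU]]] := hJ q; first by rewrite JE.
  have sp : in_span (delta_mx 0 p - tau *: delta_mx 0 q).
    by exists c => //; exact: subset_trans cX' XS.
  have [a ha] := in_span_int sp; exists (tau, a) => _; split=> //.
  by rewrite -ha map_mxB map_mxZ dotDr dotNr dotZr !dot_ratv_delta.
by exists p, (fun q => (ta q).1), (fun q => (ta q).2); split.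
Qed.

Lemma integral_rep_row_bound s : s \in S -> \sum_q `|U s q| <= 2.
Proof.
move=> sS; apply: le_trans (integral_rep_norm zU sS); apply: ler_sum => q _.
by move: (U s q) => u; nia.
Qed.

Section NotIntegral.
Variables (p : 'I_d) (tau a : 'I_d -> int).
Hypothesis pI : p \in I.
Hypothesis htau : forall q, q \in I ->
  [/\ tau q ^+ 2 = 1, in_span (delta_mx 0 p - tau q *: delta_mx 0 q)
    & y 0 p - (tau q)%:~R * y 0 q = (a q)%:~R].
Hypothesis nint : forall z : int, y 0 p != z%:~R.

Definition imbalance s := \sum_(q in I) tau q * U s q.

(** Modulo the vectors [e_p - tau_q e_q] of the span, the row of [s] is congruent
to a multiple of [e_p]. *)
Lemma imbalance_span s : s \in S -> in_span (imbalance s *: delta_mx 0 p).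
Proof.
move=> sS.
have -> : imbalance s *: delta_mx 0 p = row s U +
    \sum_(q in I) (tau q * U s q) *: (delta_mx 0 p - tau q *: delta_mx 0 q).
  under eq_bigr do rewrite scalerBr.
  rewrite sumrB -scaler_suml -/(imbalance s) addrCA -[LHS]addr0; congr (_ + _).
  apply/esym/eqP; rewrite subr_eq0; apply/eqP.
  rewrite {1}[row s U]row_sum_delta (bigID (mem I)) /= [X in _ + X]big1 ?addr0.
    apply: eq_bigr => q qI; rewrite scalerA mxE; congr (_ *: _).
    by have [t2 _ _] := htau qI; rewrite mulrAC -expr2 t2 mul1r.
  move=> q qI; rewrite mxE; have [->|Us] := eqVneq (U s q) 0; first by rewrite scale0r.
  by case/negP: qI; apply/zsuppP; exists s.
apply: in_spanD; first exact: in_span_row.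
by apply: in_span_sum => q qI; apply: in_spanZ; case: (htau qI).
Qed.

(** The vector [e_p] is not in the span, because its product with [y] is not an
integer. *)
Lemma imbalance_values s : s \in S -> imbalance s = 0 \/ imbalance s ^+ 2 = 4.
Proof.
move=> sS; have i2 : `|imbalance s| <= 2.
  apply: le_trans (integral_rep_row_bound sS); rewrite [leRHS](bigID (mem I)) /= -[leLHS]addr0.
  apply: lerD; last by apply: sumr_ge0.
  apply: (le_trans (ler_norm_sum _ _ _)); apply: ler_sum => q qI; rewrite normrM.
  have [t2 _ _] := htau qI; have /eqP := t2.
  by rewrite sqrf_eq1 => /orP[]/eqP ->; rewrite ?normrN normr1 mul1r.
have n1 (e : int) : e ^+ 2 = 1 -> imbalance s != e.
  move=> e2; apply/eqP => ie; have := imbalance_span sS; rewrite ie => /in_span_int[b].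
  rewrite map_mxZ dotZr dot_ratv_delta => hb; have := nint (e * b).
  by rewrite rmorphM /= -hb mulrA -expr2 -rmorphXn /= e2 mul1r eqxx.
have := n1 1 (erefl _); have := n1 (-1) (erefl _); move: (imbalance s) i2 => i.
move=> h1 h2 h3; have [->|[->|->]] : i = 0 \/ i = 2 \/ i = -2 by lia.
- by left.
- by right.
- by right.
Qed.

Lemma imbalance_parity s : s \in S -> exists k, imbalance s = B s s + 2 * k.
Proof.
move=> sS.
have -> : B s s = \sum_(q in I) row s U 0 q * row s U 0 q.
  rewrite zU // /dot (bigID (mem I)) /= [X in _ + X]big1 ?addr0 // => q qI.
  rewrite mxE; have [->|Us] := eqVneq (U s q) 0; first by rewrite mul0r.
  by case/negP: qI; apply/zsuppP; exists s.
suff [k hk] : exists k, \sum_(q in I) (tau q * U s q - row s U 0 q * row s U 0 q) = 2 * k.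
  by exists k; rewrite -hk sumrB addrC subrK.
apply: (big_ind (fun x => exists k, x = 2 * k)) => [|x z [k ->] [l ->]|q qI].
- by exists 0; rewrite mulr0.
- by exists (k + l); rewrite mulrDr.
rewrite mxE; move: (U s q) => u; have [t2 _ _] := htau qI.
have [c uc] : exists c, u = 2 * c \/ u = 2 * c + 1 by exists (divz u 2); lia.
have /eqP := t2; rewrite sqrf_eq1 => /orP[]/eqP ->; case: uc => ->.
- by exists (c - 2 * c ^+ 2); ring.
- by exists (- c - 2 * c ^+ 2); ring.
- by exists (- c - 2 * c ^+ 2); ring.
- by exists (- 3 * c - 2 * c ^+ 2 - 1); ring.
Qed.

(** A vector of norm 1 in [S] would have an odd imbalance, which is excluded. *)
Lemma norm_two : B t t = 2 \/ (exists2 e, e \in S & B e e = 1) -> B t t = 2.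
Proof.
case=> // -[e eS e1]; have [k] := imbalance_parity eS; rewrite e1 => ik.
case: (imbalance_values eS); rewrite ik; first by lia.
by rewrite expr2; nia.
Qed.

Lemma y_value q : q \in I -> (tau q)%:~R * y 0 q = y 0 p - (a q)%:~R.
Proof. by move=> qI; have [_ _ <-] := htau qI; rewrite opprB addrC subrK. Qed.

Lemma y_value_sqr q : q \in I -> y 0 q ^+ 2 = (y 0 p - (a q)%:~R) ^+ 2.
Proof.
move=> qI; have [t2 _ _] := htau qI; rewrite -y_value // exprMn.
by rewrite -rmorphXn /= t2 mul1r.
Qed.

(** The entries of [y] are, up to sign, the numbers [y 0 p - a q], and two of them
have squares of sum at most 2: numbers at distance at least 2 would have to be 1
and -1, which are integers. *)
Lemma two_levels q q' : q \in I -> q' \in I -> `|a q - a q'| <= 1.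
Proof.
move=> qI q'I; have [->|qq] := eqVneq q q'; first by rewrite subrr normr0.
have h : y 0 q ^+ 2 + y 0 q' ^+ 2 <= 2.
  have : (B t t)%:~R <= 2 :> rat by rewrite -[2]/(2%:~R) ler_int.
  move=> /(le_trans yy)/(dot_close [set q; q']).
  by rewrite big_setU1 ?big_set1 // inE.
rewrite !y_value_sqr // in h.
rewrite leNgt; apply/negP => aq.
have {aq} aq : (2 <= a q - a q') \/ (a q - a q' <= -2) by lia.
pose u := y 0 p - (a q)%:~R; pose v := y 0 p - (a q')%:~R.
have uv : v - u = (a q - a q')%:~R by rewrite /u /v rmorphB /=; ring.
have uv4 : 4 <= (v - u) ^+ 2.
  rewrite uv -rmorphXn /= -[4]/(4%:~R) ler_int; case: aq; nia.
have e0 : (u + v) ^+ 2 = 0.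
  apply/eqP; rewrite eq_le sqr_ge0 andbT; rewrite -/u -/v in h; nra.
have e4 : (v - u) ^+ 2 = 4.
  apply/eqP; rewrite eq_le uv4 andbT; rewrite -/u -/v in h; nra.
move/eqP: e0; rewrite sqrf_eq0 addrC addr_eq0 => /eqP vE.
have u1 : u ^+ 2 = 1 by move: e4; rewrite vE; nra.
move/eqP: u1; rewrite sqrf_eq1 => /orP[]/eqP u1.
- have := nint (a q + 1); rewrite rmorphD /=; apply/negP; rewrite negbK; apply/eqP; move: u1; rewrite /u; lra.
- have := nint (a q - 1); rewrite rmorphB /=; apply/negP; rewrite negbK; apply/eqP; move: u1; rewrite /u; lra.
Qed.

(** [S] is orthogonal to the sum of the [tau_q e_q], so a multiple of it may be
added to [y]. *)
Lemma balanced_product k s : s \in S -> imbalance s = 0 ->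
  B s t = \sum_(q in I) (k - a q) * (tau q * U s q).
Proof.
move=> sS; rewrite /imbalance => bal.
have -> : \sum_(q in I) (k - a q) * (tau q * U s q) = - \sum_(q in I) a q * (tau q * U s q).
  under eq_bigr do rewrite mulrBl.
  by rewrite sumrB -mulr_sumr bal mulr0 sub0r.
apply/eqP; rewrite -(eqr_int rat) -yS //; apply/eqP.
have /(congr1 (fun z : int => z%:~R : rat)) := bal; rewrite rmorph0 rmorph_sum /= => b0.
transitivity (\sum_(q in I) (y 0 p - (a q)%:~R) * (tau q * U s q)%:~R).
  rewrite /dot (bigID (mem I)) /= [X in _ + X]big1 ?addr0.
    apply: eq_bigr => q qI; rewrite -y_value // !mxE rmorphM /= mulrACA -rmorphM /=.
    by have [e2 _ _] := htau qI; rewrite -expr2 e2 mul1r.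
  move=> q qI; rewrite !mxE; have [->|Us] := eqVneq (U s q) 0; first by rewrite mulr0.
  by case/negP: qI; apply/zsuppP; exists s.
rewrite (eq_bigr (fun q => y 0 p * (tau q * U s q)%:~R - (a q)%:~R * (tau q * U s q)%:~R)); last first.
  by move=> q _; rewrite mulrBl.
rewrite sumrB -mulr_sumr b0 mulr0 sub0r rmorphN rmorph_sum /=; congr (- _).
by apply: eq_bigr => q _; rewrite [RHS]intrM.
Qed.

Lemma dot_indicator (P : {set 'I_d}) (e : 'I_d -> int) (x : 'rV[int]_d) :
  dot (\row_q (if q \in P then e q else 0)) x = \sum_(q in P) e q * x 0 q.
Proof.
rewrite /dot (bigID (mem P)) /= [X in _ + X]big1 ?addr0.
  by apply: eq_bigr => q qP; rewrite mxE qP.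
by move=> q /negbTE qP; rewrite mxE qP mul0r.
Qed.

Lemma dot_indicator_norm (P : {set 'I_d}) (e : 'I_d -> int) :
  (forall q, q \in P -> e q ^+ 2 = 1) ->
  let x := \row_q (if q \in P then e q else 0) in dot x x = #|P|%:R.
Proof.
move=> he /=; rewrite dot_indicator -sumr_const; apply: eq_bigr => q qP.
by rewrite mxE qP -expr2 he.
Qed.

(** Shifting [y] by a multiple of the sum of the [tau_q e_q] makes it an integer
vector supported on either of the two level sets of [a]. If one of them has at
most two elements, this vector represents [t]. Otherwise three coordinates from
each give a root system [A5] in the span of [S], whose third fundamental weight
is realized by [t]: together they generate [E6]. *)
Lemma balanced_step : B t t = 2 -> (forall s, s \in S -> imbalance s = 0) ->
  (exists d' (U' : 'M[int]_(n, d')), integral_rep U' (t |: S)) \/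
  exists W, e8_config B 6 (t |: S) W.
Proof.
move=> t2 bal.
have [q1 q1I hq1] : exists2 q, q \in I & forall q', q' \in I -> a q <= a q'.
  have [q qI hq] := @Order.TotalTheory.arg_minP _ _ _ p (mem I) a pI.
  by exists q.
have aI q : q \in I -> a q = a q1 \/ a q = a q1 + 1.
  by move=> qI; have := hq1 q qI; have := two_levels qI q1I; lia.
pose J := [set q in I | a q == a q1]; pose J' := [set q in I | a q != a q1].
have tJ q : q \in J -> tau q ^+ 2 = 1 by rewrite inE => /andP[qI _]; case: (htau qI).
have tJ' q : q \in J' -> (- tau q) ^+ 2 = 1.
  by rewrite inE sqrrN => /andP[qI _]; case: (htau qI).
have [cJ|cJ] := leqP #|J| 2.
  left; apply: (integral_rep_add_nonzero zU tS s0S bt (x := \row_q (if q \in J then tau q else 0))).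
    move=> s sS; rewrite dot_indicator (balanced_product (a q1 + 1) sS (bal s sS)).
    rewrite [RHS](bigID (fun q => a q == a q1)) /= [X in _ = _ + X]big1 ?addr0.
      apply: eq_big => [q|q qJ]; first by rewrite inE.
      by move: qJ; rewrite inE mxE => /andP[_ /eqP ->]; rewrite addrAC subrr add0r mul1r.
    by move=> q /andP[/aI[->|->]]; rewrite ?eqxx // subrr mul0r.
  by rewrite dot_indicator_norm // t2 -[2]/(2%:R) ler_nat.
have [cJ'|cJ'] := leqP #|J'| 2.
  left; apply: (integral_rep_add_nonzero zU tS s0S bt (x := \row_q (if q \in J' then - tau q else 0))).
    move=> s sS; rewrite dot_indicator (balanced_product (a q1) sS (bal s sS)).
    rewrite [RHS](bigID (fun q => a q != a q1)) /= [X in _ = _ + X]big1 ?addr0.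
      apply: eq_big => [q|q qJ]; first by rewrite inE.
      move: qJ; rewrite inE mxE => /andP[/aI[->|->]]; rewrite ?eqxx //.
      by rewrite opprD addNKr mulN1r mulNr.
    by move=> q /andP[_]; rewrite negbK => /eqP ->; rewrite subrr mul0r.
  by rewrite dot_indicator_norm // t2 -[2]/(2%:R) ler_nat.
right; have /card_gt2P[f0 [f1 [f2 [[f0J f1J f2J] [f01 f12 f20]]]]] := cJ.
have /card_gt2P[f3 [f4 [f5 [[f3J f4J f5J] [f34 f45 f53]]]]] := cJ'.
pose f i := nth p [:: f0; f1; f2; f3; f4; f5] i.
have dJ q q' : q \in J -> q' \in J' -> q != q'.
  by rewrite !inE => /andP[_ aq] /andP[_]; apply: contraNneq => <-.
have fu : uniq [:: f0; f1; f2; f3; f4; f5].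
  rewrite /= !inE !negb_or f01 f12 f34 f45 (eq_sym f0 f2) f20 (eq_sym f3 f5) f53.
  by rewrite !dJ.
have fI i : (i < 6)%N -> f i \in I.
  have sJ q : q \in J -> q \in I by rewrite inE => /andP[].
  have sJ' q : q \in J' -> q \in I by rewrite inE => /andP[].
  by move: i; do 6?[case=> [_|]; first by [exact: sJ|exact: sJ']].
pose E i : 'rV[int]_d := tau (f i) *: delta_mx 0 (f i).
have EE i j : (i < 6)%N -> (j < 6)%N -> dot (E i) (E j) = (i == j)%:R.
  move: i j; apply: (@orthonormal_deltas f (fun i => tau (f i)) 6) => [i' j' i6 j6 ff|i' i6].
    by apply/eqP; rewrite -(nth_uniq p _ _ fu) //; apply/eqP.
  by have [] := htau (fI i' i6).
have yE i : (i < 6)%N -> dot y (ratv (E i)) = y 0 p - (a (f i))%:~R.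
  by move=> i6; rewrite map_mxZ dotZr dot_ratv_delta y_value // fI.
have sE i j : (i < 6)%N -> (j < 6)%N -> in_span (E i - E j).
  move=> i6 j6; have [_ si _] := htau (fI i i6); have [_ sj _] := htau (fI j j6).
  by have := in_spanB sj si; rewrite opprB addrC addrA subrK.
clearbody E.
(* The chain of roots of [A5]; index 0 is left to [- t], adjacent to the third. *)
pose r i := nth 0 [:: 0; E 0%N - E 1%N; E 1%N - E 2%N; E 2%N - E 3%N; E 3%N - E 4%N; E 4%N - E 5%N] i.
have rE : (r 1%N = E 0%N - E 1%N) * (r 2%N = E 1%N - E 2%N) * (r 3%N = E 2%N - E 3%N) *
  (r 4%N = E 3%N - E 4%N) * (r 5%N = E 4%N - E 5%N) by [].
clearbody r.
have aJ q : q \in J -> a q = a q1 by rewrite inE => /andP[_ /eqP].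
have aJ' q : q \in J' -> a q = a q1 + 1.
  by rewrite inE => /andP[/aI[->|->]] //; rewrite eqxx.
apply: (@e6_config_build 0%N r) => //.
- do 6?[case=> //] => _ _; rewrite rE; exact: sE.
- do 6?[case=> //]; do 6?[case=> //] => _ _ _ _.
  all: try by rewrite !rE !dotDl !dotDr !dotNl !dotNr !EE.
- do 6?[case=> //] => _ _; rewrite rE map_mxB dotDr dotNr !yE // /f /=.
  all: try by rewrite ?(aJ _ f0J) ?(aJ _ f1J) ?(aJ _ f2J) ?(aJ' _ f3J) ?(aJ' _ f4J) ?(aJ' _ f5J) ?rmorphD /e8_gram /=; ring.
Qed.

Lemma unbalanced_span s : s \in S -> imbalance s != 0 ->
  forall q, q \in I -> in_span (2 *: delta_mx 0 q).
Proof.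
move=> sS is0 q qI.
have hp : in_span (2 *: delta_mx 0 p).
  have := imbalance_span sS; have [i0|] := imbalance_values sS; first by rewrite i0 eqxx in is0.
  move=> i4 /(in_spanZ (divz (imbalance s) 2)); rewrite scalerA.
  have -> : divz (imbalance s) 2 * imbalance s = 2; last by [].
  move: i4; move: (imbalance s) => i; rewrite expr2 => i4.
  by have [->|->] : i = 2 \/ i = -2 by nia.
have [t2 sq _] := htau qI.
have := in_spanZ (tau q) (in_spanB hp (in_spanZ 2 sq)).
congr in_span; apply/rowP => j; rewrite !mxE.
set a1 := (_ && _)%:R; set a2 := (_ && _)%:R.
transitivity (tau q ^+ 2 * (2 * a2)); last by rewrite t2 mul1r.
ring.
Qed.

(** If some imbalance is not zero, then the span contains the whole root system of
type [D] on the coordinates of [S]. *)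
Lemma unbalanced_signs s : s \in S -> imbalance s != 0 ->
  forall q q' (e e' : int), q \in I -> q' \in I -> e ^+ 2 = 1 -> e' ^+ 2 = 1 ->
  in_span (e *: delta_mx 0 q + e' *: delta_mx 0 q').
Proof.
move=> sS is0 q q' e e' qI q'I e2 e'2.
have [t2 sq _] := htau qI; have [t2' sq' _] := htau q'I.
have h := in_spanZ (- (tau q * e)) (in_spanB sq sq').
have {h} h : in_span (e *: delta_mx 0 q - (e * tau q * tau q') *: delta_mx 0 q').
  move: h; congr in_span; apply/rowP => j; rewrite !mxE.
  set a1 := (_ && _)%:R; set a2 := (_ && _)%:R; set a3 := (_ && _)%:R.
  transitivity (tau q ^+ 2 * e * a2 - tau q * e * tau q' * a3); first by ring.
  by rewrite t2 mul1r; ring.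
have f2 : (e * tau q * tau q') ^+ 2 = 1 by rewrite !exprMn e2 t2 t2'.
have [fe|fe] : e' = - (e * tau q * tau q') \/ e' = e * tau q * tau q'.
- move: f2 e'2 => /eqP; rewrite sqrf_eq1 => /orP[]/eqP -> /eqP; rewrite sqrf_eq1 => /orP[]/eqP ->;
  by [left|right].
- by rewrite fe scaleNr.
- have := in_spanD h (in_spanZ e' (unbalanced_span sS is0 q'I)); congr in_span.
  by rewrite -fe -addrA; congr (_ + _); rewrite scalerA mulrC -scalerA scaler_nat mulr2n addKr.
Qed.

(** [2 e_q] is in the span, [y] has norm at most 2, and its entries are not
integers. *)
Lemma half_integral s : s \in S -> imbalance s != 0 ->
  forall q, q \in I -> exists2 e : int, e ^+ 2 = 1 & y 0 q = e%:~R / 2.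
Proof.
move=> sS is0 q qI; have [e] := in_span_int (unbalanced_span sS is0 qI).
rewrite map_mxZ dotZr dot_ratv_delta => ye.
have yE : y 0 q = e%:~R / 2 by rewrite -ye mulrC mulKf.
exists e => //; have := dot_close [set q] yy; rewrite big_set1 yE => h.
have e8 : e ^+ 2 <= 8.
  rewrite -(ler_int rat) rmorphXn /=; have : (B t t)%:~R <= 2 :> rat by rewrite -[2]/(2%:~R) ler_int.
  have -> : (8%:~R : rat) = 8 by [].
  move: h; rewrite expr_div_n; lra.
have odd k : e <> 2 * k.
  move=> ek; have [_ _] := htau qI; rewrite yE ek => /eqP; rewrite subr_eq => /eqP yp.
  have := nint (a q + tau q * k); rewrite yp rmorphD !rmorphM /= => /eqP; apply.
  by congr (_ + _ * _); rewrite mulrC mulKf.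
have := odd 0; have := odd 1; have := odd (-1); move: e8; rewrite expr2 => *.
have [->|->] // : e = 1 \/ e = -1 by nia.
Qed.

(** Five coordinates give a root system [D5] in the span of [S], on which [t] acts
as a spinor weight: together they generate [E6]. *)
Lemma unbalanced_large s : s \in S -> imbalance s != 0 -> B t t = 2 -> (4 < #|I|)%N ->
  exists W, e8_config B 6 (t |: S) W.
Proof.
move=> sS is0 t2 cI.
have /choice[e he] : forall q, exists e : int, q \in I -> e ^+ 2 = 1 /\ y 0 q = e%:~R / 2.
  move=> q; have [qI|_] := boolP (q \in I); last by exists 0.
  by have [e e2 ye] := half_integral sS is0 qI; exists e.
pose f i := nth p (enum I) i.
have fI i : (i < 5)%N -> f i \in I.
  by move=> i5; rewrite -mem_enum mem_nth // -cardE (leq_trans i5).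
pose E i : 'rV[int]_d := e (f i) *: delta_mx 0 (f i).
have EE i j : (i < 5)%N -> (j < 5)%N -> dot (E i) (E j) = (i == j)%:R.
  move: i j; apply: (@orthonormal_deltas f (fun i => e (f i)) 5) => [i' j' i6 j6 ff|i' i6].
    apply/eqP; rewrite -(nth_uniq p _ _ (enum_uniq (mem I))) ?inE -?cardE ?(leq_trans i6) ?(leq_trans j6) //.
    exact/eqP.
  by have [] := he _ (fI i' i6).
have yE i : (i < 5)%N -> dot y (ratv (E i)) = 1 / 2.
  move=> i6; rewrite map_mxZ dotZr dot_ratv_delta; have [e2 ->] := he _ (fI i i6).
  by rewrite mulrA -rmorphM /= -expr2 e2.
have sD i j : (i < 5)%N -> (j < 5)%N -> in_span (E i + E j).
  move=> i5 j5; have [e2 _] := he _ (fI i i5); have [e2' _] := he _ (fI j j5).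
  exact: unbalanced_signs sS is0 _ _ _ _ (fI i i5) (fI j j5) e2 e2'.
have sB' i j : (i < 5)%N -> (j < 5)%N -> in_span (E i - E j).
  move=> i5 j5; have [e2 _] := he _ (fI i i5); have [e2' _] := he _ (fI j j5).
  rewrite -scaleNr; apply: unbalanced_signs sS is0 _ _ _ _ (fI i i5) (fI j j5) e2 _.
  by rewrite sqrrN.
clearbody E.
(* The simple roots of [D5]; index 5 is left to [- t]. *)
pose r i := nth 0 [:: E 3%N - E 4%N; E 0%N - E 1%N; E 1%N - E 2%N; E 2%N - E 3%N; E 3%N + E 4%N] i.
have rE : (r 0%N = E 3%N - E 4%N) * (r 1%N = E 0%N - E 1%N) * (r 2%N = E 1%N - E 2%N) *
  (r 3%N = E 2%N - E 3%N) * (r 4%N = E 3%N + E 4%N) by [].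
clearbody r.
apply: (@e6_config_build 5%N r) => //.
- by do 6?[case=> //] => _ _; rewrite rE; [exact: sB'|exact: sB'|exact: sB'|exact: sB'|exact: sD].
- do 6?[case=> //]; do 6?[case=> //] => _ _ _ _.
  all: try by rewrite !rE !dotDl !dotDr ?dotNl ?dotNr ?dotNl !EE.
- do 6?[case=> //] => _ _; rewrite rE ?map_mxB ?map_mxD dotDr ?dotNr !yE // /e8_gram /=; lra.
Qed.

(** After sign changes [y] is the vector [(1/2, ..., 1/2)] on at most four
coordinates; the vectors of [S] are padded with zeros to four. The reflection in
the unit vector [r = (1/2, 1/2, 1/2, -1/2)] maps it to [(0, 0, 0, 1)], and keeps
the vectors of [S] integral because the product of [s] and [r] is [B s t] minus
the last entry of [s]. *)
Lemma unbalanced_small s1 : s1 \in S -> imbalance s1 != 0 -> B t t = 2 -> (#|I| <= 4)%N ->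
  exists d' (U' : 'M[int]_(n, d')), integral_rep U' (t |: S).
Proof.
move=> s1S is0 t2 cI.
have /choice[e he] : forall q, exists e : int, q \in I -> e ^+ 2 = 1 /\ y 0 q = e%:~R / 2.
  move=> q; have [qI|_] := boolP (q \in I); last by exists 0.
  by have [e e2 ye] := half_integral s1S is0 qI; exists e.
pose f i := nth p (enum I) i.
have fI i : (i < #|I|)%N -> f i \in I by move=> i5; rewrite -mem_enum mem_nth // -cardE.
have sumI (F : 'I_d -> int) :
    \sum_(q in I) F q = \sum_(i < 4) (if (i < #|I|)%N then F (f i) else 0).
  rewrite -[LHS]big_enum /= (big_nth p) -cardE big_mkord.
  by rewrite (big_ord_widen _ (fun i => F (nth p (enum I) i)) cI) big_mkcond.
pose w s i : int := if (i < #|I|)%N then e (f i) * U s (f i) else 0.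
have U0 s q : s \in S -> q \notin I -> U s q = 0.
  by move=> sS qI; apply/eqP; apply: contraNT qI => Us; apply/zsuppP; exists s.
have wsum s : s \in S -> w s 0%N + (w s 1%N + (w s 2%N + w s 3%N)) = 2 * B s t.
  move=> sS; transitivity (\sum_(q in I) e q * U s q).
    by rewrite sumI !big_ord_recl big_ord0 addr0.
  apply/eqP; rewrite -(eqr_int rat) rmorphM /= -yS // rmorph_sum /=; apply/eqP.
  rewrite /dot [RHS](_ : _ = 2 * \sum_(q in I) y 0 q * (U s q)%:~R); last first.
    congr (_ * _); rewrite (bigID (mem I)) /= [X in _ + X]big1 ?addr0.
      by apply: eq_bigr => q _; rewrite !mxE.
    by move=> q qI; rewrite !mxE U0 ?mulr0.
  rewrite mulr_sumr; apply: eq_bigr => q qI; have [_ ->] := he q qI.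
  by rewrite rmorphM /= mulrA [2 * _]mulrC mulfVK.
have wdot s s' : s \in S -> s' \in S ->
    w s 0%N * w s' 0%N + (w s 1%N * w s' 1%N + (w s 2%N * w s' 2%N + w s 3%N * w s' 3%N)) = B s s'.
  move=> sS s'S; rewrite zU // /dot (bigID (mem I)) /= [X in _ = _ + X]big1 ?addr0; last first.
    by move=> q qI; rewrite !mxE U0 ?mul0r.
  transitivity (\sum_(q in I) (e q * U s q) * (e q * U s' q)).
    rewrite sumI !big_ord_recl big_ord0 addr0 /w.
    by do 3?[congr (_ + _)]; case: ifP; rewrite ?mulr0.
  apply: eq_bigr => q qI; rewrite !mxE; have [e2 _] := he q qI.
  by rewrite mulrACA -expr2 e2 mul1r.
(* [k s] is the product of [s] and [r]. *)
clearbody w; pose k s := B s t - w s 3%N.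
pose U' : 'M[int]_(n, 5) := \matrix_(i, j)
  nth 0 (if i == t then [:: 0; 0; 0; 1; 1]
         else [:: w i 0%N - k i; w i 1%N - k i; w i 2%N - k i; w i 3%N + k i; 0]) j.
exists 5%N, U' => s s'; rewrite /dot !big_ord_recl big_ord0 !mxE !in_setU1.
have nt x : x \in S -> (x == t) = false by move=> xS; apply: contraNF tS => /eqP <-.
move=> /orP[/eqP ->|sS] /orP[/eqP ->|s'S]; rewrite ?eqxx ?nt //=.
- by rewrite B_sym /k; ring.
- by rewrite /k; ring.
rewrite -wdot //; have := wsum s sS; have := wsum s' s'S; rewrite /k.
move: (B s t) (B s' t) => b b'.
move: (w s 0%N) (w s 1%N) (w s 2%N) (w s 3%N) (w s' 0%N) (w s' 1%N) (w s' 2%N) (w s' 3%N).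
move=> w0 w1 w2 w3 w0' w1' w2' w3' h' h.
have -> : w0 = 2 * b - (w1 + (w2 + w3)) by rewrite -h addrK.
have -> : w0' = 2 * b' - (w1' + (w2' + w3')) by rewrite -h' addrK.
ring.
Qed.

End NotIntegral.

Lemma few_step : B t t = 2 \/ (exists2 e, e \in S & B e e = 1) ->
  (exists d' (U' : 'M[int]_(n, d')), integral_rep U' (t |: S)) \/
  exists W, e8_config B 6 (t |: S) W.
Proof.
move=> ht; have [p [tau [a [pI hta]]]] := span_links.
have [[z yz]|nz] := pselect (exists z : int, y 0 p = z%:~R).
  left; apply: (@integral_rep_add_integral (\row_q (if q \in I then tau q * (z - a q) else 0))).
    move=> q qI; rewrite mxE qI; have [e2 _ h] := hta q qI.
    rewrite rmorphM rmorphB /= -yz -h opprB addrCA subrr addr0 mulrA -rmorphM /=.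
    by rewrite -expr2 e2 mul1r.
  by move=> q qI; rewrite mxE ifN.
have nint (z : int) : y 0 p != z%:~R by apply/eqP => yz; apply: nz; exists z.
have t2 := norm_two pI hta nint ht.
have [bal|[s [sS is0]]] : (forall s, s \in S -> imbalance tau s = 0) \/
    exists s, s \in S /\ imbalance tau s != 0.
- have [|h] := pselect (exists s, s \in S /\ imbalance tau s != 0); first by right.
  by left=> s sS; apply: contrapT => /eqP is0; apply: h; exists s.
- exact: balanced_step pI hta nint t2 bal.
have [cI|cI] := leqP #|I| 4.
  by left; exact: (unbalanced_small pI hta nint sS is0 t2 cI).
by right; exact: (unbalanced_large pI hta nint sS is0 t2 cI).
Qed.

End FewCoordinates.

(** * Components that contain E6 *)

Lemma config_projection k (X : {set 'I_n}) W t : (6 <= k <= 8)%N -> (#|X| < N)%N ->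
  e8_config B k X W ->
  exists Y : 'rV[rat]_8, [/\ e8_level k Y,
    forall i, (i < k)%N -> dot Y (ratv (e8_row i)) = 4 * (bform B (W i) (delta_mx 0 t))%:~R
    & dot Y Y <= 4 * (B t t)%:~R].
Proof.
move=> /andP[k6 k8] cX [WX WW].
pose Wm : 'M[int]_(k, n) := \matrix_(i, j) W i 0 j.
pose H : 'M[rat]_(k, 8) := \matrix_(i, j) (2^-1 * (e8_row i 0 j)%:~R).
have rW i : row i Wm = W i by apply/rowP => j; rewrite !mxE.
have rH (i : 'I_k) : row i H = 2^-1 *: ratv (e8_row i) by apply/rowP => j; rewrite !mxE.
have i8 (i : 'I_k) : (i < 8)%N by exact: leq_trans (ltn_ord i) k8.
have [||||z [z1 z2]] := @local_projection _ _ Wm H (delta_mx 0 t) (t |: X).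
- by rewrite cardsU1; apply: leq_trans cX; rewrite -[X in (_ <= X)%N]add1n leq_add2r leq_b1.
- by move=> i; rewrite rW; apply: subset_trans (subsetUr _ _); exact: WX.
- by rewrite supp_delta sub1set setU11.
- move=> i j; rewrite !rW !rH dotZl dotZr dot_map e8_row_dot // WW // rmorphM /=.
  by rewrite -[4%:~R]/(4 : rat); field.
exists (2 *: (z *m H)); split.
- have : e8_level k (z *m H).
    apply: e8_level_mulmx => i; rewrite rH -[_ *: _]addr0; apply: e8_level_comb.
      exact/e8_level_map/e8_row_level.
    by split=> _; rewrite /coord !mxE.
  by move=> hz; rewrite -[_ *: _]addr0; apply: e8_level_comb => //; split=> _; rewrite /coord !mxE.
- move=> i ik; have := z1 (Ordinal ik); rewrite rH rW dotZr /= => <-.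
  by rewrite dotZl; field.
- by rewrite dotZl dotZr; rewrite bform_delta in z2; lra.
Qed.

Lemma local_norm_le (t : 'I_n) : (B t t)%:~R <= 2 :> rat.
Proof. by rewrite -[2]/(2%:~R) ler_int. Qed.

(** [E8] is even and the lift [m] of the projection of [t] has a norm strictly
between 0 and twice the minimum, so its norm is the minimum. Thus [t] lies over
the projection of a root, and subtracting from [s t] the combination [v] of the
[W i] that represents [s m - e8_row k] yields a vector with the products of
[e8_row k]. *)
Lemma e8_config_extend k (X : {set 'I_n}) W t (Y : 'rV[rat]_8) (s : int) (m : 'rV[int]_8) :
  (6 <= k < 8)%N -> e8_config B k X W -> e8_level k Y ->
  (forall i, (i < k)%N -> dot Y (ratv (e8_row i)) = 4 * (bform B (W i) (delta_mx 0 t))%:~R) ->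
  dot Y Y <= 4 * (B t t)%:~R -> s ^+ 2 = 1 -> e8_vector m ->
  ratv m = Y + s%:~R *: e8_gap k ->
  exists W', e8_config B k.+1 (t |: X) W'.
Proof.
move=> k68 [WX WW] lY hY nY s2 e8m mE; have /andP[k6 k8] := k68.
have [gap0 gapk gapn] := e8_gap_facts k68.
set G := e8_gap k in mE gap0 gapk gapn; set D := dot G G in gapn.
have s2r : (s%:~R : rat) ^+ 2 = 1 by rewrite -rmorphXn /= s2.
have nm : dot m m = 8.
  have [c mc] := e8_vector_even e8m.
  have : ((dot m m)%:~R : rat) = dot Y Y + D.
    rewrite -dot_map mE dotDl !dotDr !dotZl !dotZr (dotC Y G) gap0 // mulr0 addr0 add0r.
    by rewrite mulrA -expr2 s2r mul1r.
  rewrite mc rmorphM /= -[8%:~R]/(8 : rat) => h8.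
  have c0 : (0 : rat) < c%:~R by have := dot_sqr_ge0 Y; lra.
  have c2 : c%:~R < (2%:~R : rat) by rewrite -[2%:~R]/(2 : rat); have := local_norm_le t; lra.
  by move: c0 c2; rewrite ltr0z ltr_int => c0 c2; have -> : c = 1 by lia.
have nY8 : dot Y Y = 8 - D.
  have : ((dot m m)%:~R : rat) = dot Y Y + D.
    rewrite -dot_map mE dotDl !dotDr !dotZl !dotZr (dotC Y G) gap0 // mulr0 addr0 add0r.
    by rewrite mulrA -expr2 s2r mul1r.
  by rewrite nm -[8%:~R]/(8 : rat) => ->; rewrite addrK.
have t2 : B t t = 2.
  have : (1%:~R : rat) < (B t t)%:~R by rewrite -[1%:~R]/(1 : rat); lra.
  by rewrite ltr_int; have := dB t; lia.
pose M := s *: m - e8_row k.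
have ME : ratv M = s%:~R *: Y - (ratv (e8_row k) - G).
  rewrite /M map_mxB map_mxZ mE scalerDr scalerA -expr2 s2r scale1r opprB addrA.
  by rewrite addrAC.
have lM : e8_level k M.
  apply: e8_level_int; rewrite ME; apply: e8_level_comb => //.
  rewrite -scaleN1r -[_ *: _]addr0; apply: e8_level_comb => //.
  by split=> _; rewrite /coord !mxE.
have e8M : e8_vector M.
  rewrite /M -scaleN1r addrC; apply: e8_vector_comb; first exact: e8_row_vector.
  rewrite -[_ *: _]addr0; apply: e8_vector_comb => //.
  by split=> [j|]; rewrite ?mxE ?subrr ?dvdz0 // big1 ?dvdz0 // => j _; rewrite mxE.
have k68' : (6 <= k <= 8)%N by rewrite k6 ltnW.
have [c Mc] := e8_spanP k68' e8M lM.
pose v : 'rV[int]_n := \sum_(i < k) c i *: W i.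
pose t' := s *: delta_mx 0 t - v.
have vt : 4 * (bform B v (delta_mx 0 t))%:~R = dot Y (ratv M).
  rewrite Mc bform_suml rmorph_sum mulr_sumr (_ : ratv _ = \sum_(i < k) (c i)%:~R *: ratv (e8_row i)).
    rewrite dot_sumr; apply: eq_bigr => i _; rewrite dotZr hY // bformZl rmorphM /=; ring.
  by apply/rowP => j; rewrite mxE !summxE rmorph_sum; apply: eq_bigr => i _; rewrite !mxE rmorphM.
have vS : supp v \subset X.
  apply/subsetP => x; rewrite inE summxE; apply: contraR => xX; rewrite big1 // => i _.
  rewrite mxE; have : x \notin supp (W i) by apply: contra xX; apply/subsetP/WX.
  by rewrite inE negbK => /eqP ->; rewrite mulr0.
have vW j : (j < k)%N -> 4 * bform B v (W j) = dot M (e8_row j).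
  move=> jk; have j8 : (j < 8)%N by exact: ltn_trans k8.
  rewrite Mc bform_suml dotC.
  rewrite dot_sumr mulr_sumr; apply: eq_bigr => i _; have i8 : (i < 8)%N by exact: ltn_trans (ltn_ord i) k8.
  by rewrite bformZl dotZr WW // e8_row_dot // (e8_gramC i8 j8); ring.
have vv : 4 * bform B v v = dot M M.
  rewrite {2}/v bform_sumr mulr_sumr {2}Mc.
  rewrite dot_sumr; apply: eq_bigr => i _; by rewrite bformZr dotZr -vW //; ring.
have t'W j : (j < k)%N -> bform B t' (W j) = e8_gram k j.
  move=> jk; have j8 : (j < 8)%N by exact: ltn_trans k8.
  apply: (@intr_inj rat); apply: (@mulfI _ (4 : rat)) => //.
  rewrite -[4 in RHS]/(4%:~R) -rmorphM /= -e8_row_dot // -dot_map.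
  rewrite bformDl bformNl bformZl rmorphB rmorphM /= mulrBr mulrCA (bformC sB _ (W j)) -hY //.
  have -> : 4 * (bform B v (W j))%:~R = (4 * bform B v (W j))%:~R :> rat by rewrite rmorphM.
  rewrite vW // -dot_map ME !dotDl !dotNl dotDl dotNl dotZl gap0; first by ring.
  by apply/e8_level_map/e8_row_level => //; exact: ltnW.
have t't' : bform B t' t' = 2.
  apply: (@intr_inj rat); apply: (@mulfI _ (4 : rat)) => //.
  have -> : bform B t' t' = s ^+ 2 * B t t - 2 * s * bform B v (delta_mx 0 t) + bform B v v.
    rewrite /t' !bformDl !bformDr !bformNl !bformNr !bformZl !bformZr bform_delta.
    by rewrite (bformC sB _ v); ring.
  have vv' : 4 * (bform B v v)%:~R = dot (ratv M) (ratv M) :> rat by rewrite dot_map -vv rmorphM.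
  rewrite s2 mul1r t2 rmorphD rmorphB !rmorphM /= mulrDr mulrBr vv'.
  have -> : 4 * (2%:~R * s%:~R * (bform B v (delta_mx 0 t))%:~R) = 2%:~R * s%:~R * dot Y (ratv M).
    by rewrite -vt; ring.
  have GG : dot G (ratv (e8_row k)) = D.
    by have := gap0 _ gapk; rewrite dotDr dotNr => /eqP; rewrite subr_eq0 => /eqP.
  have gg : dot (ratv (e8_row k)) (ratv (e8_row k)) = 8.
    by rewrite dot_map e8_row_dot // e8_gram_diag.
  have Gg := GG; rewrite dotC in Gg; have YG : dot Y G = 0 by rewrite dotC gap0.
  have gY := dotC (ratv (e8_row k)) Y.
  rewrite ME !(dotDl, dotDr, dotNl, dotNr, dotZl, dotZr) gg GG Gg YG (gap0 _ lY) gY nY8 -/D.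
  rewrite -[2%:~R]/(2 : rat); move: s2r.
  move: (s%:~R : rat) (dot Y (ratv (e8_row k))) => s' x e.
  by transitivity (4 * 2 + (1 - s' ^+ 2) * (8 - D)); [ring|rewrite e; ring].
exists (fun i => if i == k then t' else W i); split.
  move=> i; rewrite ltnS leq_eqVlt; case: eqP => [-> _|_ /= ik].
    apply: suppD_sub; first by apply: suppZ_sub; rewrite supp_delta sub1set setU11.
    by rewrite -scaleN1r; apply: suppZ_sub; exact: subset_trans vS (subsetUr _ _).
  exact: subset_trans (WX i ik) (subsetUr _ _).
move=> i j ik jk.
have lt l : (l < k.+1)%N -> l != k -> (l < k)%N by rewrite ltnS ltn_neqAle => -> ->.
have [ei|/(lt i ik) {}ik] := eqVneq i k; have [ej|/(lt j jk) {}jk] := eqVneq j k.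
- by rewrite ei ej t't' e8_gram_diag.
- by rewrite ei; exact: t'W.
- by rewrite ej (bformC sB) t'W // e8_gramC // (ltn_trans ik).
- exact: WW.
Qed.

Definition e8_rep (C : {set 'I_n}) (E : 'I_n -> 'rV[int]_8) :=
  (forall t, t \in C -> e8_vector (E t)) /\
  {in C &, forall t u, 4 * B t u = dot (E t) (E u)}.

Lemma dot0r (R : comPzRingType) d (x : 'rV[R]_d) : dot x 0 = 0.
Proof. by rewrite -(scale0r 0) dotZr mul0r. Qed.

(** If [E t] is not zero, then it has norm 2 as [E8] is even, the same as [t]: the
difference of [t] and its projection is a null vector, and [t] may be replaced
by its projection in all products. The elements of [C] whose projection is zero
are orthogonal to those, so that there are none in a connected set. *)
Lemma e8_config_complete k (X C : {set 'I_n}) W (E : 'I_n -> 'rV[int]_8) :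
  (6 <= k <= 8)%N -> e8_config B k X W -> X \subset C -> (#|X| + 1 < N)%N -> linked C ->
  (forall t, t \in C -> [/\ e8_vector (E t), e8_level k (E t),
     forall i, (i < k)%N -> dot (E t) (e8_row i) = 4 * bform B (W i) (delta_mx 0 t)
     & dot (E t) (E t) <= 4 * B t t]) ->
  e8_rep C E.
Proof.
move=> k68 [WX WW] XC cX lC hE; have /andP[k6 k8] := k68.
have rowdot t u : t \in C -> u \in C -> E t != 0 -> 4 * B t u = dot (E t) (E u).
  move=> tC uC Et0; have [eE lE pE nE] := hE t tC.
  have [c Ec] := e8_spanP k68 eE lE.
  have n8 : dot (E t) (E t) = 8.
    have [l El] := e8_vector_even eE.
    have : 0 < dot (E t) (E t).
      rewrite lt_neqAle dot_sqr_ge0 andbT eq_sym; apply: contra Et0 => /eqP e0.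
      apply/eqP/rowP => j; rewrite [RHS]mxE; apply/eqP; rewrite -sqrf_eq0 expr2.
      by move/psumr_eq0P: e0 => -> // i _; rewrite -expr2 sqr_ge0.
    by have := dB t; lia.
  have t2 : B t t = 2 by have := dB t; lia.
  pose v : 'rV[int]_n := \sum_(i < k) c i *: W i.
  have vS : supp v \subset X.
    apply/subsetP => x; rewrite inE summxE; apply: contraR => xX; rewrite big1 // => i _.
    rewrite mxE; have : x \notin supp (W i) by apply: contra xX; apply/subsetP/WX.
    by rewrite inE negbK => /eqP ->; rewrite mulr0.
  have vprod x : x \in C -> 4 * bform B v (delta_mx 0 x) = dot (E t) (E x).
    move=> xC; have [_ _ pEx _] := hE x xC.
    rewrite bform_suml Ec dotC dot_sumr mulr_sumr; apply: eq_bigr => i _.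
    by rewrite bformZl dotZr pEx //; ring.
  have vv : 4 * bform B v v = 8.
    rewrite {2}/v bform_sumr mulr_sumr -n8 {2}Ec dot_sumr; apply: eq_bigr => i _.
    rewrite bformZr dotZr mulrCA; congr (_ * _).
    rewrite {1}Ec dotC dot_sumr bform_suml mulr_sumr; apply: eq_bigr => j _.
    rewrite bformZl dotZr WW // e8_row_dot ?(leq_trans (ltn_ord _) k8) //.
    by rewrite e8_gramC ?(leq_trans (ltn_ord _) k8) //; ring.
  have null : bform B (delta_mx 0 t - v) (delta_mx 0 t - v) = 0.
    rewrite !bformDl !bformDr !bformNl !bformNr bform_delta t2 (bformC sB _ v).
    have e2 (x : int) : 4 * x = 8 -> x = 2 by lia.
    by have := vprod t tC; rewrite n8 => /e2 ->; rewrite (e2 _ vv).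
  have cw : (#|supp (delta_mx 0%R t - v)%R| < N)%N.
    apply: leq_ltn_trans cX; apply: (@leq_trans #|t |: X|).
      apply/subset_leq_card/suppD_sub; first by rewrite supp_delta sub1set setU11.
      by rewrite -scaleN1r; apply: suppZ_sub; exact: subset_trans vS (subsetUr _ _).
    by rewrite cardsU1 addnC leq_add2l leq_b1.
  have := local_null cw null u; rewrite bformDl bformNl bform_delta => /eqP.
  by rewrite subr_eq0 => /eqP ->; exact: vprod.
split=> [t /hE[] //|].
pose T := [set t in C | E t != 0].
have TC : T \subset C by apply/subsetP => t; rewrite inE => /andP[].
suff TE : T = C by move=> t u tC uC; apply: rowdot => //; move: tC; rewrite -TE inE => /andP[].
apply/eqP; apply: contraT => TnC; have [|s [s' [sT s'T /eqP[]]]] := lC T TC _ TnC.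
  apply/set0Pn; apply: contrapT => T0.
  have all0 t : t \in C -> E t = 0.
    by move=> tC; apply/eqP; apply: contrapT => /negP Et; apply: T0; exists t; rewrite inE tC.
  have i0k : (0 < k)%N by exact: leq_trans k6.
  have := WW 0%N 0%N i0k i0k; rewrite bformE big1 // => j _.
  have [->|Wj] := eqVneq (W 0%N 0 j) 0; first by rewrite mul0r.
  have jC : j \in C by apply: (subsetP XC); apply: (subsetP (WX 0%N i0k)); rewrite inE.
  have [_ _ /(_ 0%N i0k) pj _] := hE j jC; rewrite all0 // dotC dot0r in pj.
  by rewrite -bform_deltarE; have -> : bform B (W 0%N) (delta_mx 0 j) = 0; [lia|rewrite mulr0].
move: sT s'T; rewrite !inE => /andP[sC Es] /andP[+ s'C]; rewrite s'C negbK => /eqP Es'.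
by have := rowdot s s' sC s'C Es; rewrite Es' dot0r; lia.
Qed.

(** The configuration is extended from [E6] to [E7] and to [E8] as long as some
element of [C] does not project into the lattice. *)
Lemma e8_component (X C : {set 'I_n}) W : e8_config B 6 X W -> X \subset C ->
  (#|X| + 4 < N)%N -> linked C -> exists E, e8_rep C E.
Proof.
have step k (X' : {set 'I_n}) W' : (6 <= k <= 8)%N -> e8_config B k X' W' -> X' \subset C -> (#|X'| + 1 < N)%N ->
    linked C -> (exists E, e8_rep C E) \/ ((k < 8)%N /\ exists t W'', t \in C /\ e8_config B k.+1 (t |: X') W'').
  move=> k68 cf X'C cX' lC; have cX2 : (#|X'| < N)%N by apply: leq_ltn_trans cX'; exact: leq_addr.
  have [[t [W'' [k8 tC cf'']]]|nex] := pselect (exists t W'', [/\ (k < 8)%N, t \in C & e8_config B k.+1 (t |: X') W'']).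
    by right; split=> //; exists t, W''.
  left; have /choice[E hE] : forall t, exists E : 'rV[int]_8, t \in C -> [/\ e8_vector E, e8_level k E,
     forall i, (i < k)%N -> dot E (e8_row i) = 4 * bform B (W' i) (delta_mx 0 t)
     & dot E E <= 4 * B t t].
    move=> t; have [tC|_] := boolP (t \in C); last by exists 0.
    have [Y [lY pY nY]] := config_projection t k68 cX2 cf.
    have [[m em Ym]|[k8 [s [m [s2 em mE]]]]] := e8_lift k68 lY pY.
      exists m => _; split=> // [|i ik|].
      - by apply: e8_level_int; rewrite -Ym.
      - by apply: (@intr_inj rat); rewrite -dot_map -Ym pY // rmorphM.
      - by rewrite -(ler_int rat) -dot_map -Ym rmorphM.
    case: nex; have k68' : (6 <= k < 8)%N by rewrite k8 andbT; case/andP: k68.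
    have [W'' cf''] := e8_config_extend k68' cf lY pY nY s2 em mE.
    by exists t, W''.
  by exists E; exact: e8_config_complete k68 cf X'C cX' lC hE.
move=> cf XC cX lC.
have cU t (X' : {set 'I_n}) : (#|t |: X'| <= #|X'| + 1)%N by rewrite cardsU1 addnC leq_add2l leq_b1.
have [||//|[_ [t [W1 [tC cf1]]]]] := step 6%N X W _ cf XC _ lC; [by []|by apply: leq_ltn_trans cX; rewrite leq_add2l|].
have c1 := cU t X.
have [|||//|[_ [t' [W2 [tC' cf2]]]]] := step 7%N _ _ _ cf1 _ _ lC; [by []|by rewrite subUset sub1set tC|by lia|].
have c2 := cU t' (t |: X).
have [|||//|[//]] := step 8%N _ _ _ cf2 _ _ lC; [by []|by rewrite !subUset !sub1set tC tC'|by lia].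
Qed.

(** * Connected components *)

Section Components.
Variable K : nat.
Hypothesis KN : (3 * K + 1 < N)%N.
Hypothesis KN3 : (3 ^ K + 5 < N)%N.
Hypothesis nodup : forall x y, B x x = B x y -> B y y = B x y -> x = y.

Definition form_rel : rel 'I_n := fun x y => B x y != 0.

Lemma form_rel_sym : symmetric form_rel.
Proof. by move=> x y; rewrite /form_rel B_sym. Qed.

Lemma form_closed (S : {set 'I_n}) :
  (forall x y, x \in S -> B x y != 0 -> y \in S) -> fingraph.closed form_rel (mem S).
Proof.
move=> hS x y xy; apply/idP/idP => [xS|yS]; first exact: hS xy.
by apply: hS yS _; rewrite B_sym.
Qed.

Definition form_component x := [set y | connect form_rel x y].

Lemma linked_component x : linked (form_component x).
Proof.
move=> S1 S1C S10 S1n; apply: contrapT => ncross.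
have cl : fingraph.closed form_rel (mem S1).
  apply: form_closed => y z yS yz; apply: contraT => zS1; case: ncross; exists y, z; split=> //.
  rewrite in_setD zS1 inE; have := subsetP S1C _ yS; rewrite inE => /connect_trans; apply.
  exact: connect1.
have /set0Pn[y yS] := S10; case/negP: S1n; rewrite eqEsubset S1C /=.
apply/subsetP => z; rewrite inE => xz; have := subsetP S1C _ yS; rewrite inE => xy.
have yz : connect form_rel y z.
  by apply: connect_trans xz; rewrite (sym_connect_sym form_rel_sym).
by rewrite -(closed_connect cl yz).
Qed.

Lemma integral_rep1 x : exists d (U : 'M[int]_(n, d)), integral_rep U [set x].
Proof.
pose U : 'M[int]_(n, 2) := \matrix_(i, j) (if j == ord0 then (B x x != 0)%:R else (B x x == 2)%:R).
exists 2, U => s s'; rewrite !inE => /eqP -> /eqP ->.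
have N0 : (0 < N)%N by apply: leq_trans KN3.
rewrite /dot !big_ord_recl big_ord0 !mxE /=; have := diag_ge0 x N0; have := dB x => b2 b0.
by have [->|[->|->]] : B x x = 0 \/ B x x = 1 \/ B x x = 2 by lia.
Qed.

(** Without repetitions, a represented set has at most one element for each row
with entries in [{-1, 0, 1}]. *)
Lemma integral_rep_card d (U : 'M[int]_(n, d)) (S : {set 'I_n}) : integral_rep U S ->
  (#|S| <= 3 ^ #|zsupp U S|)%N.
Proof.
move=> zU.
have U1 s q : s \in S -> -1 <= U s q <= 1.
  move=> sS; have := integral_rep_norm zU sS; rewrite (bigD1 q) //= => h.
  have : 0 <= \sum_(i < d | i != q) U s i ^+ 2 by apply: sumr_ge0 => i _; exact: sqr_ge0.
  by move: (\sum_(i < d | i != q) _) h => r; nia.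
pose code s : {ffun 'I_d -> 'I_3} := [ffun q => inord (absz (U s q + 1))].
have codeE s q : s \in S -> (code s q : nat) = absz (U s q + 1).
  by move=> sS; rewrite ffunE inordK //; have := U1 s q sS; lia.
have inj : {in S &, injective code}.
  move=> s s' sS s'S ss; have rr : row s U = row s' U.
    apply/rowP => q; rewrite !mxE; have := codeE s q sS; have := codeE s' q s'S; rewrite ss => ->.
    by have := U1 s q sS; have := U1 s' q s'S; lia.
  by apply: nodup; rewrite !zU // rr.
rewrite -(card_in_imset inj).
have -> : (3 ^ #|zsupp U S| = #|pffun_on (inord 1 : 'I_3) (zsupp U S) predT|)%N.
  by rewrite card_pffun_on card_ord.
apply/subset_leq_card/subsetP => _ /imsetP[s sS ->]; apply/pffun_onP; split=> //.
apply/subsetP => q; rewrite !inE; apply: contraR => qI; apply/eqP/val_inj; rewrite /= codeE // inordK //.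
have -> : U s q = 0; last by [].
apply/eqP; apply: contraNT qI => Us; apply/exists_inP; by exists s.
Qed.

(** Let [S] be a maximal connected subset that is represented by integer vectors
and contains a vector [x], of norm 1 if there is one. If [S] is
not everything, then an element [t] next to [S] cannot be added: hence [S] occupies few coordinates and has bounded size, and
[t] completes it to a configuration of type [E6]. *)
Lemma component_rep x0 : 900 <= (K%:R : rat) ->
  (exists d (U : 'M[int]_(n, d)), integral_rep U (form_component x0)) \/
  exists E, e8_rep (form_component x0) E.
Proof.
move=> Kr; have large d (U : 'M[int]_(n, d)) S t := @rounded_vector d K U S t Kr KN; clear Kr.
pose C := form_component x0; have lC : linked C := @linked_component x0.
have N0 : (1 < N)%N by apply: leq_trans KN3; rewrite addnC.
have [x xC hx] : exists2 x, x \in C & (exists2 e, e \in C & B e e = 1) -> B x x = 1.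
  have [[e eC e1]|ne] := pselect (exists2 e, e \in C & B e e = 1); first by exists e.
  by exists x0 => [|/ne //]; rewrite inE connect0.
pose P (S : {set 'I_n}) := `[< [/\ x \in S, S \subset C, linked S & exists d (U : 'M[int]_(n, d)), integral_rep U S] >].
have P1 : P [set x].
  by apply/asboolP; rewrite set11 sub1set; split=> //; [exact: linked1|exact: integral_rep1].
have [S /maxsetP[/asboolP[xS SC lS [d [U zU]]] maxS] _] := maxset_exists P1.
have [SE|SnC] := eqVneq S C; first by left; exists d, U; rewrite -/C -SE.
have [|s [t [sS + bt]]] := lC S SC _ SnC; first by apply/set0Pn; exists x.
rewrite in_setD => /andP[tS tC].
have noext : ~ exists d' (U' : 'M[int]_(n, d')), integral_rep U' (t |: S).
  move=> zU'; suff : P (t |: S).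
    by move=> /maxS /(_ (subsetUr _ _)) SE; rewrite -SE setU11 in tS.
  apply/asboolP; split=> //; first by rewrite in_setU1 xS orbT.
    by rewrite subUset sub1set tC.
  exact: linked_add lS sS bt.
have [cI|cI] := ltnP K #|zsupp U S|.
  have [z [z1 z2]] := large d U S t zU lS cI.
  by case: noext; exact: integral_rep_add_nonzero zU tS sS bt z1 z2.
have cS : (#|S| <= 3 ^ K)%N by apply: leq_trans (integral_rep_card zU) _; rewrite leq_exp2l.
have cS' : (#|S| < N)%N by apply: leq_ltn_trans KN3; apply: leq_trans cS _; exact: leq_addr.
have [y [y1 y2]] := integral_rep_projection t zU (subxx S) cS'.
have [|//|[W cf]] := few_step cS' zU lS tS sS bt y1 y2.
  have [[e eC e1]|ne] := pselect (exists2 e, e \in C & B e e = 1).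
    by right; exists x => //; apply: hx; exists e.
  left; have t0 : B t t != 0.
    apply: contraNneq bt => t0; rewrite B_sym -bform_delta; apply/eqP/local_null.
      by rewrite supp_delta cards1.
    by rewrite bform_delta.
  have t1 : B t t != 1 by apply/eqP => t1; apply: ne; exists t.
  by have := dB t; have := diag_ge0 t (ltnW N0); lia.
right; apply: e8_component cf _ _ lC; first by rewrite subUset sub1set tC.
apply: leq_ltn_trans KN3; rewrite cardsU1 tS (addnC 1%N) -addnA leq_add2r; exact: cS.
Qed.

End Components.
End LocalForm.

(** * Representation of locally positive semidefinite forms *)

(** A Gram representation of [B] by vectors of [Z^d] and of copies of [E8]. The
factor 4 is due to the doubled coordinates of the latter. *)
Definition gram_rep n (B : 'M[int]_n) d (U : 'M[int]_(n, d)) (Es : seq 'M[int]_(n, 8)) :=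
  (forall E, E \in Es -> forall i, e8_vector (row i E)) /\
  4 *: B = 4 *: (U *m U^T) + \sum_(E <- Es) E *m E^T.

Definition representable n (B : 'M[int]_n) := exists d (U : 'M[int]_(n, d)) Es, gram_rep B U Es.

Lemma mulmx_trE (R : pzRingType) n d (U : 'M[R]_(n, d)) i j :
  (U *m U^T) i j = dot (row i U) (row j U).
Proof. by rewrite mxE; apply: eq_bigr => l _; rewrite !mxE. Qed.

Lemma e8_vector0 : e8_vector 0.
Proof. by split=> [j|]; rewrite ?mxE ?subrr ?dvdz0 // big1 ?dvdz0 // => j _; rewrite mxE. Qed.

Lemma representableD n (B1 B2 : 'M[int]_n) :
  representable B1 -> representable B2 -> representable (B1 + B2).
Proof.
move=> [d1 [U1 [Es1 [e1 r1]]]] [d2 [U2 [Es2 [e2 r2]]]].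
exists (d1 + d2)%N, (row_mx U1 U2), (Es1 ++ Es2); split.
  by move=> E; rewrite mem_cat => /orP[]; [exact: e1|exact: e2].
rewrite scalerDr r1 r2 big_cat /= tr_row_mx mul_row_col scalerDr.
by rewrite addrACA.
Qed.

Lemma representable_gram n d (U : 'M[int]_(n, d)) : representable (U *m U^T).
Proof. by exists d, U, [::]; split=> //; rewrite big_nil addr0. Qed.

Lemma representable_e8 n (B : 'M[int]_n) (E : 'M[int]_(n, 8)) :
  (forall i, e8_vector (row i E)) -> 4 *: B = E *m E^T -> representable B.
Proof.
move=> hE BE; exists 0%N, 0, [:: E]; split; first by move=> F; rewrite inE => /eqP ->.
by rewrite mul0mx scaler0 add0r big_seq1.
Qed.

Lemma representable_rows n k (B : 'M[int]_k) (g : 'I_n -> 'I_k) :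
  representable B -> representable (mxsub g g B).
Proof.
move=> [d [U [Es [hE BE]]]]; exists d, (rowsub g U), [seq rowsub g E | E <- Es]; split.
  move=> _ /mapP[E EE ->] i; have -> : row i (rowsub g E) = row (g i) E by apply/rowP => j; rewrite !mxE.
  exact: hE.
have rs e (V : 'M[int]_(k, e)) : rowsub g V *m (rowsub g V)^T = mxsub g g (V *m V^T).
  by apply/matrixP => i j; rewrite !mxE; apply: eq_bigr => l _; rewrite !mxE.
rewrite rs big_map; apply/matrixP => i j; have /matrixP/(_ (g i) (g j)) := BE.
rewrite !mxE => ->; congr (_ + _).
rewrite !summxE; apply: eq_bigr => E _; by rewrite rs [RHS]mxE.
Qed.

Definition block_of n (B : 'M[int]_n) (S : {set 'I_n}) : 'M[int]_n :=
  \matrix_(i, j) (if (i \in S) && (j \in S) then B i j else 0).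

Section DistinctRows.
Variables (n : nat) (B : 'M[int]_n) (N K : nat).
Hypothesis sB : B^T = B.
Hypothesis dB : forall i, B i i <= 2.
Hypothesis lpB : locally_psd B N.
Hypothesis KN : (3 * K + 1 < N)%N.
Hypothesis KN3 : (3 ^ K + 5 < N)%N.

Lemma representable_distinct : 900 <= (K%:R : rat) ->
  (forall x y, B x x = B x y -> B y y = B x y -> x = y) -> representable B.
Proof.
move=> Kr nodup; have comp x := component_rep sB dB lpB KN KN3 nodup x Kr; clear Kr.
have comp_block x : representable (block_of B (form_component B x)).
  set C := form_component B x; have [[d [U zU]]|[E [eE rE]]] := comp x.
    have -> : block_of B C = (\matrix_(i, j) (if i \in C then U i j else 0)) *m
        (\matrix_(i, j) (if i \in C then U i j else 0))^T.
      apply/matrixP => i j; rewrite mulmx_trE mxE.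
      have rU l : row l (\matrix_(i, j) (if i \in C then U i j else 0)) = if l \in C then row l U else 0.
        by apply/rowP => q; rewrite !mxE; case: ifP; rewrite ?mxE.
      rewrite !rU; have [iC|_] := boolP (i \in C); last by rewrite dotC dot0r.
      by case: (boolP (j \in C)) => [jC|_] /=; rewrite ?dot0r // zU.
    exact: representable_gram.
  pose F : 'M[int]_(n, 8) := \matrix_(i, j) (if i \in C then E i 0 j else 0).
  have rF l : row l F = if l \in C then E l else 0.
    by apply/rowP => q; rewrite !mxE; case: ifP; rewrite ?mxE.
  apply: (@representable_e8 _ _ F).
    by move=> i; rewrite rF; case: ifP => [/eE //|_]; exact: e8_vector0.
  apply/matrixP => i j; rewrite mulmx_trE !mxE !rF.
  have [iC|_] := boolP (i \in C); last by rewrite dotC dot0r mulr0.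
  by case: (boolP (j \in C)) => [jC|_] /=; rewrite ?dot0r ?mulr0 // rE.
suff all k (S : {set 'I_n}) : (#|S| <= k)%N -> fingraph.closed (form_rel B) (mem S) ->
    representable (block_of B S).
  have := all n setT; rewrite cardsT card_ord leqnn => /(_ isT).
  have -> : block_of B setT = B by apply/matrixP => i j; rewrite mxE !inE.
  by apply=> x y _; rewrite !inE.
elim: k S => [|k IH] S cS clS.
  have -> : S = set0 by apply/eqP; rewrite -cards_eq0 -leqn0.
  have -> : block_of B set0 = (0 : 'M[int]_(n, 0)) *m 0^T.
    by apply/matrixP => i j; rewrite mul0mx !mxE inE.
  exact: representable_gram.
have [S0|[x xS]] := set_0Vmem S.
  by apply: IH => //; rewrite S0 cards0.
set C := form_component B x.
have CS : C \subset S.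
  by apply/subsetP => y; rewrite inE => xy; rewrite -(closed_connect clS xy).
have csym := sym_connect_sym (form_rel_sym sB).
have clC : fingraph.closed (form_rel B) (mem C).
  by move=> y z yz; rewrite !inE; apply: same_connect_r => //; exact: connect1.
have -> : block_of B S = block_of B C + block_of B (S :\: C).
  apply/matrixP => i j; rewrite !mxE !in_setD.
  have [iC|iC] := boolP (i \in C); have [jC|jC] := boolP (j \in C).
  - by rewrite (subsetP CS _ iC) (subsetP CS _ jC) /= addr0.
  - have -> : B i j = 0 by apply/eqP; apply: contraNT jC => bij; have /= <- := clC i j bij.
    by rewrite !if_same addr0.
  - have -> : B i j = 0 by apply/eqP; apply: contraNT iC => bij; have /= -> := clC i j bij.
    by rewrite !if_same addr0.
  - by rewrite /= add0r.
apply: representableD; first exact: comp_block.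
apply: IH => [|y z yz].
  have xC : x \in C by rewrite inE connect0.
  rewrite cardsD (setIidPr CS) -ltnS; apply: leq_trans cS.
  rewrite -subn_gt0 subKn ?subset_leq_card //; by apply/card_gt0P; exists x.
have /= h1 := clS y z yz; have /= h2 := clC y z yz.
by rewrite /= !in_setD; move: h1 h2; rewrite !unfold_in /= => -> ->.
Qed.

End DistinctRows.

(** Two indices with [B x x = B x y = B y y] have equal rows, since their
difference is a null vector; keeping one index of each class makes the sizes of
the represented sets bounded. *)
Lemma representable_of_locally_psd : exists N, forall n (B : 'M[int]_n),
  B^T = B -> (forall i, B i i <= 2) -> locally_psd B N -> representable B.
Proof.
have [K Kr] : exists K : nat, 900 <= (K%:R : rat) by exists (30 * 30)%N; rewrite natrM; lra.
have main (n : nat) (B : 'M[int]_n) N sB dB lpB KN KN3 := @representable_distinct n B N K sB dB lpB KN KN3 Kr.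
clear Kr; pose N := (3 * K + 1 + (3 ^ K + 5)).+1; exists N => n B sB dB lpB.
have N2 : (2 < N)%N by rewrite /N; lia.
have rows x y : B x x = B x y -> B y y = B x y -> forall z, B x z = B y z.
  move=> xx yy z; apply/eqP; rewrite -subr_eq0 -!bform_delta -bformNl -bformDl; apply/eqP.
  apply: (@local_null n B N sB dB lpB).
    apply: leq_trans N2; apply: (@leq_trans #|[set x; y]|.+1); last by rewrite ltnS cards2; case: (x != y).
    rewrite ltnS; apply/subset_leq_card/suppD_sub; first by rewrite supp_delta sub1set !inE eqxx.
    by rewrite -scaleN1r; apply: suppZ_sub; rewrite supp_delta sub1set !inE eqxx orbT.
  by rewrite !bformDl !bformDr !bformNl !bformNr !bform_delta xx yy (B_sym sB y x); ring.
pose eqv x y := (B x x == B x y) && (B y y == B x y).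
pose r x := odflt x [pick y | eqv x y].
have rP x : eqv x (r x).
  by rewrite /r; case: pickP => [y //|/(_ x)]; rewrite /eqv eqxx.
have eqv_rows x y : eqv x y -> forall z, B x z = B y z by move=> /andP[/eqP xx /eqP yy]; exact: rows.
have eqvE x y : eqv x y -> eqv x =1 eqv y.
  move=> xy z; have := eqv_rows x y xy; move=> h; rewrite /eqv (h z) (h x) (B_sym sB y x) (h y).
  by [].
have r_eqv x y : eqv x y -> r x = r y.
  move=> xy; rewrite /r (eq_pick (eqvE x y xy)); case: pickP => [z //|/(_ y)].
  by rewrite /eqv eqxx.
have rr x : r (r x) = r x by rewrite -(r_eqv _ _ (rP x)).
pose V := [set x | r x == x].
have rV x : r x \in V by rewrite inE rr.
have [n0|[x0 _]] := set_0Vmem [set: 'I_n].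
  have -> : B = (0 : 'M[int]_(n, 0)) *m 0^T.
    by apply/matrixP => i j; have := in_setT i; rewrite n0 inE.
  exact: representable_gram.
pose g x := enum_rank_in (rV x0) (r x).
pose B0 := mxsub (@enum_val _ (mem V)) (@enum_val _ (mem V)) B.
have -> : B = mxsub g g B0.
  apply/matrixP => i j; rewrite !mxE !enum_rankK_in // (eqv_rows _ _ (rP i)) B_sym //.
  by rewrite (eqv_rows _ _ (rP j)) B_sym.
apply: representable_rows; apply: (main _ B0 N).
- by apply/matrixP => i j; rewrite !mxE B_sym.
- by move=> i; rewrite mxE.
- move=> w cw; pose G : 'M[rat]_(#|V|, n) := \matrix_(i, j) (enum_val i == j)%:R.
  have -> : map_mx intr B0 = G *m map_mx intr B *m G^T.
    have dG l : (delta_mx 0 l : 'rV_#|V|) *m G = delta_mx 0 (enum_val l).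
      by rewrite -rowE; apply/rowP => l'; rewrite !mxE eqxx eq_sym.
    by apply/matrixP => i j; rewrite -[RHS]bform_delta -bform_mul !dG bform_delta !mxE.
  rewrite -bform_mul; apply: lpB; apply: leq_trans cw.
  apply: (@leq_trans #|[set enum_val i | i in supp w]|); last exact: leq_imset_card.
  apply/subset_leq_card/subsetP => x; rewrite inE; apply: contraR => xw.
  rewrite mxE big1 // => i _; rewrite mxE; case: eqP => [xi|_]; last by rewrite mulr0.
  rewrite mulr1; apply/eqP; apply: contraNT xw => wi; apply/imsetP; exists i => //.
  by rewrite inE.
- by rewrite /N; lia.
- by rewrite /N ltnS leq_addl.
move=> i j; rewrite !mxE => ii jj; apply: enum_val_inj.
have := enum_valP i; have := enum_valP j; rewrite !inE => /eqP <- /eqP <-.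
by apply: r_eqv; rewrite /eqv ii jj eqxx.
Qed.

(** * Lattices *)

Lemma dotpE (R : comPzRingType) n (u v : 'cV[R]_n) : dotp u v = (u^T *m v) 0 0.
Proof. by rewrite mxE; apply: eq_bigr => i _; rewrite mxE. Qed.

Lemma dotp_eq0 (R : realDomainType) n (u : 'cV[R]_n) : dotp u u = 0 -> u = 0.
Proof.
move=> u0; apply/colP => i; rewrite [RHS]mxE; apply/eqP; rewrite -sqrf_eq0 expr2.
by move/psumr_eq0P: u0 => -> // j _; rewrite -expr2 sqr_ge0.
Qed.

(** The isometry maps [N z] to [Q z]; it is well defined because [N z = 0] and
[Q z = 0] both mean that the form of the common Gram matrix vanishes at [z]. *)
Lemma column_lattice_iso (R : realDomainType) p q n (N : 'M[R]_(p, n)) (Q : 'M[R]_(q, n)) :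
  N^T *m N = Q^T *m Q -> lattice_iso (column_lattice N) (column_lattice Q).
Proof.
move=> NQ.
have dotE (z z' : 'cV[int]_n) : dotp (N *m map_mx intr z) (N *m map_mx intr z') =
    dotp (Q *m map_mx intr z) (Q *m map_mx intr z').
  by rewrite !dotpE !trmx_mul -!mulmxA (mulmxA N^T) NQ !mulmxA.
have mapB (z z' : 'cV[int]_n) p' (M : 'M[R]_(p', n)) :
    M *m map_mx intr z - M *m map_mx intr z' = M *m map_mx intr (z - z').
  by rewrite map_mxB mulmxBr.
have mapD (z z' : 'cV[int]_n) p' (M : 'M[R]_(p', n)) :
    M *m map_mx intr z + M *m map_mx intr z' = M *m map_mx intr (z + z').
  by rewrite map_mxD mulmxDr.
have NQz (z z' : 'cV[int]_n) : N *m map_mx intr z = N *m map_mx intr z' ->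
    Q *m map_mx intr z = Q *m map_mx intr z'.
  move=> /eqP; rewrite -subr_eq0 mapB => /eqP N0; apply/eqP; rewrite -subr_eq0 mapB.
  by apply/eqP/dotp_eq0; rewrite -dotE N0 /dotp big1 // => i _; rewrite mxE mul0r.
have QNz (z z' : 'cV[int]_n) : Q *m map_mx intr z = Q *m map_mx intr z' ->
    N *m map_mx intr z = N *m map_mx intr z'.
  move=> /eqP; rewrite -subr_eq0 mapB => /eqP N0; apply/eqP; rewrite -subr_eq0 mapB.
  by apply/eqP/dotp_eq0; rewrite dotE N0 /dotp big1 // => i _; rewrite mxE mul0r.
have /choice[f hf] : forall u, exists v, forall z : 'cV[int]_n, u = N *m map_mx intr z -> v = Q *m map_mx intr z.
  move=> u; have [[z uz]|nz] := pselect (exists z : 'cV[int]_n, u = N *m map_mx intr z).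
    by exists (Q *m map_mx intr z) => z' uz'; apply: NQz; rewrite -uz.
  by exists 0 => z uz; case: nz; exists z.
have fN z : f (N *m map_mx intr z) = Q *m map_mx intr z by exact: hf.
exists f; split.
- split.
  + by move=> _ [z _ <-]; rewrite fN; exists z.
  + move=> u v; rewrite !in_setE => -[z _ <-] [z' _ <-]; rewrite !fN; exact: QNz.
  + by move=> _ [z _ <-]; exists (N *m map_mx intr z); [exists z|exact: fN].
- by move=> _ _ [z _ <-] [z' _ <-]; rewrite mapD !fN mapD.
- by move=> _ _ [z _ <-] [z' _ <-]; rewrite !fN dotE.
Qed.

Lemma column_lattice_sublattice (R : pzRingType) p n (Q : 'M[R]_(p, n)) (M : set 'cV[R]_p) :
  (forall z : 'cV[int]_n, M (Q *m map_mx intr z)) -> sublattice (column_lattice Q) M.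
Proof.
move=> QM; split.
- by move=> _ [z _ <-].
- by exists 0 => //; rewrite map_mx0 mulmx0.
- by move=> _ _ [z _ <-] [z' _ <-]; exists (z - z') => //; rewrite map_mxB mulmxBr.
Qed.

(** Halving the doubled coordinates: the parity of the coordinates tells the two
cosets of [D8] apart. *)
Lemma e8_vectorE8 (R : numFieldType) (m : 'rV[int]_8) : e8_vector m ->
  E8 R (2^-1 *: (map_mx intr m)^T).
Proof.
move=> /e8_vectorP[e [h [s [h0 mE hs]]]].
have mj j : m 0 j = e + 2 * h j.
  by have := mE j (ltn_ord j); rewrite /coord inord_val.
have even (a : int) : (2 %| \sum_(i < 8) (a + h i))%Z.
  rewrite sum_coord !inordK // h0 addr0; apply/dvdzP; exists (4 * a + s).
  transitivity (8 * a + (h 1%N + h 2%N + h 3%N + h 4%N + h 5%N + h 6%N + h 7%N)); first by ring.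
  by rewrite hs; ring.
have [a [ea|ea]] : exists a, e = 2 * a \/ e = 2 * a + 1 by exists (divz e 2); lia.
  left; exists (\col_j (a + h j)).
    by rewrite /=; under eq_bigr do rewrite mxE; exact: even.
  by apply/colP => j; rewrite !mxE mj ea -mulrDr rmorphM /= mulrA mulVf ?mul1r.
right; exists (map_mx intr (\col_j (a + h j))).
  exists (\col_j (a + h j)) => //.
  by rewrite /=; under eq_bigr do rewrite mxE; exact: even.
apply/colP => j; rewrite !mxE mj ea.
have -> : 2 * a + 1 + 2 * h j = 2 * (a + h j) + 1 by ring.
by rewrite (rmorphD _ (2 * _)) rmorphM /= mulrDr mulrA mulVf ?mul1r ?mulr1 1?addrC.
Qed.

Lemma representable_lattice (R : numFieldType) n (A : 'M[int]_n) : representable A ->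
  exists d k (Q : 'M[R]_(d + \sum_(i < k) 8, n)),
    Q^T *m Q = map_mx intr A /\
    forall z : 'cV[int]_n, lattice_dsum (Zlattice R d) (lattice_copies (E8 R) k) (Q *m map_mx intr z).
Proof.
move=> [d [U [Es [hE AE]]]]; exists d, (size Es).
pose F (i : 'I_(size Es)) : 'M[R]_(8, n) := 2^-1 *: (map_mx intr (tnth (in_tuple Es) i))^T.
exists (col_mx (map_mx intr U^T) (\mxcol_i F i)); split.
  apply: (@scalerI _ _ (4 : R)); first by rewrite pnatr_eq0.
  rewrite -[4 in RHS]/(4%:~R) -map_mxZ AE map_mxD map_mxZ map_mxM.
  rewrite tr_col_mx mul_row_col scalerDr -map_trmx trmxK; congr (_ + _).
  rewrite tr_mxcol mul_mxrow_mxcol scaler_sumr.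
  have msum (I : Type) (r : seq I) (f : I -> 'M[int]_n) :
      map_mx intr (\sum_(i <- r) f i) = \sum_(i <- r) map_mx intr (f i) :> 'M[R]_n.
    by apply: (big_morph (map_mx intr)) => [u v|]; rewrite ?map_mxD ?map_mx0.
  rewrite [in RHS]big_tnth msum; apply: eq_bigr => i _.
  have -> : (F i)^T = 2^-1 *: map_mx intr (tnth (in_tuple Es) i).
    by apply/matrixP => x y; rewrite !mxE.
  rewrite /F map_mxM -map_trmx -scalemxAl -scalemxAr !scalerA.
  by rewrite -[RHS]scale1r; congr (_ *: _); field.
move=> z; split.
  rewrite mul_col_mx col_mxKu; exists (U^T *m z) => //.
  by rewrite map_mxM.
move=> i; rewrite mul_col_mx col_mxKd -submxcol_mul mxcolK /F -scalemxAl.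
have -> : (map_mx intr (tnth (in_tuple Es) i))^T *m map_mx intr z =
    (map_mx intr (z^T *m tnth (in_tuple Es) i))^T :> 'cV[R]_8.
  by rewrite map_mxM trmx_mul -map_trmx trmxK.
apply: e8_vectorE8; have hEi := hE _ (mem_tnth i (in_tuple Es)).
rewrite mulmx_sum_row; apply: (big_ind e8_vector) => [|u v eu ev|l _].
- exact: e8_vector0.
- by rewrite -[u]scale1r; apply: e8_vector_comb.
- by rewrite -[_ *: _]addr0; apply: e8_vector_comb => //; exact: e8_vector0.
Qed.

(** * Extensions of a signed graph *)

Definition sg_sign (R : pzRingType) (G : signed_graph) (x y : G) : R :=
  if sg_adj x y then if sg_pos x y then 1 else -1 else 0.

Lemma qform_adj (R : realFieldType) (G : signed_graph) mu (v : 'rV[R]_#|G|) :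
  let g x := v 0 (enum_rank x) in
  qform (adj_mx R G - mu%:M) v =
  (\sum_x \sum_y g x * sg_sign R x y * g y) - mu * \sum_x g x ^+ 2.
Proof.
move=> g; rewrite qformB qform_scalar qform1; congr (_ - _ * _).
  rewrite /qform mxE (reindex (@enum_rank G)) /=; last exact: onW_bij (@enum_rank_bij G).
  rewrite [RHS]exchange_big; apply: eq_bigr => y _.
  rewrite [v^T _ _]mxE mxE mulr_suml (reindex (@enum_rank G)) /=; last exact: onW_bij (@enum_rank_bij G).
  by apply: eq_bigr => x _; rewrite mxE !enum_rankK.
by rewrite (reindex (@enum_rank G)) //=; exact: onW_bij (@enum_rank_bij G).
Qed.

Section Extension.
Variables (G : signed_graph) (phi : G -> int) (k : nat).

Let ext_vertex : finType := (G + 'I_k)%type.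

Let ext_adj (a b : ext_vertex) := match a, b with
  | inl x, inl y => sg_adj x y
  | inl x, inr _ | inr _, inl x => phi x != 0
  | inr i, inr j => i != j
  end.

Let ext_pos (a b : ext_vertex) := match a, b with
  | inl x, inl y => sg_pos x y
  | inl x, inr _ | inr _, inl x => 0 < phi x
  | inr _, inr _ => true
  end.

Fact ext_adj_irr : irreflexive ext_adj.
Proof. by case=> [x|i] /=; [exact: sg_adj_irr|rewrite eqxx]. Qed.

Fact ext_adj_sym : symmetric ext_adj.
Proof. by move=> [x|i] [y|j] //=; [exact: sg_adj_sym|rewrite eq_sym]. Qed.

Fact ext_pos_sym : symmetric ext_pos.
Proof. by move=> [x|i] [y|j] //=; exact: sg_pos_sym. Qed.

Fact ext_nonempty : (0 < #|ext_vertex|)%N.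
Proof. by rewrite card_sum ltn_addr // sg_nonempty. Qed.

(** In terms of Gram matrices, the new vertices are represented by a unit vector
[f] plus vectors orthogonal to each other and to everything else, where [phi] is
the inner product with [f]. *)
Definition sg_extension : signed_graph :=
  SignedGraph ext_adj_irr ext_adj_sym ext_pos_sym ext_nonempty.

Lemma card_sg_extension : #|sg_extension| = (#|G| + k)%N.
Proof. by rewrite card_sum card_ord. Qed.

Lemma sg_extension_connected x0 : phi x0 != 0 -> sg_connected G -> sg_connected sg_extension.
Proof.
move=> phi0 cG.
have sE : connect_sym (@sg_adj sg_extension) := sym_connect_sym ext_adj_sym.
have cl x y : connect (@sg_adj sg_extension) (inl x) (inl y).
  have /connectP[p + ->] := cG x y; elim: p x => [|z p IHp] x /=; first by rewrite connect0.
  by move=> /andP[xz /IHp]; apply: connect_trans; exact: connect1.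
have c0 a : connect (@sg_adj sg_extension) (inl x0) a.
  by case: a => [y|j]; [exact: cl|exact: connect1].
by move=> a b; apply: connect_trans (c0 b); rewrite sE.
Qed.

Lemma sg_extension_proper : (0 < k)%N -> sg_proper_induced G sg_extension.
Proof.
move=> k0; have [x0 _] : exists x0, x0 \in G by apply/card_gt0P; exact: sg_nonempty.
pose U : {set sg_extension} := [set inl x | x in G].
have inlU x : (inl x : sg_extension) \in U by apply: imset_f.
have U0 : U != set0 by apply/set0Pn; exists (inl x0).
exists U, U0; split.
  rewrite properT; apply/eqP => UT; have : (inr (Ordinal k0) : sg_extension) \in U by rewrite UT inE.
  by case/imsetP.
pose f (x : G) : sg_induced U0 := exist _ (inl x) (inlU x).
exists f; split=> //.
apply: inj_card_bij => [x y [//]|].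
rewrite card_sig card_imset //; exact: inl_inj.
Qed.

Variables (R : realType) (m : R).
Hypothesis phi_bound : forall x, `|phi x| <= 1.

Lemma sg_sign_extension x i : sg_sign R (inl x : sg_extension) (inr i) = (phi x)%:~R.
Proof.
rewrite /sg_sign /=; have := phi_bound x; case: eqP => [-> //|h] b.
have [->|->] : phi x = 1 \/ phi x = -1 by lia.
  by [].
by rewrite ltr0N1 mulrN1z.
Qed.

(** Completing the square: with [s] the sum of the entries of a vector at the new
vertices and [T] the product of [phi] with the remaining entries, the value of
the form of the extension, shifted by [m], is that of the shifted form of [G]
minus [T ^ 2], plus [(T + s) ^ 2], plus [m - 1] times the sum of the squares of
the new entries. *)
Lemma smallest_eigenvalue_extension : 1 <= m ->
  (forall g : G -> R, (\sum_x (phi x)%:~R * g x) ^+ 2 <=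
     (\sum_x \sum_y g x * sg_sign R x y * g y) + m * \sum_x g x ^+ 2) ->
  - m <= smallest_eigenvalue R sg_extension.
Proof.
move=> m1 psd; have [ev _] := smallest_eigenvalueP R sg_extension.
apply: eigenvalue_ge ev => v; rewrite qform_adj mulNr opprK.
pose u (a : sg_extension) := v 0 (enum_rank a).
change (0 <= (\sum_a \sum_b u a * sg_sign R a b * u b) + m * \sum_a u a ^+ 2).
rewrite big_sumType /= [X in _ + m * X]big_sumType /=.
under eq_bigr do rewrite big_sumType /=.
under [X in _ + X + _]eq_bigr do rewrite big_sumType /=.
rewrite !big_split /=.
set s := \sum_(j < k) u (inr j).
have mix : \sum_x \sum_(j < k) u (inl x) * sg_sign R (inl x : sg_extension) (inr j) * u (inr j) =
    (\sum_x (phi x)%:~R * u (inl x)) * s.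
  rewrite mulr_suml; apply: eq_bigr => x _; rewrite mulr_sumr; apply: eq_bigr => j _.
  by rewrite sg_sign_extension [u _ * _]mulrC.
have mix' : \sum_(j < k) \sum_x u (inr j) * sg_sign R (inr j : sg_extension) (inl x) * u (inl x) =
    (\sum_x (phi x)%:~R * u (inl x)) * s.
  rewrite -mix exchange_big; apply: eq_bigr => x _; apply: eq_bigr => j _.
  rewrite mulrAC [u _ * u _]mulrC mulrAC; congr (_ * _ * _).
have new : \sum_(j < k) \sum_(l < k) u (inr j) * sg_sign R (inr j : sg_extension) (inr l) * u (inr l) =
    s ^+ 2 - \sum_(j < k) u (inr j) ^+ 2.
  rewrite expr2 mulr_suml -sumrB; apply: eq_bigr => j _.
  rewrite mulr_sumr (bigD1 j) //= [in RHS](bigD1 j) //= addrAC expr2 subrr add0r.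
  rewrite {1}/sg_sign /= eqxx mulr0 mul0r add0r; apply: eq_bigr => l lj.
  by rewrite /sg_sign /= eq_sym lj mulr1.
rewrite mix mix' new.
have := psd (fun x => u (inl x)).
set T := \sum_x _ * _; set W := \sum_x u _ ^+ 2; set F := \sum_j u _ ^+ 2.
rewrite (_ : \sum_x \sum_y _ = \sum_x \sum_y u (inl x) * sg_sign R (inl x : sg_extension) (inl y) * u (inl y)) //.
set Q := \sum_x \sum_y _ => h.
have F0 : 0 <= (m - 1) * F.
  by rewrite mulr_ge0 ?subr_ge0 // sumr_ge0 // => j _; exact: sqr_ge0.
have := sqr_ge0 (T + s).
rewrite -subr_ge0 in h.
have -> : Q + T * s + (T * s + (s ^+ 2 - F)) + m * (W + F) =
  (Q + m * W - T ^+ 2) + (T + s) ^+ 2 + (m - 1) * F by ring.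
by move=> h2; exact: (addr_ge0 (addr_ge0 h h2) F0).
Qed.

End Extension.

Lemma sg_iso_card (G H : signed_graph) : sg_iso G H -> #|G| = #|H|.
Proof. by move=> [f [/bij_eq_card]]. Qed.

(** * Signed graphs with large valencies *)

Lemma representable_psd (R : realFieldType) n (B : 'M[int]_n) (v : 'rV[R]_n) :
  representable B -> 0 <= bform (map_mx intr B) v v.
Proof.
move=> /(@representable_lattice R)[d [k [Q [<- _]]]].
rewrite -{2}[Q]trmxK bform_gram; apply: sumr_ge0 => j _; rewrite -expr2; exact: sqr_ge0.
Qed.

(** The three main steps: limit vectors are split off, what remains is locally
positive semidefinite, and its diagonal is at most [- c - 1 <= 2] because each
vertex has a product plus or minus 1 with some limit vector. *)
Lemma sg_representation : exists kappa, forall (R : realType) (G : signed_graph) (c : int),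
  -3 <= c <= -1 -> (forall x : G, (kappa <= valency x)%N) ->
  (forall v, 0 <= qform (adj_mx R G - c%:~R%:M) v) ->
  exists s (Phi : 'M[int]_(#|G|, s)),
    [/\ forall x j, `|Phi x j| <= 1, forall x, exists j, Phi x j != 0,
        map_mx intr (adj_mx int G - c%:M) = adj_mx R G - c%:~R%:M
      & representable (adj_mx int G - c%:M - Phi *m Phi^T)].
Proof.
have [N hN] := representable_of_locally_psd; have [K hK] := locally_psd_of_norm1 N.
have [kappa hk] := limit_vectors K; exists kappa => R G c c3 val psd.
set A := adj_mx int G - c%:M.
have sA : A^T = A by rewrite linearB /= adj_mx_sym tr_scalar_mx.
have AE : map_mx intr A = adj_mx R G - c%:~R%:M.
  apply/matrixP => i j; rewrite !mxE rmorphB /= rmorphMn /=; congr (_ - _).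
  by case: ifP => _; [case: ifP => _|]; rewrite ?rmorphN1 ?rmorph0 ?rmorph1.
have dA i : A i i = - c by rewrite !mxE sg_adj_irr eqxx sub0r.
have oA i j : i != j -> A i j = sg_sign int (enum_val i) (enum_val j).
  by move=> ij; rewrite !mxE (negbTE ij) mulr0n subr0.
have [|||||s [Phi [b nz hPhi]]] := hk _ A (- c) sA.
- by move=> w; rewrite -(ler_int R) -bform_map AE; exact: psd.
- by lia.
- exact: dA.
- by move=> i j /oA ->; rewrite /sg_sign; case: ifP => _; [case: ifP => _|].
- move=> x; apply: leq_trans (val (enum_val x)) _.
  rewrite /valency -(card_imset _ (@enum_rank_inj G)); apply/subset_leq_card/subsetP => _ /imsetP[y + ->].
  rewrite !inE => xy; have yx : enum_rank y != x.
    by apply: contraTneq xy => <-; rewrite enum_rankK sg_adj_irr.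
  rewrite yx oA 1?eq_sym // enum_rankK /sg_sign xy; by case: ifP.
have sB : (A - Phi *m Phi^T)^T = A - Phi *m Phi^T by rewrite linearB /= sA trmx_mul trmxK.
have dB i : (A - Phi *m Phi^T) i i <= 2.
  rewrite -bform_delta bformB bform_gram bform_delta dA.
  have [j nzj] := nz i; rewrite (bigD1 j) //= -rowE mxE.
  have : 0 <= \sum_(l < s | l != j) row i Phi 0 l * row i Phi 0 l.
    by apply: sumr_ge0 => l _; rewrite -expr2 sqr_ge0.
  have [->|->] : Phi i j = 1 \/ Phi i j = -1 by have := b i j; lia.
    by move: (\sum_(l < s | _) _) => S; lia.
  by move: (\sum_(l < s | _) _) => S; lia.
by exists s, Phi; split=> //; apply: hN => //; exact: hK.
Qed.

(** The two ends of an edge, with the opposite of its sign, form a vector with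
Rayleigh quotient -1. *)
Lemma smallest_eigenvalue_le_N1 (R : realType) (G : signed_graph) (x y : G) :
  sg_adj x y -> smallest_eigenvalue R G <= -1.
Proof.
move=> xy; have := @smallest_eigenvalue_psd R G; set l := smallest_eigenvalue R G.
set M := adj_mx R G - l%:M => psd.
have sM : M^T = M by rewrite linearB /= adj_mx_sym tr_scalar_mx.
set i := enum_rank x; set j := enum_rank y.
have ij : i != j by apply: contraTneq xy => /enum_rank_inj ->; rewrite sg_adj_irr.
have dM a : M a a = - l by rewrite !mxE sg_adj_irr eqxx sub0r.
have ME : M i j = sg_sign R x y by rewrite !mxE (negbTE ij) mulr0n subr0 !enum_rankK.
have M2 : M i j ^+ 2 = 1 by rewrite ME /sg_sign xy; case: ifP => _; rewrite ?sqrrN expr1n.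
have := psd (1 *: delta_mx 0 i + (- M i j) *: delta_mx 0 j).
rewrite /qform -/(bform M _ _) (bform_lin2 sM) !bform_delta !dM sqrrN M2 expr1n !mul1r mulNr -expr2 M2.
by move=> h; clear -h; lra.
Qed.

Theorem theorem1p7 (R : realType) :
  exists kappa4 : nat, (0 < kappa4)%N /\
    forall G : signed_graph,
      sg_connected G ->
      -3 <= smallest_eigenvalue R G ->
      (forall x : G, (kappa4 <= valency x)%N) ->
      [/\ exists n k : nat,
            forall (m : nat) (L : set 'cV[R]_m),
              associated_lattice G L ->
              exists2 L' : set 'cV[R]_(n + \sum_(i < k) 8),
                sublattice L'
                  (lattice_dsum (Zlattice R n)
                     (lattice_copies (E8 R) k))
                & lattice_iso L L',
          exists H : nat -> signed_graph,
            (forall i, [/\ sg_connected (H i),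
                           -3 <= smallest_eigenvalue R (H i)
                         & sg_proper_induced G (H i)])
            /\ (forall i j, i <> j -> ~ sg_iso (H i) (H j))
        & sg_extendable R G].
Proof.
have [kappa hk] := sg_representation; exists kappa.+1; split=> // G cG lam val.
set l := smallest_eigenvalue R G in lam *; pose c := Num.floor l.
have [x0 _] : exists x0, x0 \in G by apply/card_gt0P; exact: sg_nonempty.
have l1 : l <= -1.
  have : (0 < valency x0)%N by apply: leq_trans (val x0).
  by rewrite card_gt0 => /set0Pn[y]; rewrite inE; exact: smallest_eigenvalue_le_N1.
have c3 : -3 <= c <= -1.
  apply/andP; split; first by rewrite floor_ge_int; exact: lam.
  rewrite -(ler_int R); exact: le_trans (floor_le _) l1.
have [||s [Phi [b nz AE rB]]] := hk R G c c3.
- by move=> x; apply: leq_trans (val x).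
- move=> v; apply: le_trans (smallest_eigenvalue_psd v) _; rewrite !qformB (qform_scalar c%:~R) (qform_scalar l).
  rewrite lerD2l lerN2 ler_wpM2r ?floor_le //.
  by rewrite qform1 sumr_ge0 // => i _; exact: sqr_ge0.
set A := adj_mx int G - c%:M in AE rB.
set B := A - Phi *m Phi^T in rB.
have AB : A = B + Phi *m Phi^T by rewrite subrK.
have [j0 nz0] := nz (enum_rank x0).
pose phi x := Phi (enum_rank x) j0.
pose H i := sg_extension phi i.+1.
have HP i : [/\ sg_connected (H i), c%:~R <= smallest_eigenvalue R (H i) & sg_proper_induced G (H i)].
  split; [exact: sg_extension_connected nz0 cG| |exact: sg_extension_proper].
  rewrite -[c%:~R]opprK; apply: smallest_eigenvalue_extension => [x||g]; first exact: b.
    by rewrite -rmorphN /= -[1]/(1%:~R) ler_int; lia.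
  pose v : 'rV[R]_#|G| := \row_i g (enum_val i).
  have gE x : v 0 (enum_rank x) = g x by rewrite mxE enum_rankK.
  have -> : (\sum_x \sum_y g x * sg_sign R x y * g y) + - c%:~R * (\sum_x g x ^+ 2) =
      bform (map_mx intr A) v v.
    rewrite AE [RHS]qform_adj mulNr; congr (_ - _ * _).
      by apply: eq_bigr => x _; apply: eq_bigr => y _; rewrite !gE.
    by apply: eq_bigr => x _; rewrite gE.
  rewrite AB map_mxD map_mxM -map_trmx /bform mulmxDr mulmxDl mxE -!/(bform _ _ _).
  rewrite bform_gram (bigD1 j0) //= -expr2 addrCA.
  have -> : (v *m map_mx intr Phi) 0 j0 = \sum_x (phi x)%:~R * g x.
    rewrite mxE (reindex (@enum_rank G)) /=; last exact: onW_bij (@enum_rank_bij G).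
    by apply: eq_bigr => x _; rewrite gE mxE mulrC.
  rewrite lerDl addr_ge0 ?representable_psd //.
  by apply: sumr_ge0 => j _; rewrite -expr2; exact: sqr_ge0.
split.
- have [d [k [Q [QA QL]]]] := representable_lattice R (representableD rB (representable_gram Phi)).
  exists d, k => m L [N NA ->]; exists (column_lattice Q); first exact: column_lattice_sublattice.
  by apply: column_lattice_iso; rewrite -NA QA -AB AE.
- exists H; split=> [i|i j ij /sg_iso_card].
    have [h1 h2 h3] := HP i; split=> //; apply: le_trans h2.
    by rewrite -[-3]/((-3)%:~R) ler_int; case/andP: c3.
  by rewrite !card_sg_extension => /addnI[].
- by apply; exists (H 0%N); have [h1 h2 h3] := HP 0%N.
Qed.
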